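(* There is an algorithm which, given a finite set $V$ of $n$ vertices, an integer $\ell\ge0$, an $\ell$-bounded weight function $w:V^2\to\mathbb{N}$ and a positive integer $s$, computes the number of proper assignments $c:V\to\{1,\dots,s\}$ in time $O^*(2^n(\ell+1)^{n/2})$, where $O^*$ suppresses factors polynomial in the input size.
   Context: $\mathbb{N}=\{0,1,2,\dots\}$. A weight function is a symmetric function $w:V^2\to\mathbb{N}$; it is $\ell$-bounded if $w(x,y)\le\ell$ for all $x,y\in V$. An assignment $c:V\to\{1,\dots,s\}$ is proper if $|c(x)-c(y)|\ge w(x,y)$ for every pair of distinct vertices $x,y\in V$; $s$ is called the span of $c$. *)

(* Defs.v *)
From mathcomp Require Import all_boot all_order all_algebra.
From mathcomp Require Import reals exp.

Set Implicit Arguments.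
Unset Strict Implicit.
Unset Printing Implicit Defensive.

Import Order.TTheory GRing.Theory Num.Theory.

Local Open Scope nat_scope.

(******************************************************************************)
(* Model of computation: a random access machine with logarithmic cost,       *)
(* presented as a structured language. A program uses finitely many arrays of *)
(* natural numbers, each indexed by all of nat; the name of an array is a     *)
(* constant of the program. Numbers are unbounded, but an operation is charged*)
(* the binary lengths of its operands and of its result, and a memory access  *)
(* is charged the binary lengths of the index and of the contents.            *)
(******************************************************************************)

(* bitlen 0 = 1 *)
Definition bitlen (a : nat) : nat := (trunc_log 2 a).+1.

Inductive binop := Add | Sub | Mul | Div | Mod.

Definition binop_fun (o : binop) : nat -> nat -> nat :=
  match o with
  | Add => addn
  | Sub => subn
  | Mul => muln
  | Div => divn
  | Mod => modn
  end.

Inductive expr :=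
  | Const of nat
  | Read of nat & expr            (* Read a i: the i-th cell of array a *)
  | Op of binop & expr & expr.

Inductive com :=
  | Skip
  | Write of nat & expr & expr    (* Write a i e: cell i of array a := e *)
  | Seq of com & com
  | If of expr & com & com        (* nonzero means true *)
  | While of expr & com.

Definition memory := nat -> nat -> nat.

Definition update (m : memory) (a i v : nat) : memory :=
  fun b j => if (b == a) && (j == i) then v else m b j.

Fixpoint eval (m : memory) (e : expr) : nat :=
  match e with
  | Const c => c
  | Read a i => m a (eval m i)
  | Op o e1 e2 => binop_fun o (eval m e1) (eval m e2)
  end.

(* The sum, over all nodes of e, of the binary length of the value there. *)
Fixpoint ecost (m : memory) (e : expr) : nat :=
  bitlen (eval m e) +
  match e with
  | Const _ => 0
  | Read _ i => ecost m i
  | Op _ e1 e2 => ecost m e1 + ecost m e2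
  end.

(* exec p m t m': started in memory m, p halts in time t with memory m'. *)
Inductive exec : com -> memory -> nat -> memory -> Prop :=
  | ExecSkip m : exec Skip m 1 m
  | ExecWrite m a i e :
      exec (Write a i e) m (ecost m i + ecost m e)
           (update m a (eval m i) (eval m e))
  | ExecSeq p q m m' m'' t t' :
      exec p m t m' -> exec q m' t' m'' -> exec (Seq p q) m (t + t') m''
  | ExecIfTrue e p q m m' t :
      eval m e != 0 -> exec p m t m' -> exec (If e p q) m (ecost m e + t) m'
  | ExecIfFalse e p q m m' t :
      eval m e = 0 -> exec q m t m' -> exec (If e p q) m (ecost m e + t) m'
  | ExecWhileTrue e p m m' m'' t t' :
      eval m e != 0 -> exec p m t m' -> exec (While e p) m' t' m'' ->
      exec (While e p) m (ecost m e + t + t') m''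
  | ExecWhileFalse e p m :
      eval m e = 0 -> exec (While e p) m (ecost m e) m.

(* The input is stored in array 0; all other cells are initially 0. *)
Definition init_memory (x : seq nat) : memory :=
  fun a i => if a == 0 then nth 0 x i else 0.

(* On input x, p halts in time t with the output y in cell 0 of array 0. *)
Definition computes (p : com) (x : seq nat) (t y : nat) : Prop :=
  exists m, exec p (init_memory x) t m /\ m 0 0 = y.

Definition input_size (x : seq nat) : nat := \sum_(a <- x) bitlen a.

Section Channel.

Variable V : finType.

Definition weight_function (w : V -> V -> nat) : Prop :=
  forall x y, w x y = w y x.

Definition bounded_by (l : nat) (w : V -> V -> nat) : Prop :=
  forall x y, w x y <= l.

Definition proper_assignment (w : V -> V -> nat) (c : V -> nat) : bool :=
  [forall x, forall y, (x != y) ==> (w x y <= `|c x - c y|)].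

(* {1, ..., s} is the set of nonzero elements of 'I_s.+1. *)
Definition num_proper (s : nat) (w : V -> V -> nat) : nat :=
  #|[set c : {ffun V -> 'I_s.+1} |
       [forall x, 0 < c x] && proper_assignment w (fun x => c x : nat)]|.

(* n, l, s and then the n x n matrix of w row by row, where the vertices are  *)
(* listed in the order of enum V.                                             *)
Definition encode (l s : nat) (w : V -> V -> nat) : seq nat :=
  [:: #|V|, l, s & [seq w x y | x <- enum V, y <- enum V]].

End Channel.

(* Main.v *)
Require Import Defs.
From mathcomp Require Import all_boot all_order all_algebra.
From mathcomp Require Import reals exp.
From mathcomp Require Import zify.

(* The vertices are placed in increasing order of colour, ties being broken by the
   index: with wt u x = max (w u x, [x < u]), vertex u precedes x iff
   c u + wt u x <= c x. A state records the vertex v to be placed next, the earliest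
   position p for it, and for each of the k other vertices still waiting a lower bound
   on its colour, which lies in [p, p + l]. Partial assignments that lead to the same
   state are merged, keeping only their number. With j = n - 1 - k vertices placed, the
   bounds are determined by p and the distances from p to the colours of the j placed
   vertices, truncated at l. Hence there are, up to polynomial factors and a factor l + 1
   for p, at most 2^n (l+1)^min(j, k) states, which is enough unless j = k. In that case
   (2 j + 1 = n), move v at once to the next position at which some bound changes: then
   a state either has a bound that equals p + wt v x, so that only k - 1 bounds are
   free, or stems directly from a state with j - 1 vertices placed.

   The span s may be exponential in the input size. But if all bounds equal p + wt v x,
   then v may be shifted, together with all that follows, by an arbitrary gap; such
   free gaps are only counted (r of them), so that p never exceeds n l + 1, and a last
   vertex at p contributes C(s + 1 - p + r, r + 1). The states are processed in the order
   of (j, p), from stacks in a sparse memory addressed by the keys of the states. *)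

Set Implicit Arguments.
Unset Strict Implicit.
Unset Printing Implicit Defensive.

(** * Counting the completions of a state *)

(** Tie-breaking gives every proper assignment exactly one order of placement; otherwise vertices of
    equal colour and weight 0 would be counted once per order. Merging is sound because the number
    of completions depends on the state alone: the result so far plus the sum, over the pending
    states, of multiplicity times number of completions is constantly the answer. Successors have
    larger rank, so a multiplicity is final once its state is taken from a stack. Free gaps work by
    translation. If all bounds are tight, moving [v] up by [g] moves all of them by [g], which
    amounts to shortening the span by [g]; summing over [g] is a prefix sum in the span, and [r]
    prefix sums of [s + 1 - p] give the binomial coefficient. Logarithmic cost also requires
    multiplicities of polynomial length. The answer at span [s] does not bound them, since a state
    may have no completion there. So the same weighted sum is followed at a larger span at which
    every state has a completion; each multiplicity is then at most the number of assignments with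
    that span. *)

Section Count.
Variables (n : nat) (wt : nat -> nat -> nat).

(* [h x = 0] says that x is placed already; otherwise [h x] is a lower bound on its
   colour. [clip_bound h e u q]: e has just been placed (no vertex if [e = n]), u comes
   next, at position q or later. [place_bound h u q]: u has just been placed at q. *)
Definition clip_bound (h : nat -> nat) (e u q : nat) : nat -> nat :=
  fun x => if x == u then q else
           if (h x == 0) || (x == e) then 0 else maxn (h x) (q + wt u x).

Definition place_bound (h : nat -> nat) (u q : nat) : nat -> nat :=
  fun x => if (x == u) || (h x == 0) then 0 else maxn (h x) (q + wt u x).

Definition num_placed (h : nat -> nat) := \sum_(x < n) (h x == 0).

(** The order of placement is summed over explicitly; that every assignment is thereby counted once
    is the content of [card_fits]. *)
Fixpoint completions (k : nat) (h : nat -> nat) (s : nat) : nat :=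
  if k is k'.+1 then
    \sum_(u < n | h u != 0) \sum_(h u <= q < s.+1) completions k' (place_bound h u q) s
  else 1.

(* Prefix sums: a free gap of arbitrary length shortens the span left. *)
Definition psum (f : nat -> nat) (s : nat) : nat := \sum_(y < s.+1) f y.

Definition stval0 (v : nat) (h : nat -> nat) (s : nat) : nat :=
  \sum_(h v <= q < s.+1) completions (n - num_placed h).-1 (place_bound h v q) s.

Definition stval (v r : nat) (h : nat -> nat) : nat -> nat :=
  iter r psum (stval0 v h).

Definition eqn_lt (h h' : nat -> nat) := forall x, x < n -> h x = h' x.

Lemma place_ext h h' u q : eqn_lt h h' -> eqn_lt (place_bound h u q) (place_bound h' u q).
Proof. by move=> E x xn; rewrite /place_bound E. Qed.

Lemma num_placed_ext h h' : eqn_lt h h' -> num_placed h = num_placed h'.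
Proof. by move=> E; apply: eq_bigr => x _; rewrite E. Qed.

Lemma completions_ext k h h' s : eqn_lt h h' -> completions k h s = completions k h' s.
Proof.
elim: k h h' => //= k IH h h' E.
apply: eq_big => [u|u _]; rewrite E //.
by apply: eq_bigr => q _; apply/IH/place_ext.
Qed.

Lemma psum_ext f g : f =1 g -> psum f =1 psum g.
Proof. by move=> E s; apply: eq_bigr => y _; rewrite E. Qed.

Lemma iter_psum_ext r f g : f =1 g -> iter r psum f =1 iter r psum g.
Proof. by elim: r => //= r IH E; apply/psum_ext/IH. Qed.

Lemma stval_ext v r h h' s : v < n -> eqn_lt h h' -> stval v r h s = stval v r h' s.
Proof.
move=> vn E; apply: iter_psum_ext => y; rewrite /stval0 E // (num_placed_ext E).
by apply: eq_bigr => q _; apply/completions_ext/place_ext.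
Qed.

Lemma psumD f g : psum (fun s => f s + g s) =1 (fun s => psum f s + psum g s).
Proof. by move=> s; rewrite /psum big_split. Qed.

Lemma iter_psumD r f g :
  iter r psum (fun s => f s + g s) =1 (fun s => iter r psum f s + iter r psum g s).
Proof. by elim: r => //= r IH s; rewrite (psum_ext IH) psumD. Qed.

Lemma iter_psumM r c f :
  iter r psum (fun s => c * f s) =1 (fun s => c * iter r psum f s).
Proof.
elim: r => //= r IH s; rewrite (psum_ext IH) /psum.
by rewrite -big_distrr.
Qed.

Lemma iter_psum_sum (I : Type) (t : seq I) (P : pred I) r (F : I -> nat -> nat) s :
  iter r psum (fun s => \sum_(i <- t | P i) F i s) s =
  \sum_(i <- t | P i) iter r psum (F i) s.
Proof.
elim: r s => //= r IH s; rewrite (psum_ext IH) /psum exchange_big //=.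
Qed.

Lemma leq_psum f s : f s <= psum f s.
Proof. by rewrite /psum big_ord_recr /= leq_addl. Qed.

Lemma leq_iter_psum r f s : f s <= iter r psum f s.
Proof. by elim: r => //= r IH; apply: leq_trans IH (leq_psum _ _). Qed.

(* The hockey-stick identity. *)
Lemma psum_bin p r s : psum (fun s => 'C(s.+1 - p + r, r.+1)) s = 'C(s.+1 - p + r.+1, r.+2).
Proof.
rewrite /psum; elim: s => [|s IH].
  rewrite big_ord_recr big_ord0 /= add0n.
  case: p => [|p]; first by rewrite subn0 !add1n !binn.
  by rewrite subSS sub0n !add0n !bin_small.
rewrite big_ord_recr /= IH.
case: (leqP p s.+1) => ps.
  by rewrite (subSn ps) !addSn !addnS [in RHS]binS.
have -> : s.+1 - p = 0 by lia.
have -> : s.+2 - p = 0 by lia.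
by rewrite !add0n !bin_small.
Qed.

Lemma iter_psum_bin p r s : iter r psum (fun s => s.+1 - p) s = 'C(s.+1 - p + r, r.+1).
Proof.
elim: r s => [|r IH] s; first by rewrite addn0 bin1.
by rewrite /= (psum_ext IH) psum_bin.
Qed.

Lemma num_placed_live h x : x < n -> h x != 0 -> num_placed h < n.
Proof.
move=> xn hx; rewrite /num_placed (bigD1 (Ordinal xn)) //= (negbTE hx) add0n.
apply: leq_ltn_trans (_ : \sum_(i < n | i != Ordinal xn) 1 < n).
  by apply: leq_sum => i _; case: (_ == _).
by rewrite sum1_card cardC1 card_ord; lia.
Qed.

Lemma num_placed_live2 h x y :
  x < n -> y < n -> x != y -> h x != 0 -> h y != 0 -> (num_placed h).+1 < n.
Proof.
move=> xn yn xy hx hy; have yx : Ordinal yn != Ordinal xn by rewrite eq_sym.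
rewrite /num_placed (bigD1 (Ordinal xn)) //= (negbTE hx) add0n.
rewrite (bigD1 (Ordinal yn)) //= (negbTE hy) add0n.
apply: leq_ltn_trans (_ : (\sum_(i < n | (i != Ordinal xn) && (i != Ordinal yn)) 1).+1 < n).
  by apply: leq_sum => i _; case: (_ == _).
have : \sum_(i < n) 1 = n by rewrite sum1_card card_ord.
rewrite (bigD1 (Ordinal xn)) //= (bigD1 (Ordinal yn)) //=.
by move=> E; rewrite -[X in _ < X]E !add1n.
Qed.

Lemma num_placed_ltP h : num_placed h < n -> exists2 x, x < n & h x != 0.
Proof.
move=> zn; case: (boolP [exists x : 'I_n, h x != 0]) => [/existsP[x hx]|].
  by exists x.
rewrite negb_exists => /forallP H; move: zn.
rewrite /num_placed (eq_bigr (fun=> 1)); first by rewrite sum1_card card_ord ltnn.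
by move=> i _; have := H i; rewrite negbK => ->.
Qed.

Lemma num_placed_lt2P h v : v < n -> h v != 0 -> (num_placed h).+1 < n ->
  exists x, [/\ x < n, x != v & h x != 0].
Proof.
move=> vn hv zn.
case: (boolP [exists x : 'I_n, (x != v :> nat) && (h x != 0)]) => [/existsP[x /andP[xv hx]]|].
  by exists x.
rewrite negb_exists => /forallP H; move: zn.
have : \sum_(i < n) 1 = n by rewrite sum1_card card_ord.
rewrite (bigD1 (Ordinal vn)) //= => E.
rewrite /num_placed (bigD1 (Ordinal vn)) //= (negbTE hv) add0n.
rewrite (eq_bigr (fun=> 1)) => [|i iv]; first by rewrite -[X in _ < X]E ltnn.
have := H i; rewrite negb_and negbK => /orP[/eqP Ei|]; last by rewrite negbK => ->.
by case/eqP: iv; apply: val_inj.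
Qed.

Lemma num_placed_place h u q : u < n -> h u != 0 -> num_placed (place_bound h u q) = (num_placed h).+1.
Proof.
move=> un hu; rewrite /num_placed (bigD1 (Ordinal un)) //= [in RHS](bigD1 (Ordinal un)) //=.
rewrite (negbTE hu) add0n /place_bound eqxx /= add1n; congr _.+1.
apply: eq_bigr => i iu.
have -> : (i == u :> nat) = false by apply/negbTE; apply: contra iu => /eqP E; apply/eqP/val_inj.
by rewrite /=; case: (eqVneq (h i) 0) => // hi; rewrite -lt0n in hi; congr nat_of_bool; apply/eqP; lia.
Qed.

(** Only differences of positions matter, so bounds and span may be translated together. The entries
    0 are marks and stay. *)
Lemma completions_shift k h h' g s :
  (forall x, x < n -> h' x = if h x == 0 then 0 else h x + g) ->
  completions k h' (s + g) = completions k h s.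
Proof.
elim: k h h' => //= k IH h h' E.
apply: eq_big => [u|u].
  by rewrite E //; case: (h u) => // z; rewrite addSn.
rewrite E // => hu0; have hu : h u != 0 by move: hu0; case: (eqVneq (h u) 0).
rewrite (negbTE hu) -addSn big_addn addnK.
apply: eq_bigr => q _; apply: IH => x xn; rewrite /place_bound E //.
case: (eqVneq (h x) 0) => hx; first by rewrite eqxx orbT.
rewrite orbF; case: (eqVneq x u) => xu //=.
have -> : (h x + g == 0) = false by lia.
have -> : (maxn (h x) (q + wt u x) == 0) = false by lia.
by rewrite addn_maxl addnAC.
Qed.

(** At least one vertex must be waiting: with none, [completions] is 1 whatever the span. *)
Lemma completions_eq0 k h s : (forall x, x < n -> h x != 0 -> s < h x) -> completions k.+1 h s = 0.
Proof.
move=> H; rewrite /= big1 // => u hu.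
by rewrite big_geq // H.
Qed.

Variable l : nat.
Hypothesis wt_le : forall u x, u < n -> x < n -> wt u x <= l.

(** Greedy placement: a vertex put at its own bound raises the maximum [t] of the bounds by at most
    [l]. *)
Lemma completions_gt0 k h s t : k = n - num_placed h ->
  (forall x, x < n -> h x <= t) -> t + k * l <= s -> 0 < completions k h s.
Proof.
elim: k h t => //= k IH h t Ek Ht ts.
have [u un hu] : exists2 x, x < n & h x != 0 by apply: num_placed_ltP; lia.
rewrite (bigD1 (Ordinal un)) //= addn_gt0; apply/orP; left.
have hs : h u < s.+1 by have := Ht u un; lia.
rewrite big_ltn // addn_gt0; apply/orP; left.
apply: (IH _ (t + l)); first by rewrite num_placed_place //; lia.
  move=> x xn; rewrite /place_bound; case: ifP => // _.
  have := Ht x xn; have := Ht u un; have := wt_le un xn; lia.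
by rewrite -addnA -mulSn.
Qed.

(** The weights of [v] are already built into the other bounds, so placing [v] at [h v] changes none
    of them. *)
Definition leads (v : nat) (h : nat -> nat) :=
  forall x, x < n -> x != v -> h x != 0 -> h v + wt v x <= h x.

Lemma stval_gt0 v r h s t : v < n -> h v != 0 ->
  (forall x, x < n -> h x <= t) -> t + n * l <= s -> 0 < stval v r h s.
Proof.
move=> vn hv Ht ts; apply: leq_trans (leq_iter_psum _ _ _).
have hs : h v < s.+1 by have := Ht v vn; lia.
rewrite /stval0 big_ltn // addn_gt0; apply/orP; left.
have zn := num_placed_live vn hv.
apply: (@completions_gt0 _ _ _ (t + l)).
- by rewrite num_placed_place //; lia.
- move=> x xn; rewrite /place_bound; case: ifP => // _.
  have := Ht x xn; have := Ht v vn; have := wt_le vn xn; lia.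
- rewrite -addnA -mulSn; apply: leq_trans ts; rewrite leq_add2l leq_mul2r; apply/orP; right; lia.
Qed.

Lemma num_placed_clip h e u q : u < n -> h u != 0 -> q != 0 -> e < n -> e != u -> h e != 0 ->
  num_placed (clip_bound h e u q) = (num_placed h).+1.
Proof.
move=> un hu q0 en eu he; rewrite -(num_placed_place 0 en he).
apply: eq_bigr => x _; rewrite /clip_bound /place_bound.
case: (eqVneq (x : nat) u) => [->|xu].
  by rewrite (negbTE q0) (negbTE hu) orbF [u == e]eq_sym (negbTE eu); congr nat_of_bool; lia.
rewrite orbC; case: ifP => // /norP[_ hx]; congr nat_of_bool; lia.
Qed.
End Count.

(** * Recurrences for the value of a state *)

Section Step.
Variables (n : nat) (wt : nat -> nat -> nat).
Notation clip := (clip_bound wt).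
Notation place := (place_bound wt).
Notation G := (completions n wt).
Notation stval := (stval n wt).
Notation stval0 := (stval0 n wt).
Notation zer := (num_placed n).

Lemma stval_last v r h s : zer h = n.-1 -> stval v r h s = 'C(s.+1 - h v + r, r.+1).
Proof.
move=> zh; rewrite -iter_psum_bin; apply: iter_psum_ext => y.
rewrite /stval0 zh (_ : (n - n.-1).-1 = 0) /=; last lia.
by rewrite sum_nat_const_nat muln1.
Qed.

(** Since [v] leads, placing it at [h v] leaves the other bounds alone. Once [u] is chosen to
    follow, the remaining bounds may be raised to [h u + wt u x] at once: [u] goes to [h u] or
    later, which would raise them at least as far. *)
Lemma stval0_succ v h s : v < n -> h v != 0 -> leads n wt v h -> (zer h).+1 < n ->
  G (n - zer h).-1 (place h v (h v)) s =
  \sum_(u < n | (u != v :> nat) && (h u != 0)) stval0 u (clip h v u (h u)) s.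
Proof.
move=> vn hv L zn; have -> : (n - zer h).-1 = (n - (zer h).+2).+1 by lia.
have Ep x : x < n -> place h v (h v) x = if x == v then 0 else h x.
  move=> xn; rewrite /place; case: (eqVneq x v) => //= xv.
  by case: (eqVneq (h x) 0) => //= hx; apply/maxn_idPl/L.
apply: eq_big => [u|u]; first by rewrite Ep //; case: (eqVneq (u : nat) v).
rewrite Ep //; case: (eqVneq (u : nat) v) => [_|uv hu]; first by rewrite eqxx.
rewrite /stval0 num_placed_clip // 1?eq_sym // {1}/clip_bound eqxx.
have -> : (n - (zer h).+1).-1 = n - (zer h).+2 by lia.
rewrite big_nat_cond [RHS]big_nat_cond; apply: eq_bigr => q /andP[/andP[hq _] _].
apply: completions_ext => x xn; rewrite [in LHS]/place_bound -/(place h v (h v) x) Ep // /place /clip /clip_bound.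
case: (eqVneq x u) => //= xu; case: (eqVneq x v) => xv /=; first by rewrite ?orbT.
rewrite orbF; case: (eqVneq (h x) 0) => //= hx.
by repeat case: ifP; lia.
Qed.

(** All bounds being tight, [v] at [h v + g] leaves the bounds of [v] at [h v] translated by [g]. By
    [completions_shift] this is position [h v] with span [s - g], and the sum over [g] is one more
    prefix sum. *)
Lemma stval_gap v r h s : v < n -> h v != 0 -> (zer h).+1 < n ->
  (forall x, x < n -> x != v -> h x != 0 -> h x = h v + wt v x) ->
  stval v r h s =
  \sum_(u < n | (u != v :> nat) && (h u != 0)) stval u r.+1 (clip h v u (h u)) s.
Proof.
move=> vn hv zn T.
have L : leads n wt v h by move=> x xn xv hx; rewrite (T x).
rewrite -iter_psum_sum iterSr; apply: iter_psum_ext => {}s.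
rewrite (psum_ext (g := G (n - zer h).-1 (place h v (h v)))); last first.
  by move=> y; rewrite stval0_succ.
set h1 := place h v (h v); set k := (n - zer h).-1.
have k0 : k = k.-1.+1 by rewrite /k; lia.
have hx1 x : x < n -> h1 x != 0 -> h v <= h1 x.
  move=> xn; rewrite /h1 /place_bound; case: ifP => //= /norP[xv hx] _.
  by lia.
have big0 y : y < h v -> G k h1 y = 0.
  by move=> yv; rewrite k0; apply: completions_eq0 => x xn /hx1 -/(_ xn); apply: leq_trans.
(* The prefix sum is read backwards, so that its index becomes the length of the gap; the terms with
   remaining span below [h v] vanish. *)
rewrite /psum -(big_mkord xpredT (fun y => G k h1 y)) big_nat_rev /= add0n.
rewrite (big_cat_nat _ (n := s.+1 - h v)) ?leq_subr //=.
rewrite [X in _ = _ + X]big_nat_cond [X in _ = _ + X]big1 ?addn0; last first.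
  by move=> y; rewrite andbT => /andP[y1 y2]; apply: big0; lia.
rewrite /stval0 -{1}[h v]add0n big_addn; rewrite big_nat_cond [RHS]big_nat_cond.
apply: eq_bigr => g; rewrite andbT => /andP[_ gs].
rewrite -[in LHS](@subnK g s); last lia.
have -> : s.+1 - g.+1 = s - g by lia.
apply: completions_shift => x xn; rewrite /h1 /place_bound; case: (eqVneq x v) => //= xv.
case: (eqVneq (h x) 0) => //= hx; rewrite (T x) // maxnn.
by case: eqVneq => //; move: hv; rewrite -lt0n; lia.
Qed.

(** At each of the first [d] positions [v] imposes nothing beyond the present bounds, which gives
    [d] equal terms. The later positions form the state with [v] moved to [h v + d]; there [n]
    stands for no vertex placed. *)
Lemma stval_chain v r h d s : v < n -> h v != 0 -> (zer h).+1 < n ->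
  leads n wt v h -> 0 < d ->
  (forall x, x < n -> x != v -> h x != 0 -> h v + d.-1 + wt v x <= h x) ->
  stval v r h s =
  d * (\sum_(u < n | (u != v :> nat) && (h u != 0)) stval u r (clip h v u (h u)) s)
  + stval v r (clip h n v (h v + d)) s.
Proof.
move=> vn hv zn L d0 T.
rewrite -iter_psum_sum -iter_psumM -iter_psumD; apply: iter_psum_ext => {}s.
rewrite -stval0_succ //.
set h1 := place h v (h v); set k := (n - zer h).-1.
have k0 : k = k.-1.+1 by rewrite /k; lia.
have hx1 x : x < n -> h1 x != 0 -> h v + d.-1 <= h1 x.
  move=> xn; rewrite /h1 /place_bound; case: ifP => //= /norP[xv hx] _.
  by have := T x xn xv hx; lia.
have zc : zer (clip h n v (h v + d)) = zer h.
  apply: eq_bigr => x _; rewrite /clip /clip_bound; case: (eqVneq (x : nat) v) => [->|xv].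
    by rewrite (negbTE hv); case: eqP => //; lia.
  rewrite (_ : (x == n :> nat) = false) ?orbF; last by apply/eqP; have := ltn_ord x; lia.
  by case: (eqVneq (h x) 0) => //= hx; case: eqP => //; lia.
rewrite [in X in _ = _ + X]/stval0 zc -/k {1}/clip_bound eqxx.
have E2 : \sum_(h v + d <= q < s.+1) G k (place (clip h n v (h v + d)) v q) s =
   \sum_(h v + d <= q < s.+1) G k (place h v q) s.
  rewrite big_nat_cond [RHS]big_nat_cond; apply: eq_bigr => q /andP[/andP[hq _] _].
  apply: completions_ext => x xn; rewrite /place /place_bound /clip /clip_bound.
  case: (eqVneq x v) => //= xv.
  rewrite (_ : (x == n) = false) ?orbF; last lia.
  by case: (eqVneq (h x) 0) => //= hx; case: eqVneq; lia.
rewrite E2 /stval0 -/k.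
have E1 q : h v <= q -> q < h v + d -> G k (place h v q) s = G k h1 s.
  move=> q1 q2; apply: completions_ext => x xn; rewrite /h1 /place_bound.
  case: (eqVneq x v) => //= xv; case: (eqVneq (h x) 0) => //= hx.
  by have := T x xn xv hx; lia.
case: (leqP (h v + d) s.+1) => ds.
  rewrite (big_cat_nat _ (n := h v + d)) ?leq_addr //=; congr (_ + _).
  rewrite big_nat_cond (eq_bigr (fun=> G k h1 s)).
    by rewrite -big_nat_cond sum_nat_const_nat addKn.
  by move=> q /andP[/andP[? ?] _]; apply: E1.
(* Some of the [d] positions now lie beyond the span, so the factor [d] would overcount; but all
   other bounds exceed [s] as well, and both sides are 0. *)
rewrite [X in _ = _ + X]big_geq; last lia.
have -> : G k h1 s = 0.
  rewrite k0; apply: completions_eq0 => x xn /hx1 -/(_ xn); lia.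
rewrite muln0 big_nat_cond big1 // => q /andP[/andP[q1 q2] _].
rewrite E1 //; last lia.
by rewrite k0; apply: completions_eq0 => x xn /hx1 -/(_ xn); lia.
Qed.
End Step.

(** * Assignments correspond to ordered placements *)

Section Bijection.
Variables (n : nat) (wt : nat -> nat -> nat).
Hypothesis wt_tie : forall u x, u < x -> 0 < wt x u.
Notation place := (place_bound wt).
Notation G := (completions n wt).
Notation zer := (num_placed n).

(* u precedes x when [c u + wt u x <= c x]; by [wt_tie] two vertices never precede
   each other. *)
Definition sep (a b u x : nat) := (a + wt u x <= b) || (b + wt x u <= a).

(** Placed vertices are forced to colour 0, so that each completion is represented by a single
    function. *)
Definition fits (h : nat -> nat) s (c : {ffun 'I_n -> 'I_s.+1}) : bool :=
  [forall x : 'I_n, if h x == 0 then c x == 0 :> nat else h x <= c x] &&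
  [forall x : 'I_n, forall y : 'I_n,
     [&& x != y, h x != 0 & h y != 0] ==> sep (c x) (c y) x y].

Definition first (h : nat -> nat) s (c : {ffun 'I_n -> 'I_s.+1}) (u : 'I_n) : bool :=
  (h u != 0) && [forall x : 'I_n, (x != u) && (h x != 0) ==> (c u + wt u x <= c x)].

(** If each preceded the other, adding the two inequalities would give [wt u v + wt v u = 0],
    against [wt_tie]. *)
Lemma first_uniq (h : nat -> nat) s (c : {ffun 'I_n -> 'I_s.+1}) u v :
  first h c u -> first h c v -> u = v.
Proof.
case/andP=> hu /forallP Fu /andP[hv /forallP Fv]; apply: contraTeq isT => uv.
have vu : v != u by rewrite eq_sym.
have := Fu v; have := Fv u; rewrite uv vu hu hv /=.
case: (ltngtP u v) => [lt|lt|E].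
- by have := wt_tie lt; lia.
- by have := wt_tie lt; lia.
- by case/eqP: uv; apply: val_inj.
Qed.

Lemma first_ex (h : nat -> nat) s (c : {ffun 'I_n -> 'I_s.+1}) :
  fits h c -> zer h < n -> exists u, first h c u.
Proof.
move=> /andP[_ /forallP F] /num_placed_ltP[x0 x0n hx0].
(* This orders vertices by colour and then by index. If [x] preceded the minimiser [u], both would
   have the same colour and [x] the larger index; but then [wt x u] is positive. *)
pose key (u : 'I_n) := c u * n + u.
case: (arg_minnP key (P := fun u : 'I_n => h u != 0) (i0 := Ordinal x0n)) => //= u hu Mu.
exists u; rewrite /first hu /=; apply/forallP => x; apply/implyP => /andP[xu hx].
have ux : u != x by rewrite eq_sym.
have /forallP/(_ x) := F u; rewrite ux hu hx /= /sep => /orP[//|H].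
have := Mu x hx; rewrite /key => K.
have un := ltn_ord u; have xn := ltn_ord x.
case: (ltngtP (c x) (c u)) => [lt|lt|E].
- by nia.
- by lia.
- have lt : u < x.
    have : u != x :> nat by apply: contra ux => /eqP e; apply/eqP/val_inj.
    by rewrite E in K; lia.
  by have := wt_tie lt; lia.
Qed.

Definition erase s (u : 'I_n) (c : {ffun 'I_n -> 'I_s.+1}) : {ffun 'I_n -> 'I_s.+1} :=
  [ffun x => if x == u then ord0 else c x].

(** Erasing the colour [q] of the first vertex is a bijection: that [u] precedes [x] is exactly what
    [place_bound] adds to the bound on [x]. *)
Lemma card_first (h : nat -> nat) s (u : 'I_n) q : h u != 0 -> h u <= q <= s ->
  #|[set c : {ffun 'I_n -> 'I_s.+1} | [&& fits h c, first h c u & c u == q :> nat]]| =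
  #|[set c : {ffun 'I_n -> 'I_s.+1} | fits (place h u q) c]|.
Proof.
move=> hu /andP[hq qs].
rewrite -(card_in_imset (f := erase u)); last first.
  move=> c c'; rewrite !inE => /and3P[_ _ /eqP E] /and3P[_ _ /eqP E'] /ffunP H.
  apply/ffunP => x; have := H x; rewrite !ffunE; case: eqVneq => // -> _.
  by apply: val_inj; rewrite /= E E'.
congr #|pred_of_set _|; apply/setP => c'; rewrite inE; apply/imsetP/idP.
  move=> [c]; rewrite inE => /and3P[/andP[/forallP F1 /forallP F2] /andP[_ /forallP F3] /eqP cu ->].
  apply/andP; split; apply/forallP => x.
    rewrite !ffunE /place /place_bound; case: (eqVneq x u) => [->|xu]; first by rewrite eqxx.
    have xu' : (x == u :> nat) = false by apply/negbTE; apply: contra xu => /eqP e; apply/eqP/val_inj.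
    rewrite xu' /=; have := F1 x; case: (eqVneq (h x) 0) => //= hx hc.
    have -> : (maxn (h x) (q + wt u x) == 0) = false by lia.
    by rewrite geq_max hc /=; have := F3 x; rewrite xu hx /= cu.
  apply/forallP => y; rewrite !ffunE /place /place_bound; apply/implyP => /and3P[xy].
  case: ifP => // /norP[xu hx] _; case: ifP => // /norP[yu hy] _.
  have -> : (x == u) = false by apply/negbTE; apply: contra xu => /eqP ->.
  have -> : (y == u) = false by apply/negbTE; apply: contra yu => /eqP ->.
  by have /forallP/(_ y) := F2 x; rewrite xy hx hy.
case/andP => /forallP F1 /forallP F2.
have nu (x : 'I_n) : x != u -> (x == u :> nat) = false.
  by move=> xu; apply/negbTE; apply: contra xu => /eqP e; apply/eqP/val_inj.
have cu0 : c' u = ord0.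
  by apply: val_inj; have := F1 u; rewrite /place /place_bound eqxx /= => /eqP.
have F1' x : x != u -> if h x == 0 then c' x == 0 :> nat else (h x <= c' x) && (q + wt u x <= c' x).
  move=> xu; have := F1 x; rewrite /place /place_bound nu //=.
  case: (eqVneq (h x) 0) => //= hx.
  have -> : (maxn (h x) (q + wt u x) == 0) = false by lia.
  by rewrite geq_max.
exists [ffun x => if x == u then inord q else c' x]; last first.
  by apply/ffunP => x; rewrite !ffunE; case: eqVneq => // ->.
have q1 : (inord q : 'I_s.+1) = q :> nat by rewrite inordK.
rewrite inE; apply/and3P; split; last by rewrite ffunE eqxx q1.
  apply/andP; split; apply/forallP => x; rewrite !ffunE.
    case: (eqVneq x u) => [->|xu]; first by rewrite (negbTE hu) q1.
    by have := F1' x xu; case: ifP => // _ /andP[].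
  apply/forallP => y; rewrite !ffunE; apply/implyP => /and3P[xy hx hy].
  rewrite /sep; case: (eqVneq x u) => [Ex|xu].
    have yu : y != u by rewrite -Ex eq_sym.
    by have := F1' y yu; rewrite (negbTE yu) (negbTE hy) q1 Ex => /andP[_ ->].
  case: (eqVneq y u) => [Ey|yu].
    by have := F1' x xu; rewrite (negbTE hx) q1 Ey => /andP[_ ->]; rewrite orbT.
  have /forallP/(_ y) := F2 x; rewrite xy /place /place_bound !nu //= (negbTE hx) (negbTE hy).
  have -> : (maxn (h x) (q + wt u x) == 0) = false by lia.
  by have -> : (maxn (h y) (q + wt u y) == 0) = false by lia.
apply/andP; split => //; apply/forallP => x; rewrite !ffunE eqxx q1.
apply/implyP => /andP[xu hx]; rewrite (negbTE xu).
by have := F1' x xu; rewrite (negbTE hx) => /andP[].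
Qed.

Lemma card_fits k (h : nat -> nat) s : n - zer h = k ->
  #|[set c : {ffun 'I_n -> 'I_s.+1} | fits h c]| = G k h s.
Proof.
elim: k h => [|k IH] h zh.
  have h0 (x : 'I_n) : h x = 0.
    apply/eqP/negPn/negP => hx; have := num_placed_live (ltn_ord x) hx; lia.
  rewrite /= (_ : [set c | fits h c] = [set [ffun=> ord0]]) ?cards1 //.
  apply/setP => c; rewrite !inE; apply/idP/eqP => [/andP[/forallP H _]|->].
    by apply/ffunP => x; rewrite ffunE; have := H x; rewrite h0 eqxx => /eqP E; apply: val_inj.
  apply/andP; split; apply/forallP => x; first by rewrite h0 eqxx ffunE.
  by apply/forallP => y; rewrite h0 eqxx andbF.
rewrite /= -sum1dep_card.
(* Every fitting assignment has exactly one pair of a first vertex and its colour, so the inserted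
   double sum is 1. *)
transitivity (\sum_(c : {ffun 'I_n -> 'I_s.+1} | fits h c)
   \sum_(u < n | h u != 0) \sum_(h u <= q < s.+1) (first h c u && (c u == q :> nat))).
  apply: eq_bigr => c Fc.
  have [u Fu] : exists u, first h c u by apply: first_ex => //; lia.
  have hu : h u != 0 by case/andP: Fu.
  have huc : h u <= c u by case/andP: Fc => /forallP/(_ u); rewrite (negbTE hu).
  rewrite (bigD1 u) //= [X in _ + X]big1 ?addn0.
    rewrite Fu /= (bigD1_seq (c u : nat)) ?iota_uniq //=; last first.
      by rewrite mem_index_iota huc ltn_ord.
    by rewrite eqxx big1 // => q; rewrite eq_sym => /negbTE ->.
  move=> v /andP[hv vu]; rewrite big1 // => q _.
  by case: (boolP (first h c v)) => // /(first_uniq Fu) E; rewrite E eqxx in vu.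
rewrite exchange_big /=; apply: eq_bigr => u hu; rewrite exchange_big /=.
rewrite big_nat_cond [RHS]big_nat_cond; apply: eq_bigr => q /andP[/andP[q1 q2] _].
rewrite -(IH (place h u q)); last by rewrite num_placed_place //; lia.
rewrite -card_first ?q1 // -sum1dep_card [RHS]big_mkcondr /=.
by apply: eq_bigr => c _; case: (_ && _).
Qed.
End Bijection.

(** * Keys and invariants of states *)

Section Enc.
Variables (n M : nat).

(** States are used as memory addresses, hence written as numbers: the bounds are the lowest digits
    in base [M], below a part holding [v] and [r]. *)
Definition state_key (v r : nat) (h : nat -> nat) : nat :=
  \sum_(x < n) h x * M ^ x + M ^ n * (v + n * r).
Definition key_digit (k x : nat) : nat := k %/ M ^ x %% M.
Definition key_vertex (k : nat) : nat := k %/ M ^ n %% n.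
Definition key_gaps (k : nat) : nat := k %/ M ^ n %/ n.

Lemma state_key_ext v r h h' : eqn_lt n h h' -> state_key v r h = state_key v r h'.
Proof. by move=> E; congr (_ + _); apply: eq_bigr => x _; rewrite E. Qed.

Hypothesis M0 : 0 < M.

Lemma sum_dig_lt (h : nat -> nat) j : (forall x, x < j -> h x < M) ->
  \sum_(x < j) h x * M ^ x < M ^ j.
Proof.
elim: j => [|j IH] H; first by rewrite big_ord0 expn0.
rewrite big_ord_recr /= expnS.
have := IH (fun x xj => H x (ltnW xj)); have := H j (ltnSn j).
by move: (M ^ j) (\sum_(_ < _) _) => A B; nia.
Qed.

Lemma key_digit_state_key v r h x : (forall y, y < n -> h y < M) -> x < n -> key_digit (state_key v r h) x = h x.
Proof.
move=> H xn; rewrite /key_digit /state_key.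
have -> : \sum_(y < n) h y * M ^ y =
   \sum_(y < x) h y * M ^ y + h x * M ^ x + M ^ x.+1 * \sum_(y < n - x.+1) h (x.+1 + y) * M ^ y.
  rewrite -!(big_mkord xpredT (fun y => h y * M ^ y)) (big_cat_nat _ (n := x.+1)) //=.
  rewrite big_nat_recr //=; congr (_ + _).
  rewrite -{1}[x.+1]add0n big_addn big_mkord big_distrr; apply: eq_bigr => y _.
  by rewrite [y + _]addnC expnD mulnCA.
have -> : M ^ n = M ^ x.+1 * M ^ (n - x.+1) by rewrite -expnD subnKC.
set A := \sum_(y < x) _; set B := \sum_(y < _) _; set C := M ^ (n - _).
have lA : A < M ^ x by apply: sum_dig_lt => y yx; apply: H; apply: ltn_trans xn.
have -> : A + h x * M ^ x + M ^ x.+1 * B + M ^ x.+1 * C * (v + n * r) =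
  (h x + (B + C * (v + n * r)) * M) * M ^ x + A by rewrite expnS; nia.
rewrite divnMDl ?expn_gt0 ?M0 // divn_small // addn0 addnC modnMDl modn_small //; exact: H.
Qed.

Lemma state_key_div v r h : (forall y, y < n -> h y < M) -> state_key v r h %/ M ^ n = v + n * r.
Proof.
move=> H; rewrite /state_key addnC [M ^ n * _]mulnC divnMDl ?expn_gt0 ?M0 //.
by rewrite divn_small ?addn0 //; apply: sum_dig_lt.
Qed.

Lemma key_vertex_state_key v r h : (forall y, y < n -> h y < M) -> v < n -> key_vertex (state_key v r h) = v.
Proof. by move=> H vn; rewrite /key_vertex state_key_div // addnC mulnC modnMDl modn_small. Qed.

Lemma key_gaps_state_key v r h : (forall y, y < n -> h y < M) -> v < n -> key_gaps (state_key v r h) = r.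
Proof.
move=> H vn; have n0 : 0 < n by apply: leq_ltn_trans vn.
by rewrite /key_gaps state_key_div // addnC mulnC divnMDl // divn_small ?addn0.
Qed.

Lemma state_key_lt v r h : (forall y, y < n -> h y < M) -> v < n -> r <= n ->
  state_key v r h < M ^ n * (n * n.+1).
Proof.
move=> H vn rn; apply: (@leq_trans (M ^ n * (v + n * r).+1)).
  by rewrite mulnS /state_key ltn_add2r; apply: sum_dig_lt.
by rewrite leq_mul2l; apply/orP; right; nia.
Qed.
End Enc.

(** * Invariants of the states, preserved by placing and by moving a vertex *)

Section Validity.
Variables (n l : nat) (wt : nat -> nat -> nat).
Hypothesis wt_le : forall u x, u < n -> x < n -> wt u x <= l.
Notation zer := (num_placed n).
Notation clip := (clip_bound wt).
Let M := n * l + 2.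
Notation enc := (state_key n M).
Notation dig := (key_digit M).
Notation vof := (key_vertex n M).
Notation rof := (key_gaps n M).

(* In [ok_past], [f a] is the distance from the colour of a to the current position
   [h v], truncated at l: older vertices bind nobody any more. *)
Record okst (v r : nat) (h : nat -> nat) : Prop := Okst {
  ok_v : v < n;
  ok_hv : h v != 0;
  ok_lead : leads n wt v h;
  ok_near : forall x, x < n -> h x <= h v + l;
  ok_pos : h v <= 1 + zer h * l;
  ok_le : forall x, x < n -> h x <= maxn (1 + zer h * l) (h v + wt v x);
  ok_r : r <= zer h;
  ok_past : exists2 f : nat -> nat, forall a, f a <= l &
    forall x, x < n -> x != v -> h x != 0 ->
      h x = maxn (h v + wt v x) (\max_(a < n | h a == 0) (h v + wt a x - f a)) }.

Lemma ok_num_placed v r h : okst v r h -> zer h < n.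
Proof. by case=> vn hv *; apply: num_placed_live hv. Qed.

Lemma ok_ltM v r h x : okst v r h -> x < n -> h x < M.
Proof.
move=> H xn; have zn := ok_num_placed H; have := ok_le H xn; have := ok_pos H.
have := wt_le (ok_v H) xn; have : zer h * l + l <= n * l by rewrite addnC -mulSn leq_mul2r zn orbT.
by rewrite /M; lia.
Qed.

Lemma num_placed_one : zer (fun=> 1) = 0.
Proof. by rewrite /num_placed big1. Qed.

Lemma num_placed_clip_id h u q : u < n -> h u != 0 -> q != 0 -> zer (clip h n u q) = zer h.
Proof.
move=> un hu q0; apply: eq_bigr => x _; rewrite /clip /clip_bound.
case: (eqVneq (x : nat) u) => [->|xu]; first by rewrite (negbTE q0) (negbTE hu).
rewrite (_ : (x == n :> nat) = false) ?orbF; last by apply/eqP; have := ltn_ord x; lia.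
by case: (eqVneq (h x) 0) => //= hx; case: eqP => //; lia.
Qed.

Lemma ok_init u : u < n -> okst u 0 (clip (fun=> 1) n u 1).
Proof.
move=> un.
have z : zer (clip (fun=> 1) n u 1) = 0 by rewrite num_placed_clip_id ?num_placed_one.
have E x : x < n -> x != u -> clip (fun=> 1) n u 1 x = 1 + wt u x.
  move=> xn xu; rewrite /clip /clip_bound (negbTE xu) /= (_ : (x == n) = false); lia.
have Eu : clip (fun=> 1) n u 1 u = 1 by rewrite /clip_bound eqxx.
split; rewrite ?z ?Eu //.
- by move=> x xn xu _; rewrite (E x) // ?Eu.
- move=> x xn; case: (eqVneq x u) => [->|xu]; first by rewrite ?Eu; lia.
  by rewrite (E x) //; have := wt_le un xn; lia.
- move=> x xn; case: (eqVneq x u) => [->|xu]; first by rewrite ?Eu; lia.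
  by rewrite (E x) //; lia.
- exists (fun=> 0) => // x xn xu _; rewrite ?Eu (E x) // big1 ?maxn0 // => a.
  by have := ltn_ord a => an /eqP; rewrite /clip /clip_bound; case: eqP => //=; case: eqP; lia.
Qed.

Lemma ok_place v r h u r' : okst v r h -> u < n -> u != v -> h u != 0 -> r' <= r.+1 ->
  okst u r' (clip h v u (h u)).
Proof.
move=> H un uv hu rr; have vn := ok_v H; have hv := ok_hv H; have zn := ok_num_placed H.
have vu : v != u by rewrite eq_sym.
have z : zer (clip h v u (h u)) = (zer h).+1 by rewrite num_placed_clip.
have hvu : h v <= h u by have := ok_lead H un uv hu; lia.
have Eu : clip h v u (h u) u = h u by rewrite /clip_bound eqxx.
have Ev : clip h v u (h u) v = 0 by rewrite /clip /clip_bound (negbTE vu) eqxx orbT.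
have E x : x != u -> x != v -> h x != 0 -> clip h v u (h u) x = maxn (h x) (h u + wt u x).
  by move=> xu xv hx; rewrite /clip /clip_bound (negbTE xu) (negbTE xv) (negbTE hx).
have E0 x : h x == 0 -> clip h v u (h u) x = 0.
  move=> hx; rewrite /clip /clip_bound hx /=; case: eqP => // xu.
  by move: hu; rewrite -xu hx.
split; rewrite ?z ?Eu //.
- move=> x xn xu; rewrite ?Eu; case: (eqVneq x v) => [->|xv]; first by rewrite ?Ev.
  case: (eqVneq (h x) 0) => [hx|hx _]; first by rewrite E0 ?hx.
  by rewrite (E x) // leq_maxr.
- move=> x xn; case: (eqVneq x u) => [->|xu]; first by rewrite ?Eu; lia.
  case: (eqVneq x v) => [->|xv]; first by rewrite ?Ev.
  case: (eqVneq (h x) 0) => [hx|hx]; first by rewrite E0 ?hx.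
  rewrite (E x) //; have := ok_near H xn; have := wt_le un xn; lia.
- have := ok_le H un; have := ok_pos H; have := wt_le vn un; rewrite mulSn; lia.
- move=> x xn; case: (eqVneq x u) => [->|xu].
    have := ok_le H un; have := ok_pos H; have := wt_le vn un; rewrite ?Eu mulSn; lia.
  case: (eqVneq x v) => [->|xv]; first by rewrite ?Ev.
  case: (eqVneq (h x) 0) => [hx|hx]; first by rewrite E0 ?hx.
  rewrite (E x) //; have := ok_le H xn; have := ok_pos H; have := wt_le vn xn.
  by rewrite mulSn; lia.
- by have := ok_r H; lia.
(* The current position advances by [d]: all distances grow by [d], and [v] enters at distance [d].
   Truncation at [l] is harmless, because a vertex at distance [l] or more only demands what the
   current position gives anyway. *)
have [f fl Ef] := ok_past H; set d := h u - h v.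
pose f' a := if a == v then minn d l else minn (f a + d) l.
exists f' => [a|x xn xu]; first by rewrite /f'; case: ifP; rewrite geq_minr.
case: (eqVneq x v) => [->|xv]; first by rewrite ?Ev.
case: (eqVneq (h x) 0) => [hx|hx _]; first by rewrite E0 ?hx.
rewrite (E x) // (Ef x) // {1}/clip_bound.
have wvx := wt_le vn xn.
have Z (a : 'I_n) : (clip h v u (h u) a == 0) = (a == v :> nat) || (h a == 0).
  case: (eqVneq (a : nat) v) => [->|av] /=; first by rewrite ?Ev.
  case: (eqVneq (h a) 0) => [ha|ha] /=; first by rewrite E0 ?ha.
  case: (eqVneq (a : nat) u) => [->|au]; first by rewrite ?Eu (negbTE hu).
  by rewrite E //; apply/eqP; lia.
apply/eqP; rewrite eqn_leq !geq_max -!andbA; apply/and5P; split.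
- case: (leqP d l) => dl; last by apply: leq_trans (leq_maxl _ _); lia.
  apply: leq_trans (leq_maxr _ _).
  apply: (@leq_trans (h u + wt v x - f' v)); first by rewrite /f' eqxx (minn_idPl dl) /d; lia.
  by apply: (leq_bigmax_cond (F := fun a : 'I_n => h u + wt a x - f' a) (Ordinal vn)); rewrite Z eqxx.
- apply/bigmax_leqP => a ha.
  have an := ltn_ord a; have wax := wt_le an xn.
  case: (leqP (f a + d) l) => dl; last by apply: leq_trans (leq_maxl _ _); lia.
  apply: leq_trans (leq_maxr _ _).
  apply: (@leq_trans (h u + wt a x - f' a)).
    rewrite /f'; case: eqP => av; first by move: hv; rewrite -av ha.
    by rewrite (minn_idPl dl) /d; lia.
  by apply: (leq_bigmax_cond (F := fun a : 'I_n => h u + wt a x - f' a) a); rewrite Z ha orbT.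
- exact: leq_maxl.
- exact: leq_maxr.
- apply/bigmax_leqP => a; rewrite Z => ha.
  have an := ltn_ord a; have wax := wt_le an xn.
  rewrite /f'; case: (eqVneq (a : nat) v) ha => [->|av] /= ha.
    by case: (leqP d l) => dl; lia.
  case: (leqP (f a + d) l) => dl; last by lia.
  rewrite leq_max; apply/orP; left.
  rewrite leq_max; apply/orP; right.
  apply: leq_trans (leq_bigmax_cond a ha); lia.
Qed.

Lemma ok_chain v r h d : okst v r h -> 0 < d -> 
  (exists x, [/\ x < n, x != v, h x != 0 & h v + d + wt v x <= h x]) ->
  okst v r (clip h n v (h v + d)).
Proof.
move=> H d0 [y [yn yv hy Hy]]; have vn := ok_v H; have hv := ok_hv H; have zn := ok_num_placed H.
set q := h v + d; have q0 : q != 0 by rewrite /q; lia.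
have z : zer (clip h n v q) = zer h by rewrite num_placed_clip_id.
have Ev : clip h n v q v = q by rewrite /clip_bound eqxx.
have E x : x < n -> x != v -> h x != 0 -> clip h n v q x = maxn (h x) (q + wt v x).
  by move=> xn xv hx; rewrite /clip /clip_bound (negbTE xv) (negbTE hx) /= (_ : (x == n) = false) //; lia.
have E0 x : h x == 0 -> clip h n v q x = 0.
  move=> hx; rewrite /clip /clip_bound hx /=; case: eqP => // xv.
  by move: hv; rewrite -xv hx.
(* The bound of [y] exceeds [h v + wt v y], so [ok_le] caps it by [1 + zer h * l]; hence [q], which
   does not pass it, obeys the same cap. *)
have qp : q <= 1 + zer h * l by have := ok_le H yn; have := ok_pos H; rewrite /q; lia.
split; rewrite ?z ?Ev //; last 2 first.
- by have := ok_r H.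
- have [f fl Ef] := ok_past H.
  pose f' a := minn (f a + d) l.
  exists f' => [a|x xn xv]; first by rewrite /f' geq_minr.
  case: (eqVneq (h x) 0) => [hx|hx _]; first by rewrite E0 ?hx.
  rewrite (E x) // (Ef x) //.
  have wvx := wt_le vn xn.
  have Z (a : 'I_n) : (clip h n v q a == 0) = (h a == 0).
    case: (eqVneq (h a) 0) => [ha|ha] /=; first by rewrite E0 ?ha.
    case: (eqVneq (a : nat) v) => [->|au]; first by rewrite ?Ev (negbTE q0).
    by rewrite E //; apply/eqP; lia.
  rewrite (eq_bigl _ _ Z); apply/eqP; rewrite eqn_leq !geq_max -!andbA; apply/and5P; split.
  + by apply: leq_trans (leq_maxl _ _); rewrite /q; lia.
  + apply/bigmax_leqP => a ha.
    have an := ltn_ord a; have wax := wt_le an xn.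
    case: (leqP (f a + d) l) => dl; last by apply: leq_trans (leq_maxl _ _); rewrite /q; lia.
    apply: leq_trans (leq_maxr _ _).
    apply: leq_trans (leq_bigmax_cond a ha).
    rewrite /f' (minn_idPl dl) /q; lia.
  + exact: leq_maxl.
  + exact: leq_maxr.
  + apply/bigmax_leqP => a ha.
    have an := ltn_ord a; have wax := wt_le an xn; rewrite /f'.
    case: (leqP (f a + d) l) => dl; last by rewrite /q; lia.
    rewrite leq_max; apply/orP; left.
    rewrite leq_max; apply/orP; right.
    apply: leq_trans (leq_bigmax_cond a ha); rewrite /q; lia.
- move=> x xn xv; case: (eqVneq (h x) 0) => [hx|hx _]; first by rewrite E0 ?hx.
  by rewrite ?Ev (E x) // leq_maxr.
- move=> x xn; case: (eqVneq x v) => [->|xv]; first by rewrite ?Ev; lia.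
  case: (eqVneq (h x) 0) => [hx|hx]; first by rewrite E0 ?hx.
  rewrite (E x) //; have := ok_near H xn; have := wt_le vn xn; rewrite /q; lia.
- move=> x xn; case: (eqVneq x v) => [->|xv]; first by rewrite ?Ev; lia.
  case: (eqVneq (h x) 0) => [hx|hx]; first by rewrite E0 ?hx.
  rewrite (E x) //; have := ok_le H xn; rewrite /q; lia.
Qed.
End Validity.

(** * The number of states *)

Lemma size_filter_iota (P : pred nat) n : size [seq x <- iota 0 n | P x] = \sum_(x < n) P x.
Proof.
rewrite size_filter -sum1_count -(big_mkord xpredT (fun x => nat_of_bool (P x))).
by rewrite /index_iota subn0 big_mkcond; apply: eq_bigr => x _; case: (P x).
Qed.

(** Sets of vertices are coded by bit masks; this is the source of the factor [2 ^ n]. *)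
Lemma mask_tuple (P : pred nat) n :
  exists m : n.-tuple bool, mask m (iota 0 n) = [seq x <- iota 0 n | P x].
Proof.
exists (Tuple (introT eqP (etrans (size_map P (iota 0 n)) (size_iota 0 n)))) => /=.
by rewrite filter_mask.
Qed.

Lemma ord_tuple (f : nat -> nat) l j (A : seq nat) : size A = j -> (forall a, f a <= l) ->
  exists t : j.-tuple 'I_l.+1, forall a, a \in A -> nth 0 (map (@nat_of_ord _) t) (index a A) = f a.
Proof.
move=> sA fl.
have st : size [seq (inord (f a) : 'I_l.+1) | a <- A] == j by rewrite size_map sA.
exists (Tuple st) => a aA /=; rewrite -map_comp (nth_map 0) ?index_mem //=.
by rewrite nth_index // inordK // ltnS.
Qed.

Section Keys.
Variables (n l : nat) (wt : nat -> nat -> nat).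
Hypothesis wt_le : forall u x, u < n -> x < n -> wt u x <= l.
Notation zer := (num_placed n).
Notation clip := (clip_bound wt).
Let M := n * l + 2.
Notation enc := (state_key n M).
Notation dig := (key_digit M).
Notation vof := (key_vertex n M).
Notation rof := (key_gaps n M).
Notation okst := (okst n l wt).

(** Here [A] is the set of placed vertices and [t] lists their truncated distances; the bounds are
    recovered by the formula of [ok_past]. *)
Definition past_key (A t : seq nat) (v p r : nat) : nat :=
  enc v r (fun x => if x == v then p else if x \in A then 0 else
    maxn (p + wt v x) (\max_(a < n | (a : nat) \in A) (p + wt a x - nth 0 t (index (a : nat) A)))).

(** Here [A] is the set of the other waiting vertices, and [t] lists their bounds as offsets from
    [p], which lie between 0 and [l] by [ok_lead] and [ok_near]. *)
Definition next_key (A t : seq nat) (v p r : nat) : nat :=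
  enc v r (fun x => if x == v then p else if x \in A then p + nth 0 t (index x A) else 0).

(** The tight bound of [u] follows from [p], so one offset fewer is listed. Naming [u] costs a
    factor [n] but saves a factor [l + 1]. *)
Definition tight_key (A t : seq nat) (u v p r : nat) : nat :=
  enc v r (fun x => if x == v then p else if x == u then p + wt v u else
    if x \in A then p + nth 0 t (index x A) else 0).

Lemma past_keyP v r h : okst v r h ->
  exists (m : n.-tuple bool) (t : (zer h).-tuple 'I_l.+1),
    enc v r h = past_key (mask m (iota 0 n)) (map (@nat_of_ord _) t) v (h v) r.
Proof.
move=> H; have [m Em] := mask_tuple (fun x => h x == 0) n.
have [f fl Ef] := ok_past H.
have [|t Et] := ord_tuple (A := mask m (iota 0 n)) (j := zer h) _ fl.
  by rewrite Em size_filter_iota.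
exists m, t; apply: state_key_ext => x xn; have vn := ok_v H; have hv := ok_hv H.
have mem a : a < n -> (a \in mask m (iota 0 n)) = (h a == 0).
  by move=> an; rewrite Em mem_filter mem_iota add0n an /= !andbT.
case: (eqVneq x v) => [-> //|xv]; rewrite mem //.
case: (eqVneq (h x) 0) => // hx; rewrite Ef //; congr maxn.
apply: eq_big => [a|a ha]; first by rewrite mem.
by rewrite Et // mem.
Qed.

Lemma size_others v h : v < n -> h v != 0 ->
  size [seq x <- iota 0 n | (x != v) && (h x != 0)] = n.-1 - zer h.
Proof.
move=> vn hv; have zn := num_placed_live vn hv; rewrite size_filter_iota.
have : \sum_(x < n) (h x == 0) + \sum_(x < n) (x == v :> nat) +
       \sum_(x < n) ((x != v :> nat) && (h x != 0)) = n.
  rewrite -!big_split -[RHS]card_ord -sum1_card; apply: eq_bigr => x _.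
  case: (eqVneq (x : nat) v) => [->|xv]; first by rewrite (negbTE hv).
  by case: (h x == 0).
have -> : \sum_(x < n) (x == v :> nat) = 1.
  rewrite (bigD1 (Ordinal vn)) //= eqxx big1 // => i iv.
  by case: eqP => // e; case/eqP: iv; apply: val_inj.
rewrite -/(zer h); lia.
Qed.

Lemma next_keyP v r h : okst v r h ->
  exists (m : n.-tuple bool) (t : (n.-1 - zer h).-tuple 'I_l.+1),
    enc v r h = next_key (mask m (iota 0 n)) (map (@nat_of_ord _) t) v (h v) r.
Proof.
move=> H; have [m Em] := mask_tuple (fun x => (x != v) && (h x != 0)) n.
have [||t Et] := @ord_tuple (fun x => minn (h x - h v) l) l (n.-1 - zer h) (mask m (iota 0 n)).
- by rewrite Em size_others //; [apply: ok_v H | apply: ok_hv H].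
- by move=> a; rewrite geq_minr.
exists m, t; apply: state_key_ext => x xn; have vn := ok_v H; have hv := ok_hv H.
case: (eqVneq x v) => [-> //|xv].
rewrite Em mem_filter mem_iota add0n xn xv /= ?andbT.
case: (eqVneq (h x) 0) => // hx; rewrite -Em Et; last first.
  by rewrite Em mem_filter mem_iota add0n xn xv hx.
rewrite /=; have := ok_near H xn; have := ok_lead H xn xv hx; lia.
Qed.

Lemma tight_keyP v r h u : okst v r h -> u < n -> u != v -> h u = h v + wt v u ->
  exists (m : n.-tuple bool) (t : (n.-1 - zer h).-1.-tuple 'I_l.+1),
    enc v r h = tight_key (mask m (iota 0 n)) (map (@nat_of_ord _) t) u v (h v) r.
Proof.
move=> H un uv hu.
have vn := ok_v H; have hv := ok_hv H.
have hu0 : h u != 0 by rewrite hu; lia.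
have [m Em] := mask_tuple (fun x => [&& x != u, x != v & h x != 0]) n.
have [||t Et] := @ord_tuple (fun x => minn (h x - h v) l) l (n.-1 - zer h).-1 (mask m (iota 0 n)).
- rewrite Em -(size_others vn hv) !size_filter_iota.
  rewrite [in RHS](bigD1 (Ordinal un)) //= uv hu0 add1n (bigD1 (Ordinal un)) //= eqxx add0n.
  apply: eq_bigr => x xu; rewrite (_ : x != u :> nat) //.
- by move=> a; rewrite geq_minr.
exists m, t; apply: state_key_ext => x xn.
case: (eqVneq x v) => [-> //|xv].
case: (eqVneq x u) => [-> //|xu].
rewrite Em mem_filter mem_iota add0n xn xv xu /= ?andbT.
case: (eqVneq (h x) 0) => // hx; rewrite -Em Et; last first.
  by rewrite Em mem_filter mem_iota add0n xn xv hx xu.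
rewrite /=; have := ok_near H xn; have := ok_lead H xn xv hx; lia.
Qed.

Definition tight (v : nat) (h : nat -> nat) :=
  exists u, [/\ u < n, u != v & h u = h v + wt v u].

(** Such a state is a function of its predecessor, of [v] and of [b], which tells whether a free gap
    was granted; so it can be counted through predecessors with one vertex fewer placed. *)
Definition placed (v r : nat) (h : nat -> nat) :=
  exists v0 r0 h0 (b : bool), [/\ okst v0 r0 h0, zer h = (zer h0).+1, r = r0 + b,
     v < n & h = clip h0 v0 v (h0 v)].

(** The alternatives are the three origins of a state: initial, reached by moving the vertex to a
    tight position, or reached by placing one. *)
Definition good (k : nat) :=
  exists v r h, [/\ k = enc v r h, okst v r h & [\/ zer h = 0, tight v h | placed v r h]].

Definition past_keys j : seq nat :=
  [seq (let: (m, t, v, p, r) := x in past_key (mask m (iota 0 n)) (map (@nat_of_ord _) t) v p r) |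
    x : n.-tuple bool * j.-tuple 'I_l.+1 * 'I_n * 'I_M * 'I_n.+1].

Definition next_keys j : seq nat :=
  [seq (let: (m, t, v, p, r) := x in next_key (mask m (iota 0 n)) (map (@nat_of_ord _) t) v p r) |
    x : n.-tuple bool * j.-tuple 'I_l.+1 * 'I_n * 'I_M * 'I_n.+1].

Definition tight_keys j : seq nat :=
  [seq (let: (m, t, u, v, p, r) := x in
        tight_key (mask m (iota 0 n)) (map (@nat_of_ord _) t) u v p r) |
    x : n.-tuple bool * j.-tuple 'I_l.+1 * 'I_n * 'I_n * 'I_M * 'I_n.+1].

Definition placed_keys j : seq nat :=
  [seq (let: (u, b) := x in
        enc (u : 'I_n) (rof k + (b : bool)) (clip (dig k) (vof k) u (dig k u))) |
    k <- past_keys j, x <- enum {: 'I_n * bool}].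

Definition all_keys : seq nat :=
  let m := n./2 in
  flatten [seq past_keys j | j <- iota 0 m] ++ flatten [seq next_keys j | j <- iota 0 m] ++
  tight_keys m.-1 ++ placed_keys m.-1.

Lemma okst_past_keys v r h : okst v r h -> enc v r h \in past_keys (zer h).
Proof.
move=> H; have [m [t E]] := past_keyP H.
have vn := ok_v H; have zn := ok_num_placed H.
have pM := ok_ltM wt_le H vn; have rn : r < n.+1 by have := ok_r H; lia.
by apply/imageP; exists (m, t, Ordinal vn, Ordinal pM, Ordinal rn).
Qed.

Lemma okst_next_keys v r h : okst v r h -> enc v r h \in next_keys (n.-1 - zer h).
Proof.
move=> H; have [m [t E]] := next_keyP H.
have vn := ok_v H; have zn := ok_num_placed H.
have pM := ok_ltM wt_le H vn; have rn : r < n.+1 by have := ok_r H; lia.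
by apply/imageP; exists (m, t, Ordinal vn, Ordinal pM, Ordinal rn).
Qed.

Lemma okst_tight_keys v r h : okst v r h -> tight v h ->
  enc v r h \in tight_keys (n.-1 - zer h).-1.
Proof.
move=> H [u [un uv hu]]; have [m [t E]] := tight_keyP H un uv hu.
have vn := ok_v H; have zn := ok_num_placed H.
have pM := ok_ltM wt_le H vn; have rn : r < n.+1 by have := ok_r H; lia.
by apply/imageP; exists (m, t, Ordinal un, Ordinal vn, Ordinal pM, Ordinal rn).
Qed.

Lemma M_gt0 : 0 < M. Proof. by rewrite /M addn2. Qed.

Lemma placed_placed_keys v r h : placed v r h -> enc v r h \in placed_keys (zer h).-1.
Proof.
move=> [v0 [r0 [h0 [b [H -> -> vn ->]]]]] /=.
have v0n := ok_v H; have Hlt y : y < n -> h0 y < M by apply: (ok_ltM wt_le H).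
apply/allpairsP => /=; exists (enc v0 r0 h0, (Ordinal vn, b)) => /=; split.
- exact: okst_past_keys.
- by rewrite mem_enum.
rewrite key_gaps_state_key ?M_gt0 // key_vertex_state_key ?M_gt0 //; apply: state_key_ext => x xn.
by rewrite /clip /clip_bound !key_digit_state_key ?M_gt0.
Qed.

Lemma good_all_keys k : 1 < n -> good k -> k \in all_keys.
Proof.
move=> n1 [v [r [h [-> H T]]]]; have zn := ok_num_placed H.
have hn : n = odd n + n./2 + n./2 by rewrite -addnA addnn odd_double_half.
rewrite /all_keys !mem_cat; set m := n./2 in hn *.
case: (ltnP (zer h) m) => zm.
  apply/orP; left; apply/flattenP; exists (past_keys (zer h)); last exact: okst_past_keys.
  by apply: map_f; rewrite mem_iota.
case: (ltnP (n.-1 - zer h) m) => km.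
  apply/orP; right; apply/orP; left; apply/flattenP; exists (next_keys (n.-1 - zer h)).
    by apply: map_f; rewrite mem_iota.
  exact: okst_next_keys.
(* Both numbers are at least [m] and they add up to [n - 1], so [n] is odd and both equal [m]. *)
have zE : zer h = m by case: (odd n) hn => /= hn; lia.
have kE : n.-1 - zer h = m by case: (odd n) hn => /= hn; lia.
have m0 : 0 < m by case: (odd n) hn => /= hn; lia.
case: T => [z0|T|T]; first by rewrite z0 in zE; rewrite -zE in m0.
  by rewrite -kE okst_tight_keys // !orbT.
by rewrite -zE placed_placed_keys // !orbT.
Qed.

Lemma size_flatten_le (F : nat -> seq nat) m B : (forall j, j < m -> size (F j) <= B) ->
  size (flatten [seq F j | j <- iota 0 m]) <= m * B.
Proof.
move=> H; rewrite size_flatten /shape -map_comp sumnE big_map.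
rewrite big_seq_cond; apply: (@leq_trans (\sum_(j <- iota 0 m | (j \in iota 0 m) && true) B)).
  by apply: leq_sum => j; rewrite andbT mem_iota => /H.
by rewrite -big_seq_cond big_const_seq count_predT size_iota iter_addn_0 mulnC.
Qed.

Lemma size_all_keys : 1 < n ->
  size all_keys <= 4 * n ^ 3 * n.+1 * (2 ^ n * l.+1 ^ n./2).
Proof.
move=> n1; rewrite /all_keys; set m := n./2.
have hn : n = odd n + n./2 + n./2 by rewrite -addnA addnn odd_double_half.
have m0 : 0 < m by rewrite /m; case: (odd n) hn => /= hn; lia.
have mn : m + m <= n by rewrite /m; lia.
have ML : M <= n * l.+1 by rewrite /M mulnS; lia.
pose B := n ^ 2 * n.+1 * (2 ^ n * l.+1 ^ m).
have card_base j : j < m -> 2 ^ n * l.+1 ^ j * n * M * n.+1 <= B.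
  move=> jm; apply: (@leq_trans (2 ^ n * l.+1 ^ j * n * (n * l.+1) * n.+1)).
    by rewrite !leq_mul2r leq_mul2l ML !orbT.
  have : l.+1 ^ j.+1 <= l.+1 ^ m by rewrite leq_pexp2l.
  rewrite /B expnS -mulnn; move: l.+1 (2 ^ n) (l.+1 ^ j) (l.+1 ^ m) => d a b c H.
  have -> : a * b * n * (n * d) * n.+1 = n * n * n.+1 * (a * (d * b)) by nia.
  by rewrite !leq_mul2l H !orbT.
have past_le j : j < m -> size (past_keys j) <= B.
  move=> jm; rewrite size_image !card_prod !card_tuple card_bool !card_ord; exact: card_base.
have next_le j : j < m -> size (next_keys j) <= B.
  move=> jm; rewrite size_image !card_prod !card_tuple card_bool !card_ord; exact: card_base.
have tight_le : size (tight_keys m.-1) <= n * B.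
  rewrite size_image !card_prod !card_tuple card_bool !card_ord.
  have := card_base m.-1; rewrite prednK // leqnn => /(_ isT).
  move: (2 ^ n) (l.+1 ^ m.-1) => a b H.
  have -> : a * b * n * n * M * n.+1 = n * (a * b * n * M * n.+1) by nia.
  by rewrite leq_mul2l H orbT.
have placed_le : size (placed_keys m.-1) <= B * (n * 2).
  rewrite size_allpairs -cardE card_prod card_ord card_bool leq_mul2r.
  by apply/orP; right; apply: past_le; rewrite prednK.
have := size_flatten_le past_le; have := size_flatten_le next_le.
rewrite !size_cat => H1 H2; apply: (@leq_trans (4 * n * B)).
  have : (m + m) * B <= n * B by rewrite leq_mul2r mn orbT.
  lia.
by rewrite /B !expnS expn0 muln1; nia.
Qed.
End Keys.

(** * Reasoning about programs *)

(** Measured so that [esize e * b] bounds the length of the value of [e] when all cells have at most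
    [b] bits; hence a constant counts with its own length. *)
Fixpoint esize (e : expr) : nat :=
  match e with
  | Const c => bitlen c
  | Read _ i => (esize i).+1
  | Op _ e1 e2 => (esize e1 + esize e2).+1
  end.

Lemma ltn_bitlen a : a < 2 ^ bitlen a.
Proof. exact: trunc_log_ltn. Qed.

Lemma bitlen_leq a k : 0 < k -> a < 2 ^ k -> bitlen a <= k.
Proof.
move=> k0 ak; case: (posnP a) => [->|a0]; first by rewrite /bitlen trunc_log0.
by rewrite /bitlen -(@ltn_exp2l 2) //; apply: leq_ltn_trans ak; apply: trunc_logP.
Qed.

Section WP.
Variables (b cap : nat).
Hypothesis b0 : 0 < b.

Definition bounded (m : memory) := forall a i, m a i < 2 ^ b.

Lemma esize_gt0 e : 0 < esize e. Proof. by case: e. Qed.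

Lemma eval_lt m e : bounded m -> eval m e < 2 ^ (esize e * b).
Proof.
move=> Bm; elim: e => [c|a i _|o e1 IH1 e2 IH2] /=.
- by apply: leq_trans (ltn_bitlen c) _; rewrite leq_exp2l // leq_pmulr.
- by apply: leq_trans (Bm _ _) _; rewrite leq_exp2l // mulSn leq_addr.
have A0 : 0 < 2 ^ (esize e1 * b) by rewrite expn_gt0.
have B0 : 0 < 2 ^ (esize e2 * b) by rewrite expn_gt0.
have C0 : 2 <= 2 ^ b by rewrite -{1}[2]expn1 leq_exp2l.
rewrite mulSn mulnDl !expnD.
move: (eval m e1) (eval m e2) (2 ^ (esize e1 * b)) (2 ^ (esize e2 * b)) (2 ^ b)
  IH1 IH2 A0 B0 C0 => x y A B C xA yB A0 B0 C0.
have AB : A <= C * (A * B).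
  by rewrite mulnCA leq_pmulr // muln_gt0 B0 andbT; apply: leq_trans C0.
case: o => /=.
- have : A + B <= 2 * (A * B) by nia.
  have : 2 * (A * B) <= C * (A * B) by rewrite leq_mul2r C0 orbT.
  lia.
- by apply: leq_trans AB; apply: leq_ltn_trans xA; apply: leq_subr.
- have : x * y < A * B by rewrite ltn_mul.
  have : A * B <= C * (A * B) by rewrite leq_pmull //; apply: leq_trans C0.
  lia.
- by apply: leq_trans AB; apply: leq_ltn_trans xA; apply: leq_div.
- by apply: leq_trans AB; apply: leq_ltn_trans xA; apply: leq_mod.
Qed.

(** There are at most [esize e] nodes, each with a value of at most [esize e * b] bits. *)
Lemma ecost_le m e : bounded m -> ecost m e <= esize e ^ 2 * b.
Proof.
move=> Bm; elim: e => [c|a i IH|o e1 IH1 e2 IH2].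
- have := @bitlen_leq c (esize (Const c) * b) _ (eval_lt (Const c) Bm).
  rewrite muln_gt0 b0 esize_gt0 /= addn0 => /(_ isT) H; apply: leq_trans H _.
  by rewrite leq_mul2r -mulnn leq_pmulr ?orbT.
- have := @bitlen_leq _ _ _ (eval_lt (Read a i) Bm).
  rewrite muln_gt0 b0 esize_gt0 => /(_ isT) /= H.
  have E x : x.+1 ^ 2 * b = x.+1 * b + (x ^ 2 * b + x * b) by rewrite -!mulnn; nia.
  rewrite E; lia.
- have := @bitlen_leq _ _ _ (eval_lt (Op o e1 e2) Bm).
  rewrite muln_gt0 b0 esize_gt0 => /(_ isT) /= H.
  have E x y : (x + y).+1 ^ 2 * b = (x + y).+1 * b + (x ^ 2 * b + y ^ 2 * b + (2 * x * y + x + y) * b).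
    by rewrite -!mulnn; nia.
  rewrite E; lia.
Qed.

(** Pays for a [Write], which evaluates two expressions of size at most [cap], and for a [Skip]. *)
Definition unit_cost := (2 * cap ^ 2 * b).+1.

Lemma ecost_unit m e : bounded m -> esize e <= cap -> ecost m e <= cap ^ 2 * b.
Proof.
move=> Bm eS; apply: leq_trans (ecost_le _ Bm) _.
by rewrite leq_mul2r leq_exp2r // eS orbT.
Qed.

(* A record, so that [apply] does not look under the hypothesis [bounded m]. *)
Record wp (p : com) (m : memory) (k : nat) (Q : memory -> Prop) : Prop := Wp {
  wp_run : bounded m ->
    exists m' t, [/\ exec p m t m', t <= k * unit_cost, bounded m' & Q m'] }.

Lemma wp_weaken p m k k' (Q Q' : memory -> Prop) :
  wp p m k Q -> k <= k' -> (forall m', Q m' -> Q' m') -> wp p m k' Q'.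
Proof.
move=> H kk QQ; split=> /(wp_run H)[m' [t [E tk Bm /QQ]]]; exists m', t; split=> //.
by apply: leq_trans tk _; rewrite leq_mul2r kk orbT.
Qed.

Lemma wp_skip m (Q : memory -> Prop) : Q m -> wp Skip m 1 Q.
Proof. by move=> Qm; split=> Bm; exists m, 1; split => //; apply: ExecSkip. Qed.

Lemma wp_write a i e m (Q : memory -> Prop) :
  esize i <= cap -> esize e <= cap -> eval m e < 2 ^ b ->
  Q (update m a (eval m i) (eval m e)) -> wp (Write a i e) m 1 Q.
Proof.
move=> iS eS ev Qm; split=> Bm.
exists (update m a (eval m i) (eval m e)), (ecost m i + ecost m e); split => //.
- exact: ExecWrite.
- have := ecost_unit Bm iS; have := ecost_unit Bm eS; rewrite mul1n /unit_cost -mulnA; lia.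
- by move=> c j; rewrite /update; case: ifP.
Qed.

Lemma wp_seq p q m k1 k2 (Q : memory -> Prop) :
  wp p m k1 (fun m' => wp q m' k2 Q) -> wp (Seq p q) m (k1 + k2) Q.
Proof.
move=> H; split=> /(wp_run H)[m1 [t1 [E1 T1 /[swap] /wp_run H2 /H2[m2 [t2 [E2 T2 Bm Qm]]]]]].
by exists m2, (t1 + t2); split => //; [apply: ExecSeq E2 | rewrite mulnDl leq_add].
Qed.

Lemma wp_if e p q m k (Q : memory -> Prop) : esize e <= cap ->
  (eval m e != 0 -> wp p m k Q) -> (eval m e = 0 -> wp q m k Q) ->
  wp (If e p q) m k.+1 Q.
Proof.
move=> eS H1 H2; split=> Bm; have cE := ecost_unit Bm eS.
case: (eqVneq (eval m e) 0) => ev.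
  have [m' [t [E T B' Qm]]] := wp_run (H2 ev) Bm.
  exists m', (ecost m e + t); split => //; first exact: ExecIfFalse.
  by rewrite mulSn leq_add //; rewrite /unit_cost -mulnA; lia.
have [m' [t [E T B' Qm]]] := wp_run (H1 ev) Bm.
exists m', (ecost m e + t); split => //; first exact: ExecIfTrue.
by rewrite mulSn leq_add //; rewrite /unit_cost -mulnA; lia.
Qed.

Lemma wp_while e p k (I : nat -> memory -> Prop) : esize e <= cap ->
  (forall j m, I j m -> eval m e != 0 -> wp p m k (fun m' => exists2 j', j' < j & I j' m')) ->
  forall j m, I j m ->
  wp (While e p) m (j * k.+1).+1 (fun m' => eval m' e = 0 /\ exists j', I j' m').
Proof.
move=> eS H; elim/ltn_ind => j IH m Im; split=> Bm; have cE := ecost_unit Bm eS.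
case: (eqVneq (eval m e) 0) => ev.
  exists m, (ecost m e); split => //; first exact: ExecWhileFalse.
    by rewrite mulSn /unit_cost -mulnA; lia.
  by split => //; exists j.
have [m1 [t1 [E1 T1 B1 [j' jj I1]]]] := wp_run (H j m Im ev) Bm.
have [m2 [t2 [E2 T2 B2 Q2]]] := wp_run (IH _ jj _ I1) B1.
exists m2, (ecost m e + t1 + t2); split => //; first exact: ExecWhileTrue E2.
apply: (@leq_trans (unit_cost + k * unit_cost + (j' * k.+1).+1 * unit_cost)).
  by rewrite !leq_add //; rewrite /unit_cost -mulnA; lia.
rewrite -mulSn -mulnDl leq_mul2r; apply/orP; right.
have : j'.+1 * k.+1 <= j * k.+1 by rewrite leq_mul2r jj orbT.
by rewrite mulSn; lia.
Qed.

Lemma wp_for e p k n (I : nat -> memory -> Prop) m : esize e <= cap ->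
  (forall i m, i <= n -> I i m -> eval m e = n - i) ->
  (forall i m, i < n -> I i m -> wp p m k (I i.+1)) ->
  I 0 m -> wp (While e p) m (n * k.+1).+1 (I n).
Proof.
move=> eS He H I0.
have := @wp_while e p k (fun j m => j <= n /\ I (n - j) m) eS _ n m.
rewrite subnn => W; apply: wp_weaken (W _ _) _ _ => //.
- move=> j m' [jn Ij]; rewrite (He _ _ _ Ij) ?leq_subr // subKn // => j0.
  have jl : n - j < n by lia.
  apply: wp_weaken (H _ _ jl Ij) _ _ => // m2 I2; exists j.-1; first lia.
  by split; [lia | rewrite (_ : n - j.-1 = (n - j).+1) //; lia].
- move=> m' [ev [j [jn Ij]]]; move: ev; rewrite (He _ _ _ Ij) ?leq_subr // subKn // => j0.
  by rewrite j0 subn0 in Ij.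
Qed.
End WP.

Definition agree (s : seq nat) (m m' : memory) := forall a i, a \notin s -> m' a i = m a i.

Lemma agree_trans s m1 m2 m3 : agree s m1 m2 -> agree s m2 m3 -> agree s m1 m3.
Proof. by move=> H1 H2 a i ai; rewrite H2 // H1. Qed.

Lemma agree_sub s s' m m' : agree s m m' -> {subset s <= s'} -> agree s' m m'.
Proof. by move=> H ss a i ai; apply: H; apply: contra ai => /ss. Qed.

Lemma agree_update s m m' a i v : agree s m m' -> a \in s -> agree s m (update m' a i v).
Proof.
move=> H ain c j cs; rewrite /update; case: eqP => [E|_] /=; last exact: H.
by rewrite E ain in cs.
Qed.

(** * The program *)

(* The arrays from [aPW] on are: the powers of the base M of the keys, a mark for
   every key seen so far, the multiplicities of the keys, and the stacks of pending
   keys; [aLEN] holds the heights of the stacks, and entry i of stack c is in cell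
   c + R * i of [aSTK]. The other arrays serve as scalar variables (in cell 0). *)
Local Notation aM := 1 (only parsing).
Local Notation aR := 2 (only parsing).
Local Notation aX := 3 (only parsing).
Local Notation aKEY := 4 (only parsing).
Local Notation aLEV := 5 (only parsing).
Local Notation aU := 6 (only parsing).
Local Notation aQ := 7 (only parsing).
Local Notation aE := 8 (only parsing).
Local Notation aW := 9 (only parsing).
Local Notation aRR := 10 (only parsing).
Local Notation aK := 11 (only parsing).
Local Notation aV := 12 (only parsing).
Local Notation aMN := 13 (only parsing).
Local Notation aMX := 14 (only parsing).
Local Notation aP := 15 (only parsing).
Local Notation aLV := 16 (only parsing).
Local Notation aRK := 17 (only parsing).
Local Notation aRES := 18 (only parsing).
Local Notation aBIN := 19 (only parsing).
Local Notation aI := 20 (only parsing).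
Local Notation aRC := 21 (only parsing).
Local Notation aD := 22 (only parsing).
Local Notation aC := 23 (only parsing).
Local Notation aPW := 24 (only parsing).
Local Notation aSEEN := 25 (only parsing).
Local Notation aCNT := 26 (only parsing).
Local Notation aLEN := 27 (only parsing).
Local Notation aSTK := 28 (only parsing).

Local Notation "p ;; q" := (Seq p q) (at level 90, right associativity).
Local Notation sc a := (Read a (Const 0)) (only parsing).
Local Notation set a e := (Write a (Const 0) e) (only parsing).
Local Notation eN := (Read 0 (Const 0)) (only parsing).
Local Notation eL := (Read 0 (Const 1)) (only parsing).
Local Notation eS := (Read 0 (Const 2)) (only parsing).
Definition eadd := Op Add.
Definition esub := Op Defs.Sub.
Definition emul := Op Mul.
Definition ediv := Op Div.
Definition emod := Op Mod.
Definition eone := Const 1.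
(** Since subtraction is truncated, tests with values 0 and 1 as well as maxima and minima need no
    branching. *)
Definition enz e := esub eone (esub eone e).
Definition ez e := esub eone e.
Definition eeq e f := esub eone (eadd (esub e f) (esub f e)).
Definition emax e f := eadd e (esub f e).
Definition emin e f := esub e (esub e f).
Definition edig k x := emod (ediv k (Read aPW x)) (sc aM).
Definition ewt u x :=
  emax (Read 0 (eadd (Const 3) (eadd (emul u eN) x))) (enz (esub u x)).

Lemma eval_eeq m e f : eval m (eeq e f) = (eval m e == eval m f).
Proof. by rewrite /=; case: eqP; lia. Qed.
Lemma eval_enz m e : eval m (enz e) = (eval m e != 0).
Proof. by rewrite /=; case: eqP; lia. Qed.
Lemma eval_ez m e : eval m (ez e) = (eval m e == 0).
Proof. by rewrite /=; case: eqP; lia. Qed.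
Lemma eval_emax m e f : eval m (emax e f) = maxn (eval m e) (eval m f).
Proof. by rewrite /=; lia. Qed.
Lemma eval_emin m e f : eval m (emin e f) = minn (eval m e) (eval m f).
Proof. by rewrite /=; lia. Qed.

Lemma eval_eadd m e f : eval m (eadd e f) = eval m e + eval m f. Proof. by []. Qed.
Lemma eval_emul m e f : eval m (emul e f) = eval m e * eval m f. Proof. by []. Qed.
Lemma eval_esub m e f : eval m (esub e f) = eval m e - eval m f. Proof. by []. Qed.
Definition evalE := (eval_eeq, eval_enz, eval_emax, eval_emin, eval_ez, eval_emul, eval_eadd, eval_esub).

(** The case distinction of [clip_bound] written as a sum of products with 0/1 tests. *)
Definition push_digit : expr :=
  let d := edig (sc aK) (sc aX) in
  eadd (emul (eeq (sc aX) (sc aU)) (sc aQ))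
       (emul (ez (eeq (sc aX) (sc aU)))
       (emul (ez (eeq (sc aX) (sc aE)))
       (emul (enz d) (emax d (eadd (sc aQ) (ewt (sc aU) (sc aX))))))).

Definition push_loop : com :=
  While (esub eN (sc aX))
    (set aKEY (eadd (sc aKEY) (emul push_digit (Read aPW (sc aX))));;
     set aLEV (eadd (sc aLEV) (ez push_digit));;
     set aX (eadd (sc aX) eone)).

(** Arguments: vertex [aU], its position [aQ], vertex just placed [aE], gaps [aRR], weight [aW], and
    in [aK] the key supplying the old bounds. [aLEV] first counts the zero digits and then becomes
    the rank, which selects the stack. *)
Definition push : com :=
  set aKEY (Const 0);; set aLEV (Const 0);; set aX (Const 0);;
  push_loop;;
  set aKEY (eadd (sc aKEY) (emul (Read aPW eN) (eadd (sc aU) (emul eN (sc aRR)))));;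
  set aLEV (eadd (emul (sc aLEV) (sc aM)) (sc aQ));;
  If (Read aSEEN (sc aKEY)) Skip
     (Write aSEEN (sc aKEY) eone;;
      Write aSTK (eadd (sc aLEV) (emul (sc aR) (Read aLEN (sc aLEV)))) (sc aKEY);;
      Write aLEN (sc aLEV) (eadd (Read aLEN (sc aLEV)) eone));;
  Write aCNT (sc aKEY) (eadd (Read aCNT (sc aKEY)) (sc aW)).

Section Rules.
Variables (b : nat).
Hypothesis b0 : 0 < b.
Notation wp := (wp b 300).

(** The cap 300 exceeds the size of every expression in the program; this is checked by computation
    at each use. *)
Lemma wp_ws a i e q m k (Q : memory -> Prop) :
  0 < k -> esize i <= 300 -> esize e <= 300 -> eval m e < 2 ^ b ->
  wp q (update m a (eval m i) (eval m e)) k.-1 Q -> wp (Write a i e;; q) m k Q.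
Proof.
move=> k0 iS eS ev H; have -> : k = 1 + k.-1 by lia.
apply: wp_seq.
exact: wp_write.
Qed.

Lemma wp_sq p q m k1 k (P Q : memory -> Prop) :
  wp p m k1 P -> k1 <= k -> (forall m', P m' -> wp q m' (k - k1) Q) -> wp (p;; q) m k Q.
Proof.
move=> H k1k H2; rewrite -(subnKC k1k); apply: wp_seq; exact: wp_weaken H _ _.
Qed.

Lemma wp_k p m k k' (Q : memory -> Prop) : wp p m k Q -> k <= k' -> wp p m k' Q.
Proof. by move=> H kk; apply: wp_weaken H kk _. Qed.
End Rules.

(** * Merging a successor into the table *)

Section Push.
Variables (n l s b : nat) (wt : nat -> nat -> nat).
Let M := n * l + 2.
Let R := n * M.
Notation wp := (wp b 300).
Notation zer := (num_placed n).
Notation clip := (clip_bound wt).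
Notation enc := (state_key n M).
Notation dig := (key_digit M).
Hypothesis b0 : 0 < b.
Hypothesis b_key : M ^ n * (n * n.+1) <= 2 ^ b.
Hypothesis b_rank : R + n < 2 ^ b.

Record ctx (m : memory) : Prop := Ctx {
  ctx_n : m 0 0 = n;
  ctx_l : m 0 1 = l;
  ctx_s : m 0 2 = s;
  ctx_w : forall u x, u < n -> x < n -> maxn (m 0 (3 + (u * n + x))) (x < u) = wt u x;
  ctx_M : m aM 0 = M;
  ctx_R : m aR 0 = R;
  ctx_pw : forall x, x <= n -> m aPW x = M ^ x }.

Lemma ctx_agree t m m' : agree t m m' -> all (fun a => a \notin t) [:: 0; aM; aR; aPW] ->
  ctx m -> ctx m'.
Proof.
move=> A /and5P[t0 t1 t2 t3 _] [c1 c2 c3 c4 c5 c6 c7].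
split; try by rewrite A.
- by move=> u x un xn; rewrite A // c4.
- by move=> x xn; rewrite A // c7.
Qed.

Lemma eval_ewt m u x : ctx m -> eval m u < n -> eval m x < n ->
  eval m (ewt u x) = wt (eval m u) (eval m x).
Proof.
move=> C un xn; rewrite /ewt eval_emax eval_enz /= (ctx_n C) -(ctx_w C) //.
by congr maxn; rewrite subn_eq0 -ltnNge.
Qed.

Lemma eval_push_digit m h u q e i : ctx m -> u < n -> i < n ->
  m aX 0 = i -> m aU 0 = u -> m aQ 0 = q -> m aE 0 = e ->
  (forall x, x < n -> dig (m aK 0) x = h x) ->
  eval m push_digit = clip h e u q i.
Proof.
move=> C un xn EX EU EQ EE HK.
have d : eval m (edig (sc aK) (sc aX)) = h i.
  by rewrite /= EX (ctx_pw C) 1?ltnW // (ctx_M C) -HK.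
have w : eval m (ewt (sc aU) (sc aX)) = wt u i.
  by rewrite eval_ewt //= ?EX ?EU.
rewrite /push_digit; move: (edig _ _) (ewt _ _) d w => dg ew d w.
rewrite !evalE d w /= EX EU EQ EE.
rewrite /clip_bound; case: (eqVneq i u) => [->|iu] /=; first by rewrite mul1n mul0n addn0.
rewrite mul0n mul1n add0n; case: (eqVneq i e) => [->|ie] /=; first by rewrite orbT.
by rewrite mul1n orbF; case: (h i == 0); rewrite ?mul0n ?mul1n.
Qed.
Lemma wp_push_loop m h u q e : ctx m -> u < n ->
  m aX 0 = 0 -> m aKEY 0 = 0 -> m aLEV 0 = 0 -> m aU 0 = u -> m aQ 0 = q -> m aE 0 = e ->
  (forall x, x < n -> dig (m aK 0) x = h x) -> (forall x, x < n -> clip h e u q x < M) ->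
  wp push_loop m (n * 4).+1 (fun m' => [/\ agree [:: aKEY; aLEV; aX] m m',
    m' aKEY 0 = \sum_(x < n) clip h e u q x * M ^ x & m' aLEV 0 = zer (clip h e u q)]).
Proof.
move=> C un EX EKEY ELEV EU EQ EE HK HM.
pose I i m' := [/\ agree [:: aKEY; aLEV; aX] m m', m' aX 0 = i,
  m' aKEY 0 = \sum_(x < i) clip h e u q x * M ^ x & m' aLEV 0 = \sum_(x < i) (clip h e u q x == 0)].
have nb : n < 2 ^ b by apply: leq_ltn_trans b_rank; apply: leq_addl.
apply: wp_weaken (@wp_for b 300 b0 _ _ 3 n I m _ _ _ _) _ _ => //.
- by move=> i m' ile [A Ex _ _]; rewrite /= (A 0 0) // (ctx_n C) Ex.
- move=> i m' ilt [A Ex Ek El].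
  have C' : ctx m' by apply: ctx_agree A _ C.
  have D t : agree [:: aKEY; aLEV] m' t -> eval t push_digit = clip h e u q i.
    move=> At; have Ct : ctx t by apply: ctx_agree At _ C'.
    apply: eval_push_digit Ct un ilt _ _ _ _ _; rewrite ?At ?Ex ?A //.
  have K1 : \sum_(x < i.+1) clip h e u q x * M ^ x < 2 ^ b.
    apply: (@leq_trans (M ^ i.+1)).
      apply: (sum_dig_lt (M := M)); first by rewrite /M addn2.
      by move=> x xi; apply: HM; apply: leq_trans xi _.
    apply: leq_trans b_key; apply: (@leq_trans (M ^ n)).
      by rewrite leq_pexp2l // /M addn2.
    by rewrite leq_pmulr // muln_gt0; apply/andP; split=> //; lia.
  have L1 : \sum_(x < i.+1) (clip h e u q x == 0) < 2 ^ b.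
    apply: leq_ltn_trans nb; apply: leq_trans ilt.
    rewrite -[leqRHS]card_ord -sum1_card; apply: leq_sum => x _; exact: leq_b1.
  rewrite big_ord_recr /= in K1; rewrite big_ord_recr /= in L1.
  apply: wp_ws => //.
    by rewrite eval_eadd eval_emul D //= Ex Ek (ctx_pw C') // ltnW.
  rewrite eval_eadd eval_emul D //= Ex Ek (ctx_pw C'); last exact: ltnW.
  set m1 := update _ _ _ _.
  have A1 : agree [:: aKEY; aLEV] m' m1 by apply: agree_update.
  apply: wp_ws => //; first by rewrite eval_eadd eval_ez D //= /m1 /update /= El.
  rewrite eval_eadd eval_ez D //= /m1 /update /= El.
  apply: wp_write => //; first by rewrite /= Ex addn1; apply: leq_ltn_trans nb.
  rewrite /= Ex addn1 /update; split => //=.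
  + do 3 (apply: agree_update => //).
  + by rewrite big_ord_recr.
  + by rewrite big_ord_recr.
- by split=> //; rewrite ?EKEY ?ELEV big_ord0.
- by move=> m' [A _ Ek El]; split.
Qed.
Record pushed (m : memory) (k c w : nat) (m' : memory) : Prop := Pushed {
  pushed_agree : agree [:: aKEY; aLEV; aX; aSEEN; aCNT; aLEN; aSTK] m m';
  pushed_cnt : forall i, m' aCNT i = m aCNT i + (if i == k then w else 0);
  pushed_seen : forall i, (m' aSEEN i != 0) = (i == k) || (m aSEEN i != 0);
  pushed_len : forall i, m' aLEN i = m aLEN i + ((i == c) && (m aSEEN k == 0));
  pushed_stk : forall i, m' aSTK i =
    if (m aSEEN k == 0) && (i == c + R * m aLEN c) then k else m aSTK i }.

Lemma wp_push m h u q e r w (k := enc u r (clip h e u q)) (c := zer (clip h e u q) * M + q) :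
  ctx m -> u < n -> m aU 0 = u -> m aQ 0 = q -> m aE 0 = e -> m aRR 0 = r -> m aW 0 = w ->
  (forall x, x < n -> dig (m aK 0) x = h x) -> (forall x, x < n -> clip h e u q x < M) ->
  r <= n -> c < R -> (m aLEN c).+1 < 2 ^ b -> m aCNT k + w < 2 ^ b ->
  wp push m (n * 4 + 12) (pushed m k c w).
Proof.
move=> C un EU EQ EE ER EW HK HM rn cR Hlen Hcnt.
have p2 : 0 < 2 ^ b by rewrite expn_gt0.
have one2 : 1 < 2 ^ b by rewrite -{1}(expn0 2) ltn_exp2l.
have kb : k < 2 ^ b.
  by apply: leq_trans b_key; apply: state_key_lt => //; rewrite /M addn2.
have cb : c < 2 ^ b by apply: leq_trans b_rank; rewrite ltnS; apply: leq_trans (ltnW cR) (leq_addr _ _).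
rewrite /push; do 3 (apply: wp_ws => //; first lia).
set m0 := update _ _ _ _.
have A0 : agree [:: aKEY; aLEV; aX] m m0 by do 3 (apply: agree_update => //).
apply: wp_sq.
- apply: (@wp_push_loop m0 h u q e) => //; rewrite ?A0 //; first exact: ctx_agree A0 _ C.
- by lia.
move=> m1 [A1 Ek El].
have {}A1 : agree [:: aKEY; aLEV; aX] m m1 by apply: agree_trans A0 A1.
have C1 : ctx m1 by apply: ctx_agree A1 _ C.
have Ekey : eval m1 (eadd (sc aKEY) (emul (Read aPW eN) (eadd (sc aU) (emul eN (sc aRR))))) = k.
  by rewrite /= Ek (ctx_n C1) (ctx_pw C1) // !A1 // EU ER.
apply: wp_ws => //; [lia | by rewrite Ekey | rewrite Ekey].
set m2 := update _ _ _ _.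
have Elev : eval m2 (eadd (emul (sc aLEV) (sc aM)) (sc aQ)) = c.
  by rewrite /= /m2 /update /= El (ctx_M C1) !A1 // EQ.
apply: wp_ws => //; [lia | by rewrite Elev | rewrite Elev].
set m3 := update _ _ _ _.
have A3 : agree [:: aKEY; aLEV; aX] m m3 by do 2 (apply: agree_update => //).
have E4 : m3 aKEY 0 = k by [].
have E5 : m3 aLEV 0 = c by [].
have E2 : m3 aR 0 = R by rewrite A3 // (ctx_R C).
clearbody m3; clear m2 Elev.
have Es i : m3 aSEEN i = m aSEEN i by rewrite A3.
have Ec i : m3 aCNT i = m aCNT i by rewrite A3.
have El' i : m3 aLEN i = m aLEN i by rewrite A3.
have Et i : m3 aSTK i = m aSTK i by rewrite A3.
have Ew : m3 aW 0 = w by rewrite A3.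
have A3' : agree [:: aKEY; aLEV; aX; aSEEN; aCNT; aLEN; aSTK] m m3.
  by apply: agree_sub A3 _ => i; rewrite !inE => /or3P[] ->; rewrite ?orbT.
apply: (@wp_k _ _ _ (4 + 1)); last lia.
apply: wp_seq; apply: wp_if => // Hs; rewrite /= E4 Es in Hs.
  apply: (@wp_k _ _ _ 1) => //; apply: wp_skip; apply: wp_write => //.
    by rewrite /= E4 Ec Ew.
  rewrite /= E4 Ec Ew; split.
  - by apply: agree_update.
  - by move=> i; rewrite /update /=; case: eqP => [->|_]; rewrite ?Ec ?addn0.
  - by move=> i; rewrite /update /= Es; case: (eqVneq i k) => [->|//].
  - by move=> i; rewrite /update /= El' (negbTE Hs) andbF addn0.
  - by move=> i; rewrite /update /= Et (negbTE Hs).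
apply: wp_ws => //; rewrite /= E4.
set m4 := update _ _ _ _.
apply: wp_ws => //; first by rewrite /m4 /update /= E4.
have -> : eval m4 (eadd (sc aLEV) (emul (sc aR) (Read aLEN (sc aLEV)))) = c + R * m aLEN c.
  by rewrite /m4 /update /= E5 E2 El'.
have -> : eval m4 (sc aKEY) = k by rewrite /m4 /update /= E4.
set m5 := update _ _ _ _.
have E : eval m5 (eadd (Read aLEN (sc aLEV)) eone) = (m aLEN c).+1.
  by rewrite /m5 /m4 /update /= E5 El' addn1.
apply: wp_write => //; first by rewrite E.
have -> : eval m5 (sc aLEV) = c by rewrite /m5 /m4 /update /= E5.
rewrite E; set m6 := update _ _ _ _.
have E6 : m6 aKEY 0 = k by [].
have E7 : m6 aCNT k + m6 aW 0 = m aCNT k + w by rewrite /m6 /m5 /m4 /update /= Ec Ew.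
apply: wp_write => //; first by rewrite /= E6 E7.
rewrite /= E6 E7; split.
- by do 4 (apply: agree_update => //).
- by move=> i; rewrite /m6 /m5 /m4 /update /=; case: eqP => [->|_]; rewrite ?Ec ?addn0.
- by move=> i; rewrite /m6 /m5 /m4 /update /= Es; case: (eqVneq i k).
- move=> i; rewrite /m6 /m5 /m4 /update /= El' Hs eqxx andbT.
  by case: eqP => [->|_]; rewrite ?addn1 ?addn0.
- by move=> i; rewrite /m6 /m5 /m4 /update /= Et Hs eqxx.
Qed.
End Push.

(** * The invariant of the main loop *)

Section Inv.
Variables (n l s : nat) (wt : nat -> nat -> nat).
Hypothesis wt_le : forall u x, u < n -> x < n -> wt u x <= l.
Let M := n * l + 2.
Let R := n * M.
Notation zer := (num_placed n).
Notation clip := (clip_bound wt).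
Notation enc := (state_key n M).
Notation dig := (key_digit M).
Notation vof := (key_vertex n M).
Notation rof := (key_gaps n M).
Notation okst := (okst n l wt).
Notation good := (good n l wt).

Lemma okst_ext v r h h' : eqn_lt n h h' -> okst v r h -> okst v r h'.
Proof.
move=> E H; have vn := ok_v H; have Ev := E v vn; have Ez := num_placed_ext E.
split; rewrite -?Ev -?Ez //.
- exact: ok_hv H.
- move=> x xn xv; rewrite -Ev -(E x xn); exact: (ok_lead H xn xv).
- move=> x xn; rewrite -?Ev -(E x xn); exact: (ok_near H).
- exact: (ok_pos H).
- move=> x xn; rewrite -?Ev -(E x xn); exact: (ok_le H).
- exact: (ok_r H).
have [f fl Ef] := ok_past H; exists f => // x xn xv; rewrite -(E x xn) => hx.
rewrite (Ef x) //; congr maxn; apply: eq_bigl => a; by rewrite E.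
Qed.

Definition key_value (k s : nat) : nat := stval n wt (vof k) (rof k) (dig k) s.
(** Lexicographic in the number of placed vertices and the position, as positions are below [M]. *)
Definition key_rank (k : nat) : nat := zer (dig k) * M + dig k (vof k).

Section Enc.
Variables (v r : nat) (h : nat -> nat).
Hypothesis H : okst v r h.

Lemma okst_digit : eqn_lt n h (dig (enc v r h)).
Proof. by move=> x xn; rewrite key_digit_state_key ?M_gt0 // => y; apply: (ok_ltM wt_le H). Qed.

Lemma okst_vertex : vof (enc v r h) = v.
Proof. by apply: key_vertex_state_key; rewrite ?M_gt0 ?(ok_v H) // => y; apply: (ok_ltM wt_le H). Qed.

Lemma okst_gaps : rof (enc v r h) = r.
Proof. by apply: key_gaps_state_key; rewrite ?M_gt0 ?(ok_v H) // => y; apply: (ok_ltM wt_le H). Qed.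

Lemma key_value_state_key y : key_value (enc v r h) y = stval n wt v r h y.
Proof.
rewrite /key_value okst_vertex okst_gaps; apply/esym/stval_ext; first exact: ok_v H.
exact: okst_digit.
Qed.

Lemma key_rank_state_key : key_rank (enc v r h) = zer h * M + h v.
Proof.
by rewrite /key_rank okst_vertex -(num_placed_ext okst_digit) -okst_digit // (ok_v H).
Qed.
End Enc.

Lemma good_okst k : good k -> okst (vof k) (rof k) (dig k) /\ k = enc (vof k) (rof k) (dig k).
Proof.
move=> [v [r [h [-> H _]]]]; rewrite okst_vertex // okst_gaps //; split.
  exact: okst_ext (okst_digit H) H.
exact: state_key_ext (okst_digit H).
Qed.

Lemma okst_rank_lt v r h : okst v r h -> zer h * M + h v < R.
Proof.
move=> H; have := ok_num_placed H; have := ok_ltM wt_le H (ok_v H); rewrite /R -/M => h1 h2.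
apply: (@leq_trans ((zer h).+1 * M)); first by rewrite mulSn addnC ltn_add2r.
by rewrite leq_mul2r h2 orbT.
Qed.

Lemma good_rank_lt k : good k -> key_rank k < R.
Proof. by case/good_okst => H _; apply: okst_rank_lt H. Qed.

Lemma good_lt k : good k -> k < M ^ n * (n * n.+1).
Proof.
case/good_okst => H ->; apply: state_key_lt; rewrite ?M_gt0 ?(ok_v H) //.
  by move=> y; apply: (ok_ltM wt_le H).
by have := ok_r H; have := ok_num_placed H; lia.
Qed.

(* At this span every state has a completion, which bounds the multiplicities. *)
Definition big_span := s + M + n * l.

Lemma good_key_value k : good k -> 0 < key_value k big_span.
Proof.
case/good_okst => H _; apply: (stval_gt0 wt_le _ (ok_v H) (ok_hv H) (t := M)).
  by move=> x xn; apply/ltnW/(ok_ltM wt_le H).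
rewrite /big_span; lia.
Qed.

Definition total_count (y : nat) := completions n wt n (fun=> 1) y.
Definition pend (m : memory) (c : nat) : seq nat :=
  [seq m aSTK (c + R * i) | i <- iota 0 (m aLEN c)].
Definition todo_value (todo : seq (nat * nat)) y := \sum_(x <- todo) x.1 * key_value x.2 y.

(* [D]: processed keys, [Q]: pending keys; [todo]: contributions (weight, key)
   still to be pushed; [ex]: contribution still to be added to the result. *)
Record Inv (m : memory) (D Q : seq nat) (todo : seq (nat * nat)) (ex : nat) : Prop := IInv {
  inv_uniq : uniq (D ++ Q);
  inv_good : forall k, k \in D ++ Q -> good k;
  inv_seen : forall k, (m aSEEN k != 0) = (k \in D ++ Q);
  inv_cnt0 : forall k, k \notin D ++ Q -> m aCNT k = 0;
  inv_pend : forall c, c < R -> perm_eq (pend m c) [seq k <- Q | key_rank k == c];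
  inv_D : forall k, k \in D -> key_rank k <= m aRK 0;
  inv_Q : forall k, k \in Q -> m aRK 0 <= key_rank k;
  inv_todo : forall x, x \in todo -> good x.2 /\ m aRK 0 < key_rank x.2;
  inv_sum : m aRES 0 + ex + \sum_(k <- Q) m aCNT k * key_value k s + todo_value todo s = total_count s;
  inv_big : \sum_(k <- Q) m aCNT k * key_value k big_span + todo_value todo big_span <= total_count big_span }.

Lemma inv_agree t m m' D Q todo ex : agree t m m' ->
  all (fun a => a \notin t) [:: aSEEN; aCNT; aLEN; aSTK; aRK; aRES] ->
  Inv m D Q todo ex -> Inv m' D Q todo ex.
Proof.
move=> A /and5P[t1 t2 t3 t4 /and3P[t5 t6 _]] [i1 i2 i3 i4 i5 i6 i7 i8 i9 i10].
have Ec k : m' aCNT k = m aCNT k by rewrite A.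
split => //; rewrite ?(A aRK) ?(A aRES) //.
- by move=> k; rewrite A // i3.
- by move=> k; rewrite A //; apply: i4.
- by move=> c cR; rewrite /pend A // (eq_map (g := fun i => m aSTK (c + R * i))) ?i5 // => i; rewrite A.
- by under eq_bigr do rewrite Ec.
- by under eq_bigr do rewrite Ec.
Qed.

(** Every value at [big_span] is at least 1, so a multiplicity is at most its own contribution to
    the sum in [inv_big]. *)
Lemma inv_weight m D Q w k todo ex : Inv m D Q ((w, k) :: todo) ex -> m aCNT k + w <= total_count big_span.
Proof.
move=> I; have [gk rk] := inv_todo I (mem_head _ _); have kv := good_key_value gk.
have := inv_big I; rewrite /todo_value big_cons /=.
have kD : k \notin D by apply/negP => /(inv_D I); rewrite leqNgt rk.
have uQ : uniq Q by have := inv_uniq I; rewrite cat_uniq => /and3P[].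
case: (boolP (k \in Q)) => kQ.
  rewrite (bigD1_seq k) //=.
  have := leq_pmulr (m aCNT k + w) kv; rewrite mulnDl => H1 H2.
  apply: leq_trans H1 _; apply: leq_trans H2.
  by rewrite -!addnA leq_add2l addnCA leq_addr.
rewrite (inv_cnt0 I) ?mem_cat ?negb_or ?kD // add0n.
move=> H; apply: leq_trans (leq_pmulr w kv) _; apply: leq_trans H.
by rewrite addnCA leq_addr.
Qed.

Lemma inv_size m D Q todo ex : Inv m D Q todo ex -> size (D ++ Q) <= M ^ n * (n * n.+1).
Proof.
move=> I; rewrite -(size_iota 0 (M ^ n * _)); apply: uniq_leq_size; first exact: inv_uniq I.
by move=> k /(inv_good I)/good_lt; rewrite mem_iota.
Qed.

Lemma inv_len m D Q todo ex c : Inv m D Q todo ex -> c < R -> m aLEN c <= M ^ n * (n * n.+1).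
Proof.
move=> I cR; apply: leq_trans (inv_size I).
rewrite -(size_iota 0 (m aLEN c)) -(size_map (fun i => m aSTK (c + R * i))).
rewrite (perm_size (inv_pend I cR)) size_filter size_cat.
by apply: leq_trans (count_size _ _) (leq_addl _ _).
Qed.

Lemma inv_push m m' D Q w k todo ex : Inv m D Q ((w, k) :: todo) ex ->
  pushed n l m k (key_rank k) w m' -> exists Q', Inv m' D Q' todo ex.
Proof.
move=> I [A Ec Es El Et]; have [gk rk] := inv_todo I (mem_head _ _).
have kR := good_rank_lt gk.
have kD : k \notin D by apply/negP => /(inv_D I); rewrite leqNgt rk.
have uDQ := inv_uniq I.
have uQ : uniq Q by move: uDQ; rewrite cat_uniq => /and3P[].
have R0 : 0 < R by apply: leq_ltn_trans kR.
have td : forall x, x \in todo -> good x.2 /\ m aRK 0 < key_rank x.2.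
  by move=> x xt; apply: (inv_todo I); rewrite inE xt orbT.
have pE c : c < R -> pend m' c =
    if (c == key_rank k) && (k \notin D ++ Q) then rcons (pend m c) k else pend m c.
  move=> cR; have sk : (m aSEEN k == 0) = (k \notin D ++ Q) by rewrite -(inv_seen I) negbK.
  rewrite /pend El sk; case: ifP => [/andP[/eqP cE kN]|H].
    rewrite cE /= iotaD map_cat cats1 /= Et sk kN eqxx; congr rcons.
    apply/eq_in_map => i; rewrite mem_iota => /andP[_ iL].
    by rewrite Et eqn_add2l eqn_pmul2l // (_ : (i == _) = false) ?andbF //; apply/eqP; lia.
  rewrite addn0; apply/eq_in_map => i; rewrite mem_iota add0n => /andP[_ iL].
  rewrite Et sk; case: (k \notin _) H => //=; rewrite andbT => ck.
  case: eqP => // E; case/eqP: ck.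
  (* The residue modulo [R] of a cell of [aSTK] tells which stack it belongs to, so stacks never
     overlap. *)
  by have /(congr1 (modn^~ R)) := E; rewrite ![_ + R * _]addnC ![R * _]mulnC !modnMDl !modn_small.
case: (boolP (k \in Q)) => kQ.
  have kDQ : k \in D ++ Q by rewrite mem_cat kQ orbT.
  have sumE y : \sum_(j <- Q) m' aCNT j * key_value j y = \sum_(j <- Q) m aCNT j * key_value j y + w * key_value k y.
    rewrite (bigD1_seq k) //= [in RHS](bigD1_seq k) //= Ec eqxx mulnDl -!addnA; congr (_ + _).
    by rewrite addnC; congr (_ + _); apply: eq_bigr => j jk; rewrite Ec (negbTE jk) addn0.
  exists Q; split; rewrite ?(A aRK) ?(A aRES) //.
  - exact: inv_good I.
  - by move=> j; rewrite Es (inv_seen I); case: eqP => [->|].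
  - move=> j jN; rewrite Ec (inv_cnt0 I) //; case: eqP => // E; by rewrite E kDQ in jN.
  - by move=> c cR; rewrite pE // kDQ andbF; apply: (inv_pend I cR).
  - exact: inv_D I.
  - exact: inv_Q I.
  - by rewrite sumE -(inv_sum I) /todo_value big_cons /= !addnA.
  - by rewrite sumE; have := inv_big I; rewrite /todo_value big_cons /= !addnA.
have kDQ : k \notin D ++ Q by rewrite mem_cat negb_or kD.
have mem j : (j \in D ++ k :: Q) = (j == k) || (j \in D ++ Q).
  by rewrite !mem_cat inE orbCA.
have sumE y : \sum_(j <- k :: Q) m' aCNT j * key_value j y = \sum_(j <- Q) m aCNT j * key_value j y + w * key_value k y.
  rewrite big_cons Ec eqxx (inv_cnt0 I) // add0n addnC; congr (_ + _).
  rewrite big_seq [RHS]big_seq; apply: eq_bigr => j jQ; rewrite Ec.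
  by case: eqP => [E|]; rewrite ?addn0 //; rewrite E (negbTE kQ) in jQ.
exists (k :: Q); split; rewrite ?(A aRK) ?(A aRES) //.
- by rewrite (uniq_catCA D [:: k] Q) /= kDQ uDQ.
- by move=> j; rewrite mem => /orP[/eqP ->|/(inv_good I)].
- by move=> j; rewrite Es mem (inv_seen I).
- move=> j; rewrite mem negb_or => /andP[jk jN]; by rewrite Ec (negbTE jk) addn0; apply: (inv_cnt0 I).
- move=> c cR; rewrite pE // kDQ andbT /= eq_sym; case: ifP => _; last exact: (inv_pend I cR).
  by rewrite perm_rcons perm_cons; apply: (inv_pend I cR).
- exact: inv_D I.
- by move=> j; rewrite inE => /orP[/eqP ->|/(inv_Q I)//]; apply: ltnW.
- by rewrite sumE -(inv_sum I) /todo_value big_cons /= !addnA.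
- by rewrite sumE; have := inv_big I; rewrite /todo_value big_cons /= !addnA.
Qed.

(** How the value of [k] is redistributed is left open: any later states will do that, together with
    [ex], have the same value at span [s]. At [big_span] an inequality suffices, because what goes
    into the result is simply dropped there. *)
Lemma inv_pop m m' D Q (c := m aRK 0) (k := m aSTK (c + R * (m aLEN c).-1)) :
  Inv m D Q [::] 0 -> c < R -> m aLEN c != 0 ->
  (forall a i, a \in [:: aSEEN; aCNT; aSTK; aRK; aRES] -> m' a i = m a i) ->
  (forall i, m' aLEN i = if i == c then (m aLEN c).-1 else m aLEN i) ->
  [/\ good k, key_rank k = c, k \notin D &
    forall todo ex,
    (forall x, x \in todo -> good x.2 /\ c < key_rank x.2) ->
    m aCNT k * key_value k s = ex + todo_value todo s ->
    todo_value todo big_span <= m aCNT k * key_value k big_span ->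
    Inv m' (k :: D) (rem k Q) todo ex].
Proof.
move=> I cR Lc A El.
have pc : pend m c = rcons (pend m' c) k.
  have Lp : m aLEN c = (m aLEN c).-1 + 1 by lia.
  rewrite /pend El eqxx {1}Lp iotaD map_cat cats1 /= add0n.
  by congr rcons; apply/eq_in_map => i _; rewrite A.
have kf : k \in [seq j <- Q | key_rank j == c].
  by rewrite -(perm_mem (inv_pend I cR)) pc mem_rcons mem_head.
have /andP[/eqP rk kQ] := etrans (esym (mem_filter (fun j => key_rank j == c) k Q)) kf.
have gk : good k by apply: (inv_good I); rewrite mem_cat kQ orbT.
have uDQ := inv_uniq I.
have kD : k \notin D.
  move: uDQ; rewrite cat_uniq => /and3P[_ /hasPn H _]; exact: H.
have pQ : perm_eq Q (k :: rem k Q) := perm_to_rem kQ.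
have pDQ : perm_eq ((k :: D) ++ rem k Q) (D ++ Q).
  rewrite perm_sym; apply: perm_trans (_ : perm_eq _ (D ++ k :: rem k Q)) _.
    by rewrite perm_cat2l.
  by rewrite -cat1s perm_catCA.
split=> // todo ex td sumE bigE.
have Ec j : m' aCNT j = m aCNT j by apply: A.
have ERK : m' aRK 0 = c by apply: A.
have ERES : m' aRES 0 = m aRES 0 by apply: A.
have sQ y : \sum_(j <- Q) m aCNT j * key_value j y =
    m aCNT k * key_value k y + \sum_(j <- rem k Q) m' aCNT j * key_value j y.
  rewrite (perm_big _ pQ) big_cons; congr (_ + _).
  by apply: eq_bigr => j _; rewrite Ec.
split; rewrite ?ERK ?ERES //.
- by rewrite (perm_uniq pDQ).
- by move=> j; rewrite (perm_mem pDQ) => /(inv_good I).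
- by move=> j; rewrite (perm_mem pDQ) A // (inv_seen I).
- by move=> j; rewrite (perm_mem pDQ) Ec => /(inv_cnt0 I).
- move=> d dR; have P := inv_pend I dR.
  have Pf : perm_eq [seq j <- Q | key_rank j == d] [seq j <- k :: rem k Q | key_rank j == d].
    exact: perm_filter.
  have {}P := perm_trans P Pf; move: P; rewrite /= rk eq_sym.
  case: (eqVneq d c) => [->|dc].
    by rewrite pc perm_rcons perm_cons.
  apply: perm_trans; rewrite /pend El (negbTE dc) (eq_map (g := fun i => m aSTK (d + R * i))) //.
  by move=> i; rewrite A.
- by move=> j; rewrite inE => /orP[/eqP ->|/(inv_D I)//]; rewrite rk.
- by move=> j /mem_rem /(inv_Q I).
- have := inv_sum I; rewrite {1}/todo_value big_nil sQ sumE !addn0 => <-.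
  by rewrite -!addnA; congr (_ + (_ + _)); rewrite addnC.
- have := inv_big I; rewrite sQ {1}/todo_value big_nil addn0; apply: leq_trans.
  by rewrite addnC leq_add2r.
Qed.
End Inv.

(** * The main loop and the processing of one state *)

Definition expand : com :=
  set aU (Const 0);;
  While (esub eN (sc aU))
    (If (emul (enz (edig (sc aK) (sc aU))) (ez (eeq (sc aU) (sc aE))))
        (set aQ (edig (sc aK) (sc aU));; push) Skip;;
     set aU (eadd (sc aU) eone)).

(** The slack of [x] is the excess of its bound over [p + wt v x]. A maximum 0 in [aMX] means that
    all bounds are tight; the minimum in [aMN] tells how far [v] can move until one becomes tight;
    [aLV] tells whether anyone else is waiting. *)
Definition slack_loop : com :=
  While (esub eN (sc aX))
    (set aC (emul (enz (edig (sc aK) (sc aX))) (ez (eeq (sc aX) (sc aV))));;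
     set aD (esub (edig (sc aK) (sc aX)) (eadd (sc aP) (ewt (sc aV) (sc aX))));;
     set aMN (esub (sc aMN) (emul (sc aC) (esub (sc aMN) (sc aD))));;
     set aMX (eadd (sc aMX) (emul (sc aC) (esub (sc aD) (sc aMX))));;
     set aLV (enz (eadd (sc aLV) (sc aC)));;
     set aX (eadd (sc aX) eone)).

Definition last_step : com :=
  set aBIN eone;; set aI (Const 0);;
  While (esub (eadd (sc aRC) eone) (sc aI))
    (set aBIN (ediv (emul (sc aBIN) (eadd (esub (eadd eS eone) (sc aP)) (sc aI)))
                    (eadd (sc aI) eone));;
     set aI (eadd (sc aI) eone));;
  set aRES (eadd (sc aRES) (emul (Read aCNT (sc aK)) (sc aBIN))).

(** The jump is the minimal slack, or 1 if some bound is tight already. It is also the number of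
    positions at which [v] leaves all bounds unchanged, hence the factor in [aW]. If all bounds are
    tight, a free gap is counted in [aRR] and [v] is not moved. *)
Definition inner_step : com :=
  set aE (sc aV);;
  set aRR (eadd (sc aRC) (ez (sc aMX)));;
  set aC (Read aCNT (sc aK));;
  set aW (emul (sc aC) (emax (sc aMN) eone));;
  expand;;
  If (sc aMX)
     (set aU (sc aV);;
      set aQ (eadd (sc aP) (emax (sc aMN) eone));;
      set aE eN;;
      set aW (sc aC);;
      push) Skip.

Definition process : com :=
  Write aLEN (sc aRK) (esub (Read aLEN (sc aRK)) eone);;
  set aK (Read aSTK (eadd (sc aRK) (emul (sc aR) (Read aLEN (sc aRK)))));;
  set aV (emod (ediv (sc aK) (Read aPW eN)) eN);;
  set aRC (ediv (ediv (sc aK) (Read aPW eN)) eN);;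
  set aP (edig (sc aK) (sc aV));;
  set aMN (sc aM);; set aMX (Const 0);; set aLV (Const 0);; set aX (Const 0);;
  slack_loop;;
  If (sc aLV) inner_step last_step.

Definition main_loop : com :=
  While (esub (sc aR) (sc aRK))
    (If (Read aLEN (sc aRK)) process (set aRK (eadd (sc aRK) eone))).

(** * Correctness and cost of the main loop *)

Section Steps.
Variables (n l s b : nat) (wt : nat -> nat -> nat).
Hypothesis n_gt1 : 1 < n.
Hypothesis wt_le : forall u x, u < n -> x < n -> wt u x <= l.
Let M := n * l + 2.
Let R := n * M.
Notation wp := (wp b 300).
Notation zer := (num_placed n).
Notation clip := (clip_bound wt).
Notation enc := (state_key n M).
Notation dig := (key_digit M).
Notation vof := (key_vertex n M).
Notation rof := (key_gaps n M).
Notation okst := (okst n l wt).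
Notation good := (good n l wt).
Notation ctx := (ctx n l s wt).
Notation kval := (key_value n l wt).
Notation rank := (key_rank n l).
Notation Inv := (Inv n l s wt).
Notation total := (total_count n wt).
Notation todo_sum := (todo_value n l wt).
Notation sbig := (big_span n l s).
Hypothesis b0 : 0 < b.
Hypothesis b_key : (M ^ n * (n * n.+1)).+1 < 2 ^ b.
Hypothesis b_rank : R + n < 2 ^ b.
Hypothesis b_big : total sbig < 2 ^ b.
Hypothesis b_tot : total s < 2 ^ b.
Hypothesis b_bin : forall a i, a <= s + n + 1 -> i <= n -> 'C(a, i) < 2 ^ b.

Lemma lt_1_2b : 1 < 2 ^ b. Proof. by rewrite -{1}(expn0 2) ltn_exp2l. Qed.
Lemma lt_0_2b : 0 < 2 ^ b. Proof. by rewrite expn_gt0. Qed.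
Lemma lt_n_2b : n < 2 ^ b. Proof. by apply: leq_ltn_trans b_rank; apply: leq_addl. Qed.
Lemma lt_M_2b : M < 2 ^ b.
Proof. apply: leq_ltn_trans b_rank; rewrite /R; nia. Qed.
Lemma lt_key_2b k : good k -> k < 2 ^ b.
Proof. by move=> /(good_lt wt_le) H; apply: ltn_trans H _; apply: ltn_trans b_key. Qed.

(** The successors that [expand] still has to push when its counter is [i]. *)
Definition todo_place (e r w : nat) (h : nat -> nat) (i : nat) : seq (nat * nat) :=
  [seq (w, enc u r (clip h e u (h u))) | u <- iota i (n - i) & (u != e) && (h u != 0)].

Lemma todo_placeS e r w h i : i < n -> todo_place e r w h i =
  (if (i != e) && (h i != 0) then [:: (w, enc i r (clip h e i (h i)))] else [::]) ++ todo_place e r w h i.+1.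
Proof.
move=> ilt; rewrite /todo_place -(subnSK ilt) /=; by case: ifP.
Qed.

Lemma todo_place_sum e r w h y :
  (forall u, u < n -> u != e -> h u != 0 -> okst u r (clip h e u (h u))) ->
  todo_sum (todo_place e r w h 0) y =
  w * \sum_(u < n | (u != e :> nat) && (h u != 0)) stval n wt u r (clip h e u (h u)) y.
Proof.
move=> H; rewrite /todo_value /todo_place big_map subn0 big_filter.
rewrite -(big_mkord (fun u => (u != e) && (h u != 0)) (fun u => stval n wt u r (clip h e u (h u)) y)).
rewrite /index_iota subn0 big_distrr /= big_seq_cond [RHS]big_seq_cond; apply: eq_bigr => u.
rewrite mem_iota add0n /= => /and3P[un ue hu]; congr (_ * _).
by apply: key_value_state_key => //; apply: H.
Qed.

Definition expand_arrays := [:: aU; aQ; aKEY; aLEV; aX; aSEEN; aCNT; aLEN; aSTK].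

Lemma wp_push_inv m h u q e r w D Q rest ex : ctx m ->
  m aU 0 = u -> m aQ 0 = q -> m aE 0 = e -> m aRR 0 = r -> m aW 0 = w ->
  (forall x, x < n -> dig (m aK 0) x = h x) -> okst u r (clip h e u q) ->
  Inv m D Q ((w, enc u r (clip h e u q)) :: rest) ex ->
  wp push m (n * 4 + 12) (fun m' =>
    agree [:: aKEY; aLEV; aX; aSEEN; aCNT; aLEN; aSTK] m m' /\ exists Q', Inv m' D Q' rest ex).
Proof.
move=> C EU EQ EE ER EW HK H I.
have cq : clip h e u q u = q by rewrite /clip_bound eqxx.
have rk : rank (enc u r (clip h e u q)) = zer (clip h e u q) * M + q.
  by rewrite (key_rank_state_key wt_le H) cq.
have rR : zer (clip h e u q) * M + q < R by rewrite -rk; apply: (good_rank_lt wt_le); case: (inv_todo I (mem_head _ _)).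
have un := ok_v H.
apply: wp_weaken (leqnn _) _.
  apply: (@wp_push n l s b wt b0 _ b_rank m h u q e r w) => //.
  - exact/ltnW/ltnW.
  - by move=> x xn; apply: (ok_ltM wt_le H).
  - by have := ok_r H; have := ok_num_placed H; lia.
  - by apply: leq_ltn_trans b_key; rewrite ltnS; apply: (inv_len wt_le I).
  - by apply: leq_ltn_trans b_big; apply: (inv_weight wt_le I).
rewrite -/M => m' Pm; split; first exact: pushed_agree Pm.
by apply: (inv_push wt_le I); rewrite rk.
Qed.

Lemma wp_expand m D Q e r w rest ex (h := dig (m aK 0)) : ctx m ->
  m aE 0 = e -> m aRR 0 = r -> m aW 0 = w ->
  (forall u, u < n -> u != e -> h u != 0 -> okst u r (clip h e u (h u))) ->
  Inv m D Q (todo_place e r w h 0 ++ rest) ex ->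
  wp expand m (n * (n * 4 + 16) + 2) (fun m' => agree expand_arrays m m' /\ exists Q', Inv m' D Q' rest ex).
Proof.
move=> C EE ER EW HO I0.
apply: wp_ws => //; [lia | exact: lt_0_2b |].
set m0 := update _ _ _ _.
have A0 : agree expand_arrays m m0 by apply: agree_update.
pose J i m' := [/\ agree expand_arrays m m', m' aU 0 = i &
  exists Q', Inv m' D Q' (todo_place e r w h i ++ rest) ex].
apply: wp_weaken (@wp_for b 300 b0 _ _ (n * 4 + 15) n J m0 _ _ _ _) _ _ => //.
- by move=> i m' ile [A Ex _]; rewrite /= (A 0 0) // (ctx_n C) Ex.
- move=> i m' ilt [A Eu [Q' I]].
  have C' : ctx m' by apply: ctx_agree A _ C.
  have d : eval m' (edig (sc aK) (sc aU)) = h i.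
    by rewrite /= Eu (ctx_pw C') 1?ltnW // (ctx_M C') (A aK).
  have hM : h i < M by rewrite /h /key_digit ltn_mod M_gt0.
  apply: (@wp_k _ _ _ ((n * 4 + 14) + 1)); last lia.
  apply: wp_seq; apply: (@wp_k _ _ _ (n * 4 + 13).+1); last lia.
  have ib : i.+1 < 2 ^ b by apply: leq_ltn_trans lt_n_2b.
  rewrite todo_placeS // in I.
  apply: wp_if => //; rewrite eval_emul eval_enz eval_ez eval_eeq d /= Eu (A aE) // EE.
    rewrite muln_eq0 !eqb0 negb_or !negbK => /andP[hi ie].
    rewrite ie hi /= in I.
    apply: wp_ws => //; [lia | by rewrite d; apply: ltn_trans hM lt_M_2b | rewrite d].
    set m1 := update _ _ _ _.
    have A1 : agree expand_arrays m m1 by apply: agree_update.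
    have A1' : agree [:: aQ] m' m1 by apply: agree_update.
    have C1 : ctx m1 by apply: ctx_agree A1' _ C'.
    have F1 : m1 aU 0 = i by rewrite A1'.
    have F2 : m1 aE 0 = e by rewrite A1.
    have F3 : m1 aRR 0 = r by rewrite A1.
    have F4 : m1 aW 0 = w by rewrite A1.
    have F5 x : x < n -> dig (m1 aK 0) x = h x by rewrite A1.
    have I1 := inv_agree A1' isT I.
    apply: wp_weaken (wp_push_inv C1 F1 _ F2 F3 F4 F5 (HO _ ilt ie hi) I1) _ _ => //; first lia.
    move=> m2 [A2 [Q2 I2]]; apply: wp_write => //; first by rewrite /= A2 // /m1 /update /= Eu addn1.
    rewrite /= A2 // /m1 /update /= Eu addn1; split=> //.
      apply: agree_update => //; apply: agree_trans A1 _; apply: agree_sub A2 _.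
      by apply/allP.
    by exists Q2; apply: (@inv_agree _ _ _ _ [:: aU]) I2 => //; apply: agree_update.
  move=> /eqP; rewrite muln_eq0 !eqb0 !negbK => H.
  have cf : (i != e) && (h i != 0) = false by case: (h i == 0) (i == e) H => [] [].
  rewrite cf /= in I.
  apply: (@wp_k _ _ _ 1); last lia.
  apply: wp_skip; apply: wp_write => //; rewrite /= Eu addn1 //.
  split=> //; first by apply: agree_update.
  by exists Q'; apply: (@inv_agree _ _ _ _ [:: aU]) I => //; apply: agree_update.
- split => //; exists Q; rewrite -/h.
  by apply: (@inv_agree _ _ _ _ [:: aU]) I0 => //; apply: agree_update.
- lia.
- move=> m' [A _ [Q' I]]; split=> //; exists Q'.
  by move: I; rewrite /todo_place subnn.
Qed.

Definition slack (h : nat -> nat) (v x : nat) : nat := h x - (h v + wt v x).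
Definition other (h : nat -> nat) (v x : nat) : bool := (x != v) && (h x != 0).

(** The default [M] for the minimum of no slacks is safe, since every slack is at most [M]. *)
Record extrema (h : nat -> nat) (v i mn mx lv : nat) : Prop := Extrema {
  ext_mn_mx : forall x, x < i -> other h v x -> mn <= slack h v x <= mx;
  ext_mx : mx = 0 \/ exists x, [/\ x < i, other h v x & slack h v x = mx];
  ext_mn : if lv == 0 then mn = M else exists x, [/\ x < i, other h v x & slack h v x = mn];
  ext_lv : lv = 0 -> forall x, x < i -> ~~ other h v x;
  ext_le : [/\ mn <= M, mx <= M & lv <= 1] }.

Definition slack_arrays := [:: aX; aC; aD; aMN; aMX; aLV].

Lemma wp_slack m h v : ctx m -> v < n -> m aX 0 = 0 -> m aMN 0 = M -> m aMX 0 = 0 ->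
  m aLV 0 = 0 -> m aV 0 = v -> m aP 0 = h v ->
  (forall x, x < n -> dig (m aK 0) x = h x) ->
  wp slack_loop m (n * 7).+1 (fun m' => agree slack_arrays m m' /\
    extrema h v n (m' aMN 0) (m' aMX 0) (m' aLV 0)).
Proof.
move=> C vn EX EMN EMX ELV EV EP HK.
pose J i m' := [/\ agree slack_arrays m m', m' aX 0 = i &
  extrema h v i (m' aMN 0) (m' aMX 0) (m' aLV 0)].
have hM x : x < n -> h x < M by move=> xn; rewrite -HK // /key_digit ltn_mod M_gt0.
have M2 := lt_M_2b.
apply: wp_weaken (@wp_for b 300 b0 _ _ 6 n J m _ _ _ _) _ _ => //.
- by move=> i m' ile [A Ex _]; rewrite /= (A 0 0) // (ctx_n C) Ex.
- move=> i m' ilt [A Ex E].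
  have C' : ctx m' by apply: ctx_agree A _ C.
  have d t : agree [:: aC; aD] m' t -> eval t (edig (sc aK) (sc aX)) = h i.
    by move=> At; rewrite /= !At // Ex (ctx_pw C') 1?ltnW // (ctx_M C') -(HK _ ilt) A.
  have ib : i.+1 < 2 ^ b by apply: leq_ltn_trans lt_n_2b.
  have [le1 le2 le3] := ext_le E.
  have Mn := hM _ ilt.
  set mn := m' aMN 0 in E le1 *; set mx := m' aMX 0 in E le2 *; set lv := m' aLV 0 in E le3 *.
  have slM : slack h v i <= M by rewrite /slack; lia.
  have ec : eval m' (emul (enz (edig (sc aK) (sc aX))) (ez (eeq (sc aX) (sc aV)))) = other h v i.
    rewrite eval_emul eval_enz eval_ez eval_eeq d //= Ex A // EV /other.
    by case: (i == v) (h i == 0) => [] [].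
  apply: wp_ws => //; first by rewrite ec; apply: leq_ltn_trans lt_1_2b; apply: leq_b1.
  rewrite ec; set m1 := update _ _ _ _.
  have A1 : agree [:: aC; aD] m' m1 by apply: agree_update.
  have ed : eval m1 (esub (edig (sc aK) (sc aX)) (eadd (sc aP) (ewt (sc aV) (sc aX)))) = slack h v i.
    have C1 : ctx m1 by apply: ctx_agree A1 _ C'.
    have ev1 : eval m1 (sc aV) = v by rewrite /= A1 // A.
    have ex1 : eval m1 (sc aX) = i by rewrite /= A1.
    rewrite eval_esub eval_eadd d // (eval_ewt C1) ?ev1 ?ex1 //.
    by rewrite /= A1 // A // EP.
  apply: wp_ws => //; first by rewrite ed; apply: leq_ltn_trans M2.
  rewrite ed; set m2 := update _ _ _ _.
  have A2 : agree [:: aC; aD] m' m2 by apply: agree_update.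
  set c := other h v i in ec m1 m2 A1 A2 ed *; set sl := slack h v i in m2 A2 ed slM *.
  have e3 : eval m2 (esub (sc aMN) (emul (sc aC) (esub (sc aMN) (sc aD)))) = if c then minn mn sl else mn.
    by rewrite /= /m2 /m1 /update /= -/mn; case: (c); lia.
  apply: wp_ws => //; first by rewrite e3; case: (c); lia.
  rewrite e3; set m3 := update _ _ _ _.
  have e4 : eval m3 (eadd (sc aMX) (emul (sc aC) (esub (sc aD) (sc aMX)))) = if c then maxn mx sl else mx.
    by rewrite /= /m3 /m2 /m1 /update /= -/mx; case: (c); lia.
  apply: wp_ws => //; first by rewrite e4; case: (c); lia.
  rewrite e4; set m4 := update _ _ _ _.
  have e5 : eval m4 (enz (eadd (sc aLV) (sc aC))) = (c || (lv != 0)).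
    rewrite eval_enz /= /m4 /m3 /m2 /m1 /update /= -/lv.
    by case: (c); rewrite ?addn1 ?addn0.
  apply: wp_ws => //; first by rewrite e5; apply: leq_ltn_trans lt_1_2b; apply: leq_b1.
  rewrite e5; set m5 := update _ _ _ _.
  have e6 : eval m5 (eadd (sc aX) eone) = i.+1.
    by rewrite /= /m5 /m4 /m3 /m2 /m1 /update /= Ex addn1.
  apply: wp_write => //; first by rewrite e6.
  rewrite e6; split=> //; first by do 6 (apply: agree_update => //).
  have -> : update m5 3 (eval m5 (Const 0)) i.+1 aMN 0 = if c then minn mn sl else mn by [].
  have -> : update m5 3 (eval m5 (Const 0)) i.+1 aMX 0 = if c then maxn mx sl else mx by [].
  have -> : update m5 3 (eval m5 (Const 0)) i.+1 aLV 0 = (c || (lv != 0)) by [].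
  case: E => E1 E2 E3 E4 _; split.
  + move=> x; rewrite ltnS leq_eqVlt => /orP[/eqP ->|xi] ox.
      by rewrite -/c in ox; rewrite ox -/sl; lia.
    by have := E1 x xi ox; case: (c) => //; lia.
  + case: (boolP c) => oc.
      case: (leqP mx sl) => H; first by right; exists i; split=> //; rewrite -/sl; lia.
      case: E2 => [E2|[x [xi ox sx]]]; first by rewrite E2 in H.
      by right; exists x; split=> //; rewrite ?sx; lia.
    case: E2 => [E2|[x [xi ox sx]]]; first by left.
    by right; exists x; split=> //; lia.
  + case: (boolP c) => oc /=.
      case: (leqP sl mn) => H; first by exists i; split=> //; rewrite -/sl; lia.
      move: E3; case: eqP => [_ mM|_ [x [xi ox sx]]]; first by rewrite mM in H; lia.
      by exists x; split=> //; rewrite ?sx; lia.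
    move: E3; case: eqP => //= _ [x [xi ox sx]].
    by exists x; split=> //; lia.
  + case: (boolP c) => //= oc; case: eqP => //= /E4 H _ x.
    by rewrite ltnS leq_eqVlt => /orP[/eqP ->//|/H].
  + by split; [case: (c); lia..|exact: leq_b1].
- split=> //; rewrite EMN EMX ELV; split=> //; by left.
- by move=> m' [A _ E].
Qed.

Lemma wp_last m r p (K := m aK 0) : ctx m -> m aRC 0 = r -> m aP 0 = p -> 0 < p -> r < n ->
  m aRES 0 + m aCNT K * 'C(s.+1 - p + r, r.+1) < 2 ^ b ->
  wp last_step m (n * 3 + 4) (fun m' => agree [:: aBIN; aI; aRES] m m' /\
    m' aRES 0 = m aRES 0 + m aCNT K * 'C(s.+1 - p + r, r.+1)).
Proof.
move=> C ER EP p0 rn Hb.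
apply: wp_ws => //; [lia | exact: lt_1_2b |].
apply: wp_ws => //; [lia | exact: lt_0_2b |].
set m0 := update _ _ _ _; set X := s.+1 - p.
(* Each coefficient arises from the previous one by the factor [(X + i) / i.+1], and the division is
   exact by [mul_bin_diag]. For [X = 0] the predecessor is truncated: the start is still 1 and the
   first factor makes it 0. *)
pose J i m' := [/\ agree [:: aBIN; aI] m m', m' aI 0 = i & m' aBIN 0 = 'C((X + i).-1, i)].
have A0 : agree [:: aBIN; aI] m m0 by do 2 (apply: agree_update => //).
apply: (@wp_sq _ _ _ _ (r.+1 * 3).+1 _ (J r.+1)); last 2 first.
- have : r.+1 * 3 <= n * 3 by rewrite leq_mul2r rn. lia.
- move=> m' [A _ EB].
  have e : eval m' (eadd (sc aRES) (emul (Read aCNT (sc aK)) (sc aBIN))) =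
      m aRES 0 + m aCNT K * 'C(X + r, r.+1).
    by rewrite /= EB addnS /= !A.
  apply: (@wp_k _ _ _ 1); last first.
    have : r.+1 * 3 <= n * 3 by rewrite leq_mul2r rn. lia.
  apply: wp_write => //; rewrite e //; split=> //.
  apply: agree_update => //; apply: agree_sub A _ => a; rewrite !inE => /orP[] ->; rewrite ?orbT //.
apply: wp_for => //.
- by move=> i m' ir [A Ei _]; rewrite /= Ei !A // ER addn1.
- move=> i m' ir [A Ei EB].
  have e : eval m' (ediv (emul (sc aBIN) (eadd (esub (eadd eS eone) (sc aP)) (sc aI)))
                    (eadd (sc aI) eone)) = 'C(X + i, i.+1).
    rewrite /= Ei EB !A // EP (ctx_s C) !addn1 -/X mulnC.
    have := mul_bin_diag (X + i) i => ->; by rewrite mulKn.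
  apply: wp_ws => //; first by rewrite e; apply: b_bin; rewrite /X; lia.
  rewrite e; set m1 := update _ _ _ _.
  apply: wp_write => //.
    by rewrite /= /m1 /update /= Ei addn1; apply: leq_ltn_trans lt_n_2b; lia.
  rewrite /= /m1 /update /= Ei addn1; split=> //=.
  + by do 2 (apply: agree_update => //).
  + by rewrite addnS.
- by split=> //; rewrite bin0.
Qed.

Lemma inv_in_todo m D Q todo ex x : Inv m D Q todo ex -> x \in todo -> x.1 <= total sbig.
Proof.
move=> I xt; have [gx _] := inv_todo I xt; have kv := good_key_value s wt_le gx.
apply: leq_trans (leq_pmulr _ kv) _; apply: leq_trans (inv_big I).
by rewrite /todo_value (big_rem x) //= addnCA leq_addr.
Qed.

Lemma inv_res m m' D Q ex : Inv m D Q [::] ex -> agree [:: aBIN; aI; aRES] m m' ->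
  m' aRES 0 = m aRES 0 + ex -> Inv m' D Q [::] 0.
Proof.
move=> I A Er; have Ec k : m' aCNT k = m aCNT k by rewrite A.
case: I => i1 i2 i3 i4 i5 i6 i7 i8 i9 i10; split=> //; rewrite ?(A aRK) //.
- by move=> k; rewrite A // i3.
- by move=> k; rewrite Ec; apply: i4.
- by move=> c cR; rewrite /pend A // (eq_map (g := fun i => m aSTK (c + n * (n * l + 2) * i))) ?i5 // => i; rewrite A.
- by rewrite Er addn0 -i9; under eq_bigr do rewrite Ec.
- by under eq_bigr do rewrite Ec.
Qed.

Section Good.
Variable k : nat.
Hypothesis gk : good k.
Let h := dig k.
Let v := vof k.
Let r := rof k.

Let H : okst v r h. Proof. by case: (good_okst wt_le gk). Qed.

Lemma good_place u r' : r' <= r.+1 -> u < n -> u != v -> h u != 0 -> okst u r' (clip h v u (h u)).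
Proof. by move=> rr un uv hu; apply: (ok_place wt_le H). Qed.

(** One more placed vertex adds [M] to the rank, which is more than the old position. *)
Lemma todo_place_good r' w x : r <= r' <= r.+1 -> x \in todo_place v r' w h 0 ->
  good x.2 /\ rank k < rank x.2.
Proof.
move=> /andP[r1 r2] /mapP[u]; rewrite mem_filter mem_iota subn0 => /andP[/andP[uv hu] un] -> /=.
have Hu := good_place r2 un uv hu; have zE : zer (clip h v u (h u)) = (zer h).+1.
  by rewrite num_placed_clip ?(ok_v H) ?(ok_hv H) // eq_sym.
split.
  exists u, r', (clip h v u (h u)); split=> //; apply: Or33.
  exists v, r, h, (r' != r); split=> //.
  by case: eqP => //=; lia.
rewrite (key_rank_state_key wt_le Hu) zE /key_rank -/h -/v mulSn.
have := ok_ltM wt_le H (ok_v H); rewrite -/M; lia.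
Qed.

(** The first existential keeps the new position below a bound, as [ok_chain] requires; the second
    provides a bound that has been reached, which makes the new state tight. *)
Lemma chain_good (d w : nat) : 0 < d ->
  (exists x, [/\ x < n, x != v, h x != 0 & h v + d + wt v x <= h x]) ->
  (exists x, [/\ x < n, x != v, h x != 0 & h x <= h v + d + wt v x]) ->
  let x := (w, enc v r (clip h n v (h v + d))) in good x.2 /\ rank k < rank x.2.
Proof.
move=> d0 ex1 [y [yn yv hy hyd]] /=; have Hc := ok_chain wt_le H d0 ex1.
have Ev : clip h n v (h v + d) v = h v + d by rewrite /clip_bound eqxx.
have zE : zer (clip h n v (h v + d)) = zer h.
  by apply: num_placed_clip_id; rewrite ?(ok_v H) ?(ok_hv H) //; lia.
split.
  exists v, r, (clip h n v (h v + d)); split=> //; apply: Or32.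
  exists y; split=> //; rewrite Ev /clip /clip_bound (negbTE yv) (negbTE hy) /=.
  by rewrite (_ : (y == n) = false); lia.
rewrite (key_rank_state_key wt_le Hc) zE Ev /key_rank -/h -/v; lia.
Qed.

Lemma key_value_last y : (forall x, x < n -> ~~ other h v x) ->
  kval k y = 'C(y.+1 - h v + r, r.+1).
Proof.
move=> no; rewrite /key_value -/h -/v -/r; apply: stval_last.
have zn := ok_num_placed H; case: (ltnP (zer h).+1 n) => [lt|]; last lia.
have [x [xn xv hx]] := num_placed_lt2P (ok_v H) (ok_hv H) lt.
by have := no x xn; rewrite /other xv hx.
Qed.

Lemma key_value_gap c y : (exists2 x, x < n & other h v x) ->
  (forall x, x < n -> other h v x -> slack h v x = 0) ->
  c * kval k y = todo_sum (todo_place v r.+1 c h 0) y.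
Proof.
move=> [x xn /andP[xv hx]] sl.
rewrite todo_place_sum => [|u un uv hu]; last exact: good_place.
congr (_ * _); rewrite /key_value -/h -/v -/r; apply: stval_gap.
- exact: ok_v H.
- exact: ok_hv H.
- exact: (num_placed_live2 xn (ok_v H) xv hx (ok_hv H)).
move=> z zn zv hz; have := sl z zn; rewrite /other zv hz => /(_ isT); rewrite /slack.
by have := ok_lead H zn zv hz; lia.
Qed.

Lemma key_value_chain c d y : 0 < d -> (exists2 x, x < n & other h v x /\ d <= slack h v x) ->
  (forall x, x < n -> other h v x -> d.-1 <= slack h v x) ->
  c * kval k y = todo_sum (todo_place v r (c * d) h 0 ++ [:: (c, enc v r (clip h n v (h v + d)))]) y.
Proof.
move=> d0 [x xn [/andP[xv hx] sx]] sl.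
have zn := num_placed_live2 xn (ok_v H) xv hx (ok_hv H).
have ex1 : exists x, [/\ x < n, x != v, h x != 0 & h v + d + wt v x <= h x].
  by exists x; split=> //; move: sx; rewrite /slack; lia.
rewrite /todo_value big_cat big_seq1 /= -/(todo_sum _ _) todo_place_sum; last first.
  by move=> u un uv hu; apply: good_place.
rewrite (key_value_state_key wt_le (ok_chain wt_le H d0 ex1)) -mulnA -mulnDr; congr (_ * _).
rewrite /key_value -/h -/v -/r; apply: stval_chain => //.
- exact: ok_v H.
- exact: ok_hv H.
- exact: ok_lead H.
move=> z zz zv hz; have := sl z zz; rewrite /other zv hz => /(_ isT); rewrite /slack.
by have := ok_lead H zz zv hz; lia.
Qed.
End Good.

Lemma wp_inner m k D Q mn mx (h := dig k) (v := vof k) (r := rof k) (cnt := m aCNT k) lv :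
  ctx m -> good k -> extrema h v n mn mx lv -> lv != 0 ->
  m aK 0 = k -> m aV 0 = v -> m aRC 0 = r -> m aP 0 = h v -> m aMN 0 = mn -> m aMX 0 = mx ->
  (forall todo,
    (forall x, x \in todo -> good x.2 /\ rank k < rank x.2) ->
    cnt * kval k s = todo_sum todo s -> todo_sum todo sbig <= cnt * kval k sbig ->
    Inv m D Q todo 0) ->
  wp inner_step m (n * (n * 4 + 20) + 30) (fun m' =>
    agree ([:: aE; aRR; aC; aW] ++ expand_arrays) m m' /\ exists Q', Inv m' D Q' [::] 0).
Proof.
move=> C gk E lv0 EK EV ER EP EMN EMX HI.
have [H _] := good_okst wt_le gk; rewrite -/h -/v -/r in H.
have [x1 [x1n o1 s1]] : exists x, [/\ x < n, other h v x & slack h v x = mn].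
  by have := ext_mn E; rewrite (negbTE lv0).
have mnx : mn <= mx by have := ext_mn_mx E x1n o1; lia.
set d := maxn mn 1.
set todo := if mx == 0 then todo_place v r.+1 (cnt * d) h 0
  else todo_place v r (cnt * d) h 0 ++ [:: (cnt, enc v r (clip h n v (h v + d)))].
set rr := r + (mx == 0); set rest := if mx == 0 then [::] else [:: (cnt, enc v r (clip h n v (h v + d)))].
have d0 : 0 < d by rewrite /d; lia.
have todoE : todo = todo_place v rr (cnt * d) h 0 ++ rest.
  by rewrite /todo /rr /rest; case: eqP; rewrite ?addn1 ?addn0 ?cats0.
have ex1 : mx != 0 -> exists2 x, x < n & other h v x /\ d <= slack h v x.
  move=> mx0; case: (ext_mx E) => [E0|[x [xn ox sx]]]; first by rewrite E0 in mx0.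
  by exists x => //; split=> //; rewrite sx /d; lia.
have ex1' : mx != 0 -> exists x, [/\ x < n, x != v, h x != 0 & h v + d + wt v x <= h x].
  by move=> /ex1[x xn [/andP[xv hx] sx]]; exists x; split=> //; move: sx; rewrite /slack; lia.
have kvE y : cnt * kval k y = todo_sum todo y.
  rewrite /todo; case: eqP => [mx0|/eqP mx0].
    rewrite (_ : d = 1) ?muln1; last by rewrite /d; lia.
    apply: key_value_gap => //; first by exists x1.
    by move=> x xn ox; have := ext_mn_mx E xn ox; rewrite -/h -/v; lia.
  apply: key_value_chain => //; first exact: ex1.
  by move=> x xn ox; have := ext_mn_mx E xn ox; rewrite /d -/h -/v; lia.
have I : Inv m D Q todo 0.
  apply: HI; rewrite ?kvE // => x; rewrite todoE mem_cat => /orP[|].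
    by apply: todo_place_good => //; rewrite /rr; case: eqP; lia.
  rewrite /rest; case: eqP => // /eqP mx0; rewrite inE => /eqP ->.
  apply: chain_good => //; first exact: ex1'.
  exists x1; split=> //; try by case/andP: o1.
  move: s1; rewrite /slack /d -/h -/v; case/andP: o1 => xv hx.
  by have := ok_lead H x1n xv hx; lia.
have vn := ok_v H.
(* This product is stored before anything is pushed. It is bounded because some successor, here that
   of the minimiser [x1], carries it as its weight. *)
have wb : cnt * d < 2 ^ b.
  apply: leq_ltn_trans b_big.
  apply: (inv_in_todo (x := (cnt * d, enc x1 rr (clip h v x1 (h x1)))) I).
  rewrite todoE mem_cat; apply/orP; left; apply/mapP; exists x1 => //.
  by rewrite mem_filter -/(other h v x1) o1 mem_iota subn0.
rewrite todoE in I.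
apply: wp_ws => //; [lia | by rewrite /= EV; apply: ltn_trans lt_n_2b |].
rewrite [eval m (sc aV)]/= EV; set m1 := update _ _ _ _.
have e1 : eval m1 (eadd (sc aRC) (ez (sc aMX))) = rr.
  by rewrite eval_eadd eval_ez /= /m1 /update /= ER EMX.
have rn : rr < 2 ^ b.
  apply: leq_ltn_trans lt_n_2b; rewrite /rr; have := ok_r H; have := ok_num_placed H; case: eqP => _; lia.
apply: wp_ws => //; [lia | by rewrite e1 |].
rewrite e1; set m2 := update _ _ _ _.
have e2' : eval m2 (Read aCNT (sc aK)) = cnt by rewrite /= /m2 /m1 /update /= EK.
have cb : cnt < 2 ^ b by apply: leq_ltn_trans wb; rewrite leq_pmulr.
apply: wp_ws => //; [lia | by rewrite e2' |].
rewrite e2'; set m2' := update _ _ _ _.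
have e2 : eval m2' (emul (sc aC) (emax (sc aMN) eone)) = cnt * d.
  by rewrite eval_emul eval_emax /= /m2' /m2 /m1 /update /= EMN.
apply: wp_ws => //; [lia | by rewrite e2 |].
rewrite e2; set m3 := update _ _ _ _.
have A3 : agree [:: aE; aRR; aC; aW] m m3 by do 4 (apply: agree_update => //).
have EC3 : m3 aC 0 = cnt by [].
have C3 : ctx m3 by apply: ctx_agree A3 _ C.
have I3 := inv_agree A3 isT I.
have hE : h = dig (m3 aK 0) by rewrite A3 // EK.
apply: wp_sq.
- apply: (@wp_expand m3 D Q v rr (cnt * d) rest 0) => //; rewrite -?hE //.
  by move=> u un uv hu; apply: good_place => //; rewrite /rr -/r; case: eqP; lia.
- nia.
move=> m4 [A4 [Q4 I4]].
have A34 : agree ([:: aE; aRR; aC; aW] ++ expand_arrays) m m4.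
  apply: agree_trans (agree_sub A3 _) (agree_sub A4 _); move=> a; rewrite mem_cat => ->; rewrite ?orbT //.
have C4 : ctx m4 by apply: ctx_agree A34 _ C.
have e4 : eval m4 (sc aMX) = mx by rewrite /= A34.
apply: (@wp_k _ _ _ (n * 4 + 16).+1); last nia.
apply: wp_if => //; rewrite e4 => mx0; last first.
  apply: (@wp_k _ _ _ 1); last lia.
  apply: wp_skip; split=> //; exists Q4; move: I4; by rewrite /rest mx0.
rewrite /rest (negbTE mx0) in I4.
have okc := ok_chain wt_le H d0 (ex1' mx0).
have cvE : clip h n v (h v + d) v = h v + d by rewrite /clip_bound eqxx.
have pb : h v + d < 2 ^ b.
  by rewrite -cvE; apply: ltn_trans lt_M_2b; apply: (ok_ltM wt_le okc).
have ev : eval m4 (sc aV) = v by rewrite /= A34.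
apply: wp_ws => //; [lia | by rewrite ev; apply: ltn_trans lt_n_2b |].
rewrite ev; set m5 := update _ _ _ _.
have e5 : eval m5 (eadd (sc aP) (emax (sc aMN) eone)) = h v + d.
  by rewrite eval_eadd eval_emax /= /m5 /update /= !A34 // EP EMN.
apply: wp_ws => //; [lia | by rewrite e5 |].
rewrite e5; set m6 := update _ _ _ _.
have e6 : eval m6 eN = n by rewrite /= /m6 /m5 /update /= (ctx_n C4).
apply: wp_ws => //; [lia | by rewrite e6 lt_n_2b |].
rewrite e6; set m7 := update _ _ _ _.
have e7 : eval m7 (sc aC) = cnt by rewrite /= /m7 /m6 /m5 /update /= A4.
apply: wp_ws => //; [lia | by rewrite e7 |].
rewrite e7; set m8 := update _ _ _ _.
have A8 : agree [:: aU; aQ; aE; aW] m4 m8 by do 4 (apply: agree_update => //).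
have C8 : ctx m8 by apply: ctx_agree A8 _ C4.
have I8 := inv_agree A8 isT I4.
have G1 : m8 aU 0 = v by [].
have G2 : m8 aQ 0 = h v + d by [].
have G3 : m8 aE 0 = n by [].
have rrE : rr = r by rewrite /rr (negbTE mx0) addn0.
have G4 : m8 aRR 0 = r by rewrite A8 // A4 // -rrE.
have G5 : m8 aW 0 = cnt by [].
have G6 x : x < n -> dig (m8 aK 0) x = h x by rewrite A8 // A34 // EK.
apply: wp_weaken (wp_push_inv C8 G1 G2 G3 G4 G5 G6 okc I8) _ _; first lia.
move=> m9 [A9 I9]; split=> //; apply: agree_trans A34 _; apply: agree_trans (agree_sub A8 _) (agree_sub A9 _).
  by apply/allP.
by apply/allP.
Qed.

Definition process_arrays := [:: aK; aV; aRC; aP; aMN; aMX; aLV; aX; aC; aD; aE; aRR; aW;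
  aU; aQ; aKEY; aLEV; aBIN; aI; aRES; aSEEN; aCNT; aLEN; aSTK].

Lemma wp_process m D Q (c := m aRK 0) : ctx m -> Inv m D Q [::] 0 -> c < R -> m aLEN c != 0 ->
  wp process m (n * (n * 4 + 30) + 50) (fun m' => agree process_arrays m m' /\
    exists k Q', Inv m' (k :: D) Q' [::] 0).
Proof.
move=> C I cR Lc; rewrite /process.
have el : eval m (esub (Read aLEN (sc aRK)) eone) = (m aLEN c).-1 by rewrite /= -/c subn1.
apply: wp_ws => //; first lia.
  rewrite el; apply: leq_ltn_trans (leq_pred _) _; apply: leq_ltn_trans (inv_len wt_le I cR) _.
  by apply: ltn_trans b_key.
rewrite el [eval m _]/= -/c; set m1 := update _ _ _ _.
set k := m aSTK (c + R * (m aLEN c).-1).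
have M1 a i : a \in [:: aSEEN; aCNT; aSTK; aRK; aRES] -> m1 a i = m a i.
  by rewrite !inE => /or4P[/eqP->|/eqP->|/eqP->|/orP[]/eqP->].
have L1 i : m1 aLEN i = if i == c then (m aLEN c).-1 else m aLEN i by [].
have [gk rk kD pop] := inv_pop I cR Lc M1 L1.
have [H _] := good_okst wt_le gk; set h := dig k in H; set v := vof k in H; set r := rof k in H.
rewrite -/R -/k -/c in gk rk kD pop.
have kb := lt_key_2b gk.
have e1 : eval m1 (Read aSTK (eadd (sc aRK) (emul (sc aR) (Read aLEN (sc aRK))))) = k.
  by rewrite /= /m1 /update /= -/c eqxx (ctx_R C).
apply: wp_ws => //; [lia | by rewrite e1 | rewrite e1; set m2 := update _ _ _ _].
have e2 : eval m2 (emod (ediv (sc aK) (Read aPW eN)) eN) = v.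
  by rewrite /= /m2 /m1 /update /= (ctx_n C) (ctx_pw C).
have vn := ok_v H.
apply: wp_ws => //; [lia | by rewrite e2; apply: ltn_trans lt_n_2b | rewrite e2; set m3 := update _ _ _ _].
have e3 : eval m3 (ediv (ediv (sc aK) (Read aPW eN)) eN) = r.
  by rewrite /= /m3 /m2 /m1 /update /= (ctx_n C) (ctx_pw C).
have rn : r < n by have := ok_r H; have := ok_num_placed H; lia.
apply: wp_ws => //; [lia | by rewrite e3; apply: ltn_trans lt_n_2b | rewrite e3; set m4 := update _ _ _ _].
have e4 : eval m4 (edig (sc aK) (sc aV)) = h v.
  by rewrite /= /m4 /m3 /m2 /m1 /update /= (ctx_M C) (ctx_pw C) // ltnW.
have hvM : h v < M by apply: (ok_ltM wt_le H).
apply: wp_ws => //; [lia | by rewrite e4; apply: ltn_trans lt_M_2b | rewrite e4; set m5 := update _ _ _ _].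
have e5 : eval m5 (sc aM) = M by rewrite /= /m5 /m4 /m3 /m2 /m1 /update /= (ctx_M C).
apply: wp_ws => //; [lia | by rewrite e5; apply: lt_M_2b | rewrite e5].
do 3 (apply: wp_ws => //; [lia | exact: lt_0_2b | ]).
set m6 := update _ _ _ _.
have A6 : agree process_arrays m m6 by do 9 (apply: agree_update => //).
have C6 : ctx m6 by apply: ctx_agree A6 _ C.
have A16 : agree [:: aK; aV; aRC; aP; aMN; aMX; aLV; aX] m1 m6 by do 8 (apply: agree_update => //).
apply: wp_sq.
- apply: (@wp_slack m6 h v) => //.
- nia.
move=> m7 [A7 E7].
have C7 : ctx m7 by apply: ctx_agree A7 _ C6.
have A17 : agree [:: aK; aV; aRC; aP; aMN; aMX; aLV; aX; aC; aD] m1 m7.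
  by apply: agree_trans (agree_sub A16 _) (agree_sub A7 _); apply/allP.
have A07 : agree process_arrays m m7 by apply: agree_trans A6 (agree_sub A7 _); apply/allP.
have F1 : m7 aK 0 = k by rewrite A7.
have F2 : m7 aV 0 = v by rewrite A7.
have F3 : m7 aRC 0 = r by rewrite A7.
have F4 : m7 aP 0 = h v by rewrite A7.
have F5 i : m7 aCNT i = m aCNT i by rewrite A17.
have HI todo ex : (forall x, x \in todo -> good x.2 /\ rank k < rank x.2) ->
    m7 aCNT k * kval k s = ex + todo_sum todo s -> todo_sum todo sbig <= m7 aCNT k * kval k sbig ->
    Inv m7 (k :: D) (rem k Q) todo ex.
  rewrite F5 rk => t1 t2 t3; apply: inv_agree A17 isT (pop todo ex t1 t2 t3).
apply: (@wp_k _ _ _ (n * (n * 4 + 20) + 30).+1); last nia.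
apply: wp_if => // lv.
  apply: wp_weaken (@wp_inner m7 k (k :: D) (rem k Q) (m7 aMN 0) (m7 aMX 0) (m7 aLV 0)
     C7 gk E7 lv F1 F2 F3 F4 _ _ _) _ _ => //.
    by move=> todo t1 t2 t3; apply: HI.
  move=> m' [A' [Q' I']]; split; last by exists k, Q'.
  by apply: agree_trans A07 (agree_sub A' _); apply/allP.
have no := ext_lv E7 lv.
have kl y : kval k y = 'C(y.+1 - h v + r, r.+1) by apply: key_value_last.
have Ir : Inv m7 (k :: D) (rem k Q) [::] (m7 aCNT k * 'C(s.+1 - h v + r, r.+1)).
  apply: HI => //; rewrite /todo_value big_nil ?addn0 // kl //.
have hv0 := ok_hv H.
apply: wp_weaken (@wp_last m7 r (h v) C7 F3 F4 _ rn _) _ _.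
- by rewrite lt0n.
- rewrite F1; apply: leq_ltn_trans b_tot; rewrite -(inv_sum Ir) -addnA leq_addr //.
- nia.
rewrite F1 => m' [A' Er]; split.
  by apply: agree_trans A07 (agree_sub A' _); apply/allP.
by exists k, (rem k Q); apply: inv_res Ir A' Er.
Qed.

Lemma inv_done m D Q todo ex : Inv m D Q todo ex -> size D <= size (all_keys n l wt).
Proof.
move=> I; apply: uniq_leq_size.
  by have := inv_uniq I; rewrite cat_uniq => /and3P[].
by move=> k kD; apply: (good_all_keys wt_le n_gt1); apply: (inv_good I); rewrite mem_cat kD.
Qed.

Lemma wp_main_loop m : ctx m -> m aRK 0 = 0 -> (exists Q, Inv m [::] Q [::] 0) ->
  wp main_loop m ((R + size (all_keys n l wt)) * (n * (n * 4 + 30) + 52)).+1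
    (fun m' => m' aRES 0 = total s /\ ctx m').
Proof.
move=> C ERK [Q0 I0]; set B := size _.
(* Each round either raises the rank or moves a key to [D], whose size is at most [B]; so the sum of
   both reserves decreases. *)
pose J j m' := [/\ ctx m', m' aRK 0 <= R &
  exists D Q, Inv m' D Q [::] 0 /\ j = (R - m' aRK 0) + (B - size D)].
apply: wp_weaken (@wp_while b 300 b0 _ _ (n * (n * 4 + 30) + 51) J _ _ (R + B) m _) _ _.
- by [].
- move=> j m' [C' rR [D [Q [I jE]]]]; rewrite /= (ctx_R C') => lt.
  have {}lt : m' aRK 0 < R by move: lt; rewrite -/R -/M; lia.
  apply: (@wp_k _ _ _ (n * (n * 4 + 30) + 50).+1); last lia.
  apply: wp_if => // Lc.
    apply: wp_weaken (wp_process C' I lt Lc) (leqnn _) _.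
    move=> m2 [A2 [k [Q2 I2]]]; have ERK2 : m2 aRK 0 = m' aRK 0 by rewrite A2.
    exists ((R - m2 aRK 0) + (B - (size D).+1)).
      by have := inv_done I2; rewrite jE ERK2 /= -/B; lia.
    split; [exact: ctx_agree A2 _ C' | by rewrite ERK2 | by exists (k :: D), Q2].
  rewrite /= in Lc.
  apply: (@wp_k _ _ _ 1); last lia.
  have e : eval m' (eadd (sc aRK) eone) = (m' aRK 0).+1 by rewrite /= addn1.
  apply: wp_write => //.
    by rewrite e; apply: leq_ltn_trans b_rank; apply: leq_trans lt (leq_addr _ _).
  rewrite e; set m2 := update _ _ _ _.
  have A2 : agree [:: aRK] m' m2 by apply: agree_update.
  have ERK2 : m2 aRK 0 = (m' aRK 0).+1 by [].
  exists ((R - m2 aRK 0) + (B - size D)); first by rewrite jE ERK2; lia.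
  split; [exact: ctx_agree A2 _ C' | by rewrite ERK2 | exists D, Q; split=> //].
  case: I => i1 i2 i3 i4 i5 i6 i7 i8 i9 i10; split => //; rewrite ?ERK2.
  + by move=> k kD; apply: leqW; apply: i6.
  (* A pending key of the current rank would lie in the corresponding stack, which is empty. *)
  + move=> k kQ; have := i7 k kQ; rewrite leq_eqVlt => /orP[/eqP E|//].
    have := i5 _ lt; rewrite /pend Lc /= => /perm_size /= /esym /size0nil N.
    have : k \in [seq k <- Q | rank k == m' aRK 0] by rewrite mem_filter kQ E eqxx.
    by rewrite N.
- split=> //; first by rewrite ERK.
  by exists [::], Q0; rewrite ERK subn0 /= subn0.
- by rewrite ltnS leq_mul2l; apply/orP; right; lia.
move=> m' [ev [j [C' rR [D [Q [I _]]]]]]; split=> //.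
move: ev; rewrite /= (ctx_R C') -/M -/R => ev.
have Q0' : Q = [::].
  case: Q I => // k Q I; have := inv_Q I (mem_head _ _).
  have := good_rank_lt wt_le (inv_good I (k := k) _); rewrite mem_cat mem_head orbT => /(_ isT).
  rewrite -/M -/R; lia.
by have := inv_sum I; rewrite Q0' big_nil /todo_value big_nil !addn0.
Qed.
End Steps.

(** * The whole program and its initialisation *)

Definition power_prog : com :=
  set aRES eone;; set aX (Const 0);;
  While (esub eN (sc aX))
    (set aRES (emul (sc aRES) eS);; set aX (eadd (sc aX) eone));;
  set 0 (sc aRES).

(** [aK] receives the number with all digits 1, which stands for the situation before the first
    vertex is chosen; [aE] is [n], that is, no vertex. Expanding it yields the initial states. *)
Definition count_prog : com :=
  set aM (eadd (emul eN eL) (Const 2));;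
  set aR (emul eN (sc aM));;
  set aPW eone;; set aK (Const 0);; set aX (Const 0);;
  While (esub eN (sc aX))
    (set aK (eadd (sc aK) (Read aPW (sc aX)));;
     Write aPW (eadd (sc aX) eone) (emul (Read aPW (sc aX)) (sc aM));;
     set aX (eadd (sc aX) eone));;
  set aE eN;; set aRR (Const 0);; set aW eone;;
  expand;; main_loop;; set 0 (sc aRES).

(* If l (n - 1) = 0 all assignments are proper. The general method is then too slow:
   for n = 1 it goes through about l ranks, and for l = 0 the tie-breaking bounds take
   two values instead of one. *)
Definition prog : com := If (emul eL (esub eN eone)) count_prog power_prog.

Section Init.
Variables (n l s b : nat) (inp : seq nat).
Notation wp := (wp b 300).
Hypothesis inp0 : nth 0 inp 0 = n.
Hypothesis inp1 : nth 0 inp 1 = l.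
Hypothesis inp2 : nth 0 inp 2 = s.
Definition weight (u x : nat) := maxn (nth 0 inp (3 + (u * n + x))) (x < u).
Hypothesis b0 : 0 < b.

Lemma weight_tie u x : u < x -> 0 < weight x u.
Proof. by rewrite /weight => ->; rewrite leq_max orbT. Qed.

Lemma wp_power : n < 2 ^ b -> (forall i, i <= n -> s ^ i < 2 ^ b) ->
  wp power_prog (init_memory inp) (n * 3 + 4) (fun m => m 0 0 = s ^ n).
Proof.
move=> nb sb; set m := init_memory inp.
have E0 : m 0 0 = n by exact: inp0.
have E1 : m 0 1 = l by exact: inp1.
have E2 : m 0 2 = s by exact: inp2.
have p1 : 1 < 2 ^ b by rewrite -{1}(expn0 2) ltn_exp2l.
apply: wp_ws => //; first lia.
apply: wp_ws => //; [lia | exact: ltnW |].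
set m0 := update _ _ _ _.
pose J i m' := [/\ agree [:: aRES; aX] m m', m' aX 0 = i & m' aRES 0 = s ^ i].
apply: (@wp_sq _ _ _ _ (n * 3).+1 _ (J n)).
- apply: wp_for => //.
  + by move=> i m' ile [A Ei _]; rewrite /= Ei A // E0.
  + move=> i m' ilt [A Ei Er].
    have e : eval m' (emul (sc aRES) eS) = s ^ i.+1 by rewrite /= Er A // E2 expnSr.
    apply: wp_ws => //; first by rewrite e; apply: sb.
    rewrite e; apply: wp_write => //; rewrite /= /update /= Ei addn1.
      by apply: leq_ltn_trans nb.
    by split=> //; do 2 (apply: agree_update => //).
  + by split=> //; do 2 (apply: agree_update => //).
- lia.
move=> m' [A Ei Er]; apply: (@wp_k _ _ _ 1); last lia.
by apply: wp_write => //; rewrite /= Er //; apply: sb.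
Qed.

Hypothesis n_gt1 : 1 < n.
Hypothesis l_gt0 : 0 < l.
Notation wt := weight.
Hypothesis wt_le : forall u x, u < n -> x < n -> wt u x <= l.
Let M := n * l + 2.
Let R := n * M.
Notation total := (total_count n wt).
Notation sbig := (big_span n l s).
Notation clip := (clip_bound wt).
Notation dig := (key_digit M).
Hypothesis b_key : (M ^ n * (n * n.+1)).+1 < 2 ^ b.
Hypothesis b_rank : R + n < 2 ^ b.
Hypothesis b_big : total sbig < 2 ^ b.
Hypothesis b_tot : total s < 2 ^ b.
Hypothesis b_bin : forall a i, a <= s + n + 1 -> i <= n -> 'C(a, i) < 2 ^ b.

Lemma total_init y :
  total y = \sum_(u < n) stval n wt u 0 (clip (fun=> 1) n u 1) y.
Proof.
have n0 : 0 < n by exact: ltnW.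
rewrite /total_count -{2}(prednK n0) /=; apply: eq_bigr => u _.
have un := ltn_ord u.
rewrite /stval /= /stval0 num_placed_clip_id ?num_placed_one // subn0 {1}/clip_bound eqxx.
rewrite big_nat_cond [RHS]big_nat_cond; apply: eq_bigr => q /andP[/andP[q1 _] _].
apply: completions_ext => x xn; rewrite /place_bound /clip_bound /= (_ : (x == n) = false); last lia.
case: (eqVneq x u) => //= xu.
by case: eqP; lia.
Qed.

Lemma inv_init m h : (forall a i, a \in [:: aSEEN; aCNT; aLEN] -> m a i = 0) ->
  m aRK 0 = 0 -> m aRES 0 = 0 -> eqn_lt n h (fun=> 1) ->
  Inv n l s wt m [::] [::] (todo_place n l wt n 0 1 h 0) 0.
Proof.
move=> m0 mrk mres hE.
have cE u : u < n -> eqn_lt n (clip h n u (h u)) (clip (fun=> 1) n u 1).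
  by move=> un x xn; rewrite /clip_bound !hE.
have okc u : u < n -> okst n l wt u 0 (clip h n u (h u)).
  by move=> un; apply: (okst_ext _ (ok_init wt_le un)) => x xn; rewrite cE.
have sumE y : todo_value n l wt (todo_place n l wt n 0 1 h 0) y = total y.
  rewrite (todo_place_sum wt_le) => [|u un _ _]; last exact: okc.
  rewrite mul1n total_init; apply: eq_big => u.
    by rewrite hE // andbT; apply/eqP; have := ltn_ord u; lia.
  by move=> _; apply: stval_ext => //; apply: cE.
split=> //.
- by move=> k; rewrite m0.
- by move=> k _; rewrite m0.
- by move=> c cR; rewrite /pend m0.
- rewrite mrk => x /mapP[u]; rewrite mem_filter mem_iota subn0 => /andP[_ un] -> /=.
  split.
    exists u, 0, (clip h n u (h u)); split=> //.
      exact: okc.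
    by apply: Or31; rewrite (num_placed_ext (cE u un)) num_placed_clip_id ?num_placed_one.
  by rewrite (key_rank_state_key wt_le (okc u un)) [X in _ + X]/clip_bound eqxx hE // addn1.
- by rewrite mres big_nil sumE.
- by rewrite big_nil sumE.
Qed.

Lemma wp_count : wp count_prog (init_memory inp)
  ((R + size (all_keys n l wt)) * (n * (n * 4 + 30) + 52) + n * (n * 4 + 20) + 20)
  (fun m => m 0 0 = total s).
Proof.
set m := init_memory inp.
have E0 : m 0 0 = n by exact: inp0.
have E1 : m 0 1 = l by exact: inp1.
have E2 : m 0 2 = s by exact: inp2.
have lt_n : n < 2 ^ b by apply: leq_ltn_trans b_rank; apply: leq_addl.
have lt_M : M < 2 ^ b by apply: leq_ltn_trans b_rank; rewrite /R; nia.
have p0 : 0 < 2 ^ b by rewrite expn_gt0.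
have p1 : 1 < 2 ^ b by rewrite -{1}(expn0 2) ltn_exp2l.
have M2 : 1 < M by rewrite /M; lia.
have RB : R < 2 ^ b by apply: leq_ltn_trans b_rank; apply: leq_addr.
have e1 : eval m (eadd (emul eN eL) (Const 2)) = M by rewrite /= E0 E1.
apply: wp_ws => //; [lia | by rewrite e1 | rewrite e1; set m1 := update _ _ _ _].
have e2 : eval m1 (emul eN (sc aM)) = R by rewrite /= /m1 /update /= E0.
apply: wp_ws => //; [lia | by rewrite e2 | rewrite e2].
do 3 (apply: wp_ws => //; [lia |]).
set m2 := update _ _ _ _.
set T := [:: aM; aR; aPW; aK; aX].
have A2 : agree T m m2 by do 5 (apply: agree_update => //).
pose J i m' := [/\ agree T m m', [/\ m' aM 0 = M, m' aR 0 = R & m' aX 0 = i],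
  (forall j, j <= i -> m' aPW j = M ^ j) & m' aK 0 = \sum_(x < i) 1 * M ^ x].
have Mn : M ^ n < 2 ^ b.
  apply: leq_ltn_trans b_key; rewrite ltnW // ltnS leq_pmulr // muln_gt0 andbT; lia.
apply: (@wp_sq _ _ _ _ (n * 4).+1 _ (J n)).
- apply: wp_for => //.
  + by move=> i m' ile [A [_ _ Ei] _ _]; rewrite /= Ei A // E0.
  + move=> i m' ilt [A [EM ER Ei] EP EK].
    have e3 : eval m' (eadd (sc aK) (Read aPW (sc aX))) = \sum_(x < i.+1) 1 * M ^ x.
      by rewrite /= EK Ei EP // big_ord_recr /= mul1n.
    have b3 : \sum_(x < i.+1) 1 * M ^ x < 2 ^ b.
      apply: (@leq_trans (M ^ i.+1)); first by apply: (@sum_dig_lt M (ltnW M2) (fun=> 1) i.+1).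
      by apply: leq_trans (ltnW Mn); rewrite leq_pexp2l // ltnW.
    apply: wp_ws => //; [by rewrite e3 | rewrite e3; set m3 := update _ _ _ _].
    have e4 : eval m3 (emul (Read aPW (sc aX)) (sc aM)) = M ^ i.+1.
      by rewrite /= /m3 /update /= Ei EP // EM expnSr.
    have e5 : eval m3 (eadd (sc aX) eone) = i.+1 by rewrite /= /m3 /update /= Ei addn1.
    apply: wp_ws => //; first by rewrite e4; apply: leq_ltn_trans Mn; rewrite leq_pexp2l // ltnW.
    rewrite e4 e5; set m4 := update _ _ _ _.
    have e6 : eval m4 (eadd (sc aX) eone) = i.+1 by rewrite /= /m4 /m3 /update /= Ei addn1.
    apply: wp_write => //; first by rewrite e6; apply: leq_ltn_trans lt_n.
    rewrite e6; split=> //.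
    * by do 3 (apply: agree_update => //).
    * by move=> j ji; rewrite /m4 /m3 /update /=; case: eqP => [->//|ne]; apply: EP; lia.
  + split=> //; last by rewrite big_ord0.
    by move=> j; rewrite leqn0 => /eqP ->.
- lia.
move=> m5 [A5 [EM ER EX] EP EK].
have e6 : eval m5 eN = n by rewrite /= A5 // E0.
apply: wp_ws => //; [lia | by rewrite e6 | rewrite e6].
do 2 (apply: wp_ws => //; [lia |]).
set m6 := update _ _ _ _.
have A6 : agree [:: aE; aRR; aW] m5 m6 by do 3 (apply: agree_update => //).
have A06 : agree ([:: aE; aRR; aW] ++ T) m m6.
  apply: agree_trans (agree_sub A5 _) (agree_sub A6 _); by apply/allP.
have C6 : ctx n l s wt m6.
  split; try (by rewrite A6); try (by rewrite A06).
  - by move=> u x un xn; rewrite A06.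
  - by move=> x xn; rewrite A6 // EP.
have hE : eqn_lt n (dig (m6 aK 0)) (fun=> 1).
  move=> x xn; rewrite A6 // EK -[bigop _ _ _]addn0 -[X in _ + X](muln0 (M ^ n)).
  have := @key_digit_state_key n M _ 0 0 (fun=> 1) x _ xn; rewrite /state_key muln0 addn0; apply=> //; exact: ltnW.
have I6 : Inv n l s wt m6 [::] [::] (todo_place n l wt n 0 1 (dig (m6 aK 0)) 0 ++ [::]) 0.
  rewrite cats0; apply: inv_init => //; try by rewrite A06.
  by move=> a i; rewrite !inE => /or3P[] /eqP ->; rewrite A06.
apply: wp_sq.
- apply: (wp_expand n_gt1 wt_le b0 b_key b_rank b_big b_tot C6 _ _ _ _ I6) => //.
  move=> u un _ _; rewrite -/M; apply: (okst_ext _ (ok_init wt_le un)) => x xn.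
  by rewrite /clip_bound !hE.
- lia.
move=> m7 [A7 I7].
have C7 : ctx n l s wt m7 by apply: ctx_agree A7 _ C6.
apply: wp_sq.
- apply: (wp_main_loop n_gt1 wt_le b0 b_key b_rank b_big b_tot b_bin C7 _ I7).
  by rewrite A7 // A06.
- rewrite -/M -/R; lia.
move=> m8 [E8 C8]; apply: (@wp_k _ _ _ 1); last by rewrite -/M -/R; lia.
by apply: wp_write => //; rewrite /= E8.
Qed.
End Init.

(** * Word length and running time *)

Lemma total_count_le n wt y : (forall u x, u < x -> 0 < wt x u) ->
  total_count n wt y <= y.+1 ^ n.
Proof.
move=> tie; rewrite /total_count -(card_fits tie); last by rewrite num_placed_one subn0.
by apply: leq_trans (max_card _) _; rewrite card_ffun !card_ord.
Qed.

Lemma bin_le_exp a i : 'C(a, i) <= a.+1 ^ i.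
Proof.
elim: a i => [|a IH] i; first by case: i => // i; rewrite bin0n.
case: i => [|i]; first by rewrite bin0 expn0.
rewrite binS expnS mulSn; apply: leq_trans (leq_add (IH _) (IH _)) _.
have le j : a.+1 ^ j <= a.+2 ^ j by case: j => // j; rewrite leq_exp2r.
by rewrite addnC leq_add // expnS leq_mul.
Qed.

Section Run.
Variables (n l s : nat) (inp : seq nat).
Hypothesis inp0 : nth 0 inp 0 = n.
Hypothesis inp1 : nth 0 inp 1 = l.
Hypothesis inp2 : nth 0 inp 2 = s.
Hypothesis inp_n : n < size inp.
Hypothesis inp_3 : 2 < size inp.
Notation sz := (input_size inp).

Lemma size_le_input_size : size inp <= sz.
Proof. by rewrite /input_size -sum1_size; apply: leq_sum => a _. Qed.

Lemma nth_lt_input_size i : nth 0 inp i < 2 ^ sz.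
Proof.
case: (ltnP i (size inp)) => [lt|ge]; last by rewrite nth_default // expn_gt0.
apply: leq_trans (ltn_bitlen _) _; rewrite leq_exp2l //.
by rewrite /input_size (big_rem (nth 0 inp i)) ?mem_nth //= leq_addr.
Qed.

(** [Z] is 8 times the square of a number exceeding [n], [l] and [s], which covers all quadratic
    quantities. Counts and binomial coefficients are below [n]-th powers of such quantities, and
    keys need one further factor for [n * n.+1]. *)
Definition word_bits := (2 * sz + 3) * (n + 2).
Let Z := 2 ^ (2 * sz + 3).

Lemma word_bitsE : 2 ^ word_bits = Z ^ (n + 2).
Proof. by rewrite /word_bits expnM. Qed.

Lemma small_values : [/\ 1 < Z, n * l + 3 <= Z, n * n.+1 + 1 < Z, n < Z &
  (s + (n * l + 2) + n * l).+1 <= Z /\ s + n + 2 <= Z].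
Proof.
have nP := nth_lt_input_size 0; have lP := nth_lt_input_size 1; have sP := nth_lt_input_size 2.
rewrite inp0 in nP; rewrite inp1 in lP; rewrite inp2 in sP.
have -> : Z = 8 * (2 ^ sz * 2 ^ sz).
  by rewrite /Z expnD mulnC mul2n -addnn expnD.
by move: (2 ^ sz) nP lP sP => P nP lP sP; split; nia.
Qed.

Lemma word_bits_gt0 : 0 < word_bits.
Proof. by rewrite muln_gt0 !addn_gt0 !orbT. Qed.

Lemma exp_lt_word a : a <= Z -> a ^ n < 2 ^ word_bits.
Proof.
have [Z1 _ _ _ _] := small_values; move=> aZ.
apply: (@leq_ltn_trans (Z ^ n)); first by case: n => // k; rewrite leq_exp2r.
by rewrite word_bitsE ltn_exp2l //; lia.
Qed.

(** At most [900 * sz ^ 6 * E] steps at [unit_cost]; the 6 stems from [2 * sz + 3 <= 3 * sz] and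
    [n + 2 <= 2 * sz]. *)
Definition time_bound (E : nat) := 900 * (2 * 300 ^ 2 * 6 + 1) * sz ^ 8 * E.

Lemma unit_cost_le : unit_cost word_bits 300 <= (2 * 300 ^ 2 * 6 + 1) * sz ^ 2.
Proof.
have H := size_le_input_size.
have b6 : word_bits <= 6 * sz ^ 2.
  rewrite /word_bits -mulnn; have : 2 * sz + 3 <= 3 * sz by lia.
  have : n + 2 <= 2 * sz by lia.
  move: (sz) => z; nia.
have s1 : 1 <= sz ^ 2 by rewrite expn_gt0; lia.
rewrite /unit_cost mulnDl mul1n -addn1 leq_add //.
by rewrite -[leqRHS]mulnA leq_mul2l b6 orbT.
Qed.

Lemma steps_le E k t : 0 < E -> k <= 900 * sz ^ 6 * E -> t <= k * unit_cost word_bits 300 ->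
  t <= time_bound E.
Proof.
move=> E0 kE tk; apply: leq_trans tk _.
apply: leq_trans (leq_mul kE unit_cost_le) _.
rewrite /time_bound (_ : sz ^ 8 = sz ^ 6 * sz ^ 2); last by rewrite -expnD.
by move: (sz ^ 6) (sz ^ 2) (2 * 300 ^ 2 * 6 + 1) => x y z; apply/eq_leq; lia.
Qed.

Lemma bounded_init : bounded word_bits (init_memory inp).
Proof.
have [Z1 _ _ _ _] := small_values.
move=> a i; rewrite /init_memory; case: ifP => _; last by rewrite expn_gt0.
apply: leq_trans (nth_lt_input_size i) _; rewrite leq_exp2l // /word_bits; nia.
Qed.

Lemma run_prog p y k E : 0 < E -> k <= 900 * sz ^ 6 * E ->
  wp word_bits 300 p (init_memory inp) k (fun m => m 0 0 = y) ->
  exists2 t, computes p inp t y & t <= time_bound E.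
Proof.
move=> E0 kE W; have [m [t [Ex tk _ my]]] := wp_run W bounded_init.
by exists t; [exists m | apply: steps_le kE tk].
Qed.

Hypothesis wt_le : forall u x, u < n -> x < n -> weight n inp u x <= maxn l 1.

Theorem prog_computes (E := 2 ^ n * l.+1 ^ n./2) :
  exists2 t, computes prog inp t
    (if l * (n - 1) != 0 then total_count n (weight n inp) s else s ^ n) &
    t <= time_bound E.
Proof.
have [Z1 ZM Zn nZ [Zs Zc]] := small_values.
have E0 : 0 < E by rewrite /E muln_gt0 !expn_gt0.
have H := size_le_input_size.
have wb0 := word_bits_gt0.
have Zb : Z <= 2 ^ word_bits by rewrite word_bitsE -{1}[Z]expn1 leq_exp2l //; lia.
have e : eval (init_memory inp) (emul eL (esub eN eone)) = l * (n - 1) by rewrite /= /init_memory /= inp0 inp1.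
have n_pow j : n ^ j <= sz ^ j by case: j => // j; rewrite leq_exp2r //; lia.
case: eqP => [triv|nontriv].
  apply: (@run_prog _ _ (n * 3 + 4).+1) => //.
    rewrite -mulnA; apply: leq_trans (_ : 900 * (sz * 1) <= _); first lia.
    by rewrite leq_mul2l leq_mul // -{1}[sz]expn1 leq_pexp2l //; lia.
  apply: wp_if => //; rewrite e; first by rewrite triv.
  move=> _; apply: wp_power => //; first by apply: leq_trans Zb.
  move=> i ile; apply: leq_ltn_trans (exp_lt_word (a := s.+1) _); last lia.
  by apply: (@leq_trans (s.+1 ^ i)); [case: (i) => // j; rewrite leq_exp2r | rewrite leq_pexp2l].
have n1 : 1 < n by move: nontriv; nia.
have l0 : 0 < l by move: nontriv; nia.
have tie := @weight_tie n inp.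
have wt_le' u x : u < n -> x < n -> weight n inp u x <= l.
  by move=> un xn; have := wt_le un xn; lia.
apply: (@run_prog _ _
  ((n * (n * l + 2) + size (all_keys n l (weight n inp))) * (n * (n * 4 + 30) + 52) +
    n * (n * 4 + 20) + 20).+1) => //; last first.
  apply: wp_if => //; rewrite e; last by move=> ?; case: nontriv.
  move=> _; apply: wp_count => //.
  - rewrite word_bitsE; apply: (@leq_ltn_trans (Z ^ n * (n * n.+1 + 1))).
      have : (n * l + 2) ^ n <= Z ^ n by rewrite leq_exp2r //; lia.
      have : 0 < Z ^ n by rewrite expn_gt0; lia.
      by move: ((n * l + 2) ^ n) (Z ^ n) => x y; nia.
    rewrite expnD ltn_mul2l expn_gt0 (ltnW Z1) /=; apply: leq_trans Zn _.
    by rewrite -{1}[Z]expn1 leq_exp2l.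
  - rewrite word_bitsE expnD -[Z ^ 2]mulnn; apply: leq_trans (_ : Z * Z <= _).
      by nia.
    by rewrite leq_pmull // expn_gt0 (ltnW Z1).
  - by apply: leq_ltn_trans (total_count_le _ _ tie) _; apply: exp_lt_word.
  - by apply: leq_ltn_trans (total_count_le _ _ tie) _; apply: exp_lt_word; lia.
  - move=> a i ale ile; apply: leq_ltn_trans (bin_le_exp _ _) _.
    apply: leq_ltn_trans (exp_lt_word (a := a.+1) _); last lia.
    by rewrite leq_pexp2l.
have hm : 0 < n./2 by rewrite half_gt0.
have lE : l.+1 <= E.
  apply: (@leq_trans (l.+1 ^ n./2)); first by rewrite -{1}[l.+1]expn1 leq_pexp2l.
  by rewrite /E leq_pmull // expn_gt0.
have R1 : n * (n * l + 2) <= n * n * E.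
  rewrite -mulnA leq_mul2l; apply/orP; right; nia.
have B1 := size_all_keys l (weight n inp) n1; rewrite -/E in B1.
(* At most [n ^ 2 * E] ranks and [4 * n ^ 3 * n.+1 * E] keys; with [n.+1 <= 2 * sz] this gives 1 +
   8. Times the 86 of [R3], plus the 45 of [R5], it stays below 900. *)
have R2 : n * (n * l + 2) + size (all_keys n l (weight n inp)) <= 9 * sz ^ 4 * E.
  apply: leq_trans (leq_add R1 B1) _; rewrite -mulnDl leq_mul2r; apply/orP; right.
  have -> : 9 * sz ^ 4 = sz ^ 4 + 4 * sz ^ 3 * (2 * sz) by rewrite (expnS _ 3); move: (sz ^ 3) => x; lia.
  apply: leq_add; last by rewrite leq_mul ?leq_mul ?n_pow //; lia.
  by apply: leq_trans (n_pow 2) _; rewrite leq_pexp2l //; lia.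
have nn : n * n <= sz ^ 2 by rewrite mulnn n_pow.
have zz : sz <= sz ^ 2 by rewrite -{1}[sz]expn1 leq_pexp2l //; lia.
have R3 : n * (n * 4 + 30) + 52 <= 86 * sz ^ 2 by rewrite mulnDr mulnA; lia.
have R4 : n * (n * 4 + 20) + 20 < 45 * sz ^ 2 by rewrite mulnDr mulnA; lia.
have R5 : 45 * sz ^ 2 <= 45 * sz ^ 6 * E.
  rewrite -mulnA leq_mul2l /= -[sz ^ 2]muln1 leq_mul // leq_pexp2l //; lia.
rewrite -addnA -addnS; apply: leq_trans (leq_add (leq_mul R2 R3) R4) _.
apply: leq_trans (leq_add (leqnn _) R5) _.
rewrite (_ : sz ^ 6 = sz ^ 4 * sz ^ 2); last by rewrite -expnD.
move: (sz ^ 4) (sz ^ 2) => x y.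
have -> : 9 * x * E * (86 * y) = 774 * (x * y * E) by lia.
by rewrite -[45 * _ * E]mulnA -[900 * _ * E]mulnA -mulnDl leq_mul2r; apply/orP; right; lia.
Qed.
End Run.

Lemma nth_allpairs (T1 T2 : Type) (f : T1 -> T2 -> nat) s t x y i j :
  i < size s -> j < size t ->
  nth 0 [seq f a c | a <- s, c <- t] (i * size t + j) = f (nth x s i) (nth y t j).
Proof.
move=> + jt; elim: s i => //= a s IH [|i] si; rewrite nth_cat size_map.
  by rewrite mul0n add0n jt (nth_map y).
by rewrite ltnNge mulSn -addnA leq_addr /= addKn IH.
Qed.

(** * From the vertices of [V] to indices *)

Section Link.
Variables (V : finType) (l s : nat) (w : V -> V -> nat).
Notation inp := (encode l s w).
Notation n := #|V|.

Lemma nth_encode (u x : 'I_n) : nth 0 inp (3 + (u * n + x)) = w (enum_val u) (enum_val x).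
Proof.
have sV : size (enum V) = n by rewrite -cardE.
have un : u < size (enum V) by rewrite sV.
have xn : x < size (enum V) by rewrite sV.
have := nth_allpairs w (enum_val u) (enum_val x) un xn; rewrite sV /= => ->.
by congr w; rewrite -enum_val_nth.
Qed.

Lemma size_encode : size inp = 3 + n * n.
Proof. by rewrite /= size_allpairs -!cardE. Qed.

(** Tie-breaking does not affect properness: unequal colours differ by at least 1 anyway, and two
    vertices of equal colour and weight 0 are separated with the smaller index first. The initial
    bounds 1 exclude colour 0. *)
Lemma num_properE : weight_function w -> num_proper s w = total_count n (weight n inp) s.
Proof.
move=> sym; rewrite /total_count -(card_fits (@weight_tie n inp)); last by rewrite num_placed_one subn0.
pose re (c : {ffun V -> 'I_s.+1}) : {ffun 'I_n -> 'I_s.+1} := [ffun i => c (enum_val i)].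
have re_inj : injective re.
  move=> c c' /ffunP E; apply/ffunP => x.
  by have := E (enum_rank x); rewrite !ffunE enum_rankK.
rewrite /num_proper -(card_imset _ re_inj); congr #|pred_of_set _|; apply/setP => c'.
rewrite inE; apply/imsetP/idP => [[c + ->]|/andP[/forallP F1 /forallP F2]].
  rewrite inE => /andP[/forallP c0 /forallP P]; apply/andP; split; apply/forallP => x /=.
    by rewrite ffunE c0.
  apply/forallP => y; rewrite !ffunE andbT; apply/implyP => xy.
  have /forallP/(_ (enum_val y))/implyP := P (enum_val x).
  rewrite (inj_eq enum_val_inj) => /(_ xy).
  rewrite /sep /weight !nth_encode (sym (enum_val y)).
  have : x != y :> nat by [].
  move: (w _ _) (c _) (c _) => a p q; lia.
exists [ffun x => c' (enum_rank x)]; last by apply/ffunP => i; rewrite !ffunE enum_valK.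
rewrite inE; apply/andP; split; apply/forallP => x.
  by have := F1 (enum_rank x); rewrite ffunE.
apply/forallP => y; apply/implyP => xy; rewrite !ffunE.
have /forallP/(_ (enum_rank y)) := F2 (enum_rank x).
have xy' : enum_rank x != enum_rank y by rewrite (inj_eq enum_rank_inj).
rewrite xy' /= /sep /weight !nth_encode !enum_rankK (sym y).
have : enum_rank x != enum_rank y :> nat by [].
move: (w _ _) (c' _) (c' _) => a p q; lia.
Qed.

Lemma num_proper_trivial : bounded_by l w -> l * (n - 1) = 0 -> num_proper s w = s ^ n.
Proof.
move=> wl /eqP; rewrite muln_eq0 subn_eq0 => triv.
have card_pos : #|[pred i : 'I_s.+1 | 0 < i]| = s.
  have := cardC (pred1 (ord0 : 'I_s.+1)); rewrite card1 card_ord add1n => -[E]; rewrite -[RHS]E.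
  by apply: eq_card => i; rewrite !inE lt0n.
rewrite -{2}card_pos -card_ffun_on -cardsE /num_proper; congr #|pred_of_set _|; apply/setP => c; rewrite !inE.
have -> : proper_assignment w (fun x => c x) by
  apply/forallP => x; apply/forallP => y; apply/implyP => xy;
  case/orP: triv => [/eqP l0|/card_le1_eqP /(_ x y isT isT) E];
  [have := wl x y; rewrite l0 leqn0 => /eqP -> | case/eqP: xy].
by rewrite andbT; apply/forallP/ffun_onP => H x; have := H x; rewrite inE.
Qed.

Lemma prog_counts : weight_function w -> bounded_by l w ->
  exists2 t, computes prog inp t (num_proper s w) &
    t <= time_bound inp (2 ^ n * l.+1 ^ n./2).
Proof.
move=> sym wl.
have wt_le u x : u < n -> x < n -> weight n inp u x <= maxn l 1.
  move=> un xn; rewrite /weight (nth_encode (Ordinal un) (Ordinal xn)) geq_max.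
  by have := wl (enum_val (Ordinal un)) (enum_val (Ordinal xn)); case: (x < u); lia.
have [||t Ct tE] := @prog_computes n l s inp erefl erefl erefl _ _ wt_le.
- by rewrite size_encode; nia.
- by rewrite size_encode.
exists t => //; move: Ct; case: eqP => [triv|_] /=.
  by rewrite num_proper_trivial.
by rewrite num_properE.
Qed.
End Link.

Import Order.TTheory GRing.Theory Num.Theory.

Local Open Scope ring_scope.

Theorem theorem2 (R : realType) :
  exists (p : com) (C k : nat),
    forall (V : finType) (l s : nat) (w : V -> V -> nat),
      weight_function w -> bounded_by l w -> (0 < s)%N ->
      exists t : nat,
        computes p (encode l s w) t (num_proper s w) /\
        t%:R <= C%:R * (input_size (encode l s w))%:R ^+ k *
                (2 ^+ #|V| * (l%:R + 1) `^ (#|V|%:R / 2)) :> R.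
Proof.
exists prog, (900 * (2 * 300 ^ 2 * 6 + 1))%N, 8 => V l s w sym wl _.
have [t Ct tE] := prog_counts s sym wl; exists t; split=> //.
(* The program attains the exponent rounded down; the base is at least 1, so the real power is no
   smaller. *)
have root_le : (l%:R + 1) ^+ #|V|./2 <= (l%:R + 1) `^ (#|V|%:R / 2) :> R.
  have l1 : 1 <= l%:R + 1 :> R by rewrite lerDr.
  rewrite -powR_mulrn ?(le_trans ler01) // ler_powR // ler_pdivlMr //.
  by rewrite -natrM ler_nat muln2 -{2}(odd_double_half #|V|) leq_addl.
apply: (@le_trans _ _ (time_bound (encode l s w) (2 ^ #|V| * l.+1 ^ #|V|./2))%:R).
  by rewrite ler_nat.
rewrite /time_bound; move: (900 * _)%N => C.
rewrite natrM natrM natrX natrM natrX natrX -[l.+1%:R]natr1.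
by rewrite ler_wpM2l ?ler_wpM2l ?mulr_ge0 ?exprn_ge0 ?ler0n.
Qed.
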